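(* Fix an inverse temperature $\beta>0$. Let $H$ be an energy functional of the form $H(\gamma)=\sum_{i=1}^N\Psi(\mathbf x_i)+\sum_{1\le i<j\le N}\Phi(\mathbf x_i,\mathbf x_j)$ for $\gamma=\{\mathbf x_1,\dots,\mathbf x_N\}\in\mathcal M_f$, where $\Psi:\mathcal E\to\mathbb R\cup\{+\infty\}$ and the symmetric function $\Phi:\mathcal E\times\mathcal E\to\mathbb R\cup\{+\infty\}$ are measurable. Assume that there exist measurable functions $\mathsf b:\mathcal E\to\mathbb R_+$ and $\mathsf a:\mathcal E\to[a,+\infty)$, with $a>0$ a constant, such that: (1) there exists $A_\Psi>0$ with $\inf_{x\in\mathbb R^d}\Psi(x,m)\ge -A_\Psi\|m\|^{d+\delta}$ for all $m\in\mathcal S$; (2) (Weak stability) for any finite set $\{\mathbf x_0,\dots,\mathbf x_N\}\subset\mathcal E$ there is an index $j\in\{0,\dots,N\}$ such that $\beta\sum_{i\ne j}\Phi(\mathbf x_j,\mathbf x_i)\ge-\mathsf b(\mathbf x_j)$; (3) (Weighted regularity) there is a critical activity $z_{\mathrm{crit}}(\beta)>0$ such that, for any $\mathbf x\in\mathcal E$, $$z_{\mathrm{crit}}(\beta)\int_{\mathcal E}e^{\mathsf a(\mathbf y)+\mathsf b(\mathbf y)}\big|e^{-\beta\Phi(\mathbf x,\mathbf y)}-1\big|\,\sigma(d\mathbf y)\le\mathsf a(\mathbf x),$$ and $\int_A e^{\mathsf a(\mathbf x)+\mathsf b(\mathbf x)}\sigma(d\mathbf x)<+\infty$ for any bounded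 $A\subset\mathcal E$; (4) (Non-uniform Ruelle bound) for any $z\in(0,z_{\mathrm{crit}}(\beta))$, any $P\in\mathcal G_{z,\beta}(H)$ and any $N\ge1$, for $\sigma^{\otimes N}$-almost all $(\mathbf x_1,\dots,\mathbf x_N)\in\mathcal E^N$, $\rho_N^{(P)}(\mathbf x_1,\dots,\mathbf x_N)\le\prod_{i=1}^Ne^{\mathsf a(\mathbf x_i)+\mathsf b(\mathbf x_i)}$. Then for any $z\in(0,z_{\mathrm{crit}}(\beta))$ there exists at most one infinite-volume Gibbs point process $P$ in $\mathcal G_{z,\beta}(H)$.
   Context: Setting. Fix $d\ge 1$ and $\delta>0$. $(\mathcal S,\|\cdot\|)$ is a normed space (the mark space), $\mathcal E=\mathbb R^d\times\mathcal S$, with points $\mathbf x=(x,m)$, and $\mathbf R$ is a probability measure on $\mathcal S$ with $\int_{\mathcal S}e^{\|m\|^{d+2\delta}}\mathbf R(dm)<+\infty$. Put $\lambda(dx,dm)=dx\otimes\mathbf R(dm)$ and $\sigma(d\mathbf x)=e^{-\beta\Psi(\mathbf x)}\lambda(d\mathbf x)$ on $\mathcal E$. Configurations. $\mathcal M$ is the space of $\sigma$-finite simple point measures $\gamma=\sum_i\delta_{\mathbf x_i}$ on $\mathcal E$ ($\mathbf x_i\ne\mathbf x_j$ for $i\neq j$), identified with their sets of atoms; $\mathcal M_f$ is the subset of finite ones, and $\underline o$ is the empty configuration. For $\Lambda\subset\mathbb R^d$, $\gamma_\Lambda=\gamma\cap(\Lambda\times\mathcal S)$, and $\mathcal M_\Lambda$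 is the set of configurations supported in $\Lambda\times\mathcal S$. For disjoint configurations, $\gamma\xi=\gamma\cup\xi$. $\mathcal B_b(\mathbb R^d)$ is the set of bounded Borel subsets of $\mathbb R^d$; $|\Lambda|$ is the volume of $\Lambda$. Poisson process. For $z>0$, $\tilde\pi^z=1+\sum_{N\ge1}\frac{z^N}{N!}\lambda^{\otimes N}$ on $\mathcal M_f$ (the term $1$ is a unit mass at $\underline o$); for $\Lambda\in\mathcal B_b(\mathbb R^d)$, $\tilde\pi^z_\Lambda$ is its restriction to $\mathcal M_\Lambda$ and $\pi^z_\Lambda=e^{-z|\Lambda|}\tilde\pi^z_\Lambda$. Energies. $H(\underline o)=0$. $E_\Phi(\{\mathbf x_1,\dots,\mathbf x_N\})=\sum_{i<j}\Phi(\mathbf x_i,\mathbf x_j)$; $E_\Phi(\mathbf x\,|\,\xi)=\sum_{\mathbf y\in\xi}\Phi(\mathbf x,\mathbf y)$ and $E_\Phi(\gamma\,|\,\xi)=\sum_{\mathbf x\in\gamma}E_\Phi(\mathbf x\,|\,\xi)$ (conditional energy). Convention $e^{-\infty}=0$. Gibbs point processes. A probability measure $P$ on $\mathcal M$ is an infinite-volume Gibbs point process with energy functional $H$, activity $z>0$ and inverse temperature $\beta>0$, written $P\in\mathcal G_{z,\beta}(H)$, if for every $\Lambda\in\mathcal B_b(\mathbb R^d)$: for any $\gamma\in\mathcal M_f$ and $P$-almost all $\xi\in\mathcal M$ the conditional energy $E_\Phi(\gamma_\Lambda\,|\,\xi_{\Lambda^c})$ is well defined, and for any positive, bounded, measurable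 $F:\mathcal M\to\mathbb R$, $$\int_{\mathcal M}F(\gamma)P(d\gamma)=\int_{\mathcal M}\frac1{Z^{z,\beta}_\Lambda(\xi)}\int_{\mathcal M_\Lambda}F(\gamma_\Lambda\xi_{\Lambda^c})e^{-\beta(H(\gamma_\Lambda)+E_\Phi(\gamma_\Lambda|\xi_{\Lambda^c}))}\pi^z_\Lambda(d\gamma)\,P(d\xi),$$ where $Z^{z,\beta}_\Lambda(\xi)$ is the normalising constant (partition function) of the inner integral. Correlation functions. For $\gamma\in\mathcal M$ the factorial measure of order $N$ is $\gamma^{(N)}(d\mathbf x_1,\dots,d\mathbf x_N)=\gamma(d\mathbf x_1)(\gamma\setminus\{\mathbf x_1\})(d\mathbf x_2)\cdots(\gamma\setminus\{\mathbf x_1,\dots,\mathbf x_{N-1}\})(d\mathbf x_N)$; the $N$-th factorial moment measure of $P$ is $\alpha_N^{(P)}(\cdot)=\mathbb E_P[\gamma^{(N)}(\cdot)]$ on $\mathcal E^N$. For $P\in\mathcal G_{z,\beta}(H)$, the $N$-point correlation function $\rho_N^{(P)}$ is the Radon–Nikodym derivative of $\alpha_N^{(P)}$ with respect to $(z\sigma)^{\otimes N}$; it is known to admit, $\sigma^{\otimes N}$-a.e., the representation $\rho_N^{(P)}(\mathbf x_1,\dots,\mathbf x_N)=e^{-\beta E_\Phi(\{\mathbf x_1,\dots,\mathbf x_N\})}\int_{\mathcal M}e^{-\beta E_\Phi(\{\mathbf x_1,\dots,\mathbf x_N\}|\xi)}P(d\xi)$. *)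

(* Defs.v *)
From HB Require Import structures.
From mathcomp Require Import all_boot all_order all_algebra finmap.
From mathcomp Require Import all_classical all_reals all_analysis.
From mathcomp Require Import measurable_realfun.

Set Implicit Arguments.
Unset Strict Implicit.
Unset Printing Implicit Defensive.

Import Order.TTheory GRing.Theory Num.Theory.
Import numFieldNormedType.Exports.

Local Open Scope classical_set_scope.
Local Open Scope card_scope.
Local Open Scope ring_scope.
Local Open Scope ereal_scope.

Section power_measure.
Context d (T : measurableType d) (R : realType).
Implicit Types m : set T -> \bar R.

(* the n-fold product measure of m *)
Fixpoint mpow m (n : nat) : set (n.-tuple T) -> \bar R :=
  match n with
  | 0 => \d_([tuple] : 0.-tuple T)
  | k.+1 =>
    pushforward (m \x @mpow m k) (fun p : T * k.-tuple T => cons_tuple p.1 p.2)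
  end.

End power_measure.
Arguments mpow {d T R} m n _.

(* The library's own sigma-finiteness instance for \x is shadowed by the one
   for pairs of subprobabilities. *)
Lemma sigma_finite_product d1 d2 (T1 : measurableType d1)
    (T2 : measurableType d2) (R : realType)
    (m1 : {sigma_finite_measure set T1 -> \bar R})
    (m2 : {sigma_finite_measure set T2 -> \bar R}) :
  sigma_finite setT (m1 \x m2).
Proof.
have /sigma_finiteP[F [TF ndF Foo]] := sigma_finiteT m1.
have /sigma_finiteP[G [TG ndG Goo]] := sigma_finiteT m2.
exists (fun n => F n `*` G n).
  rewrite -setXTT TF TG predeqE => -[x y]; split.
    move=> [/= [n _ Fnx] [k _ Gky]]; exists (maxn n k) => //; split.
    - by move: x Fnx; exact/subsetPset/ndF/leq_maxl.
    - by move: y Gky; exact/subsetPset/ndG/leq_maxr.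
  by move=> [n _ []/= ? ?]; split; exists n.
move=> k; have [? ?] := Foo k; have [? ?] := Goo k.
split; first exact: measurableX.
by rewrite product_measure1E// lte_mul_pinfty// ge0_fin_numE.
Qed.

Section power_measure_step.
Context d (T : measurableType d) (R : realType) (n : nat).
Variables (m : {sigma_finite_measure set T -> \bar R}).
Variables (nu : {sigma_finite_measure set (n.-tuple T) -> \bar R}).

Let f (p : T * n.-tuple T) := cons_tuple p.1 p.2.
Let mf : measurable_fun setT f. Proof. exact: measurable_cons. Qed.

Definition mpow_step := pushforward (m \x nu) f.

Let step0 : mpow_step set0 = 0.
Proof. exact: measure0. Qed.

Let step_ge0 A : 0 <= mpow_step A.
Proof. exact: measure_ge0. Qed.

Let step_sigma_additive : semi_sigma_additive mpow_step.
Proof.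
move=> F mF tF mUF; rewrite /mpow_step /pushforward preimage_bigcup.
apply: measure_semi_sigma_additive.
- by move=> k; rewrite -[X in measurable X]setTI; exact: mf.
- apply/trivIsetP => /= i j _ _ ij; rewrite -preimage_setI.
  by move/trivIsetP : tF => /(_ _ _ _ _ ij) ->//; rewrite preimage_set0.
- by rewrite -preimage_bigcup -[X in measurable X]setTI; exact: mf.
Qed.

HB.instance Definition _ := isMeasure.Build _ _ _ mpow_step
  step0 step_ge0 step_sigma_additive.

Let step_sigma_finite : sigma_finite setT mpow_step.
Proof.
have [F FT Foo] := sigma_finite_product m nu.
pose g (t : n.+1.-tuple T) : T * n.-tuple T := (thead t, [tuple of behead t]).
have mg : measurable_fun setT g.
  apply/measurable_fun_pairP; split; last exact: measurable_behead.
  exact: measurable_tnth.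
exists (fun k => g @^-1` F k).
  by rewrite -preimage_bigcup -FT preimage_setT.
move=> k; have [mFk Fkoo] := Foo k; split.
  by rewrite -[X in measurable X]setTI; exact: mg.
rewrite /mpow_step /pushforward -comp_preimage.
rewrite (_ : g \o f = id)//; apply/funext => -[x t]; rewrite /g /f/= theadE.
by congr pair; apply/val_inj.
Qed.

HB.instance Definition _ := Measure_isSigmaFinite.Build _ _ _ mpow_step
  step_sigma_finite.

End power_measure_step.

Section power_measure_sigma_finite.
Context d (T : measurableType d) (R : realType) (n : nat).
Variable m : {sigma_finite_measure set T -> \bar R}.

Let mpowP : exists nu : {sigma_finite_measure set (n.-tuple T) -> \bar R},
  mpow m n = nu.
Proof.
elim: n => [|k [nu kE]]/=; last by exists (mpow_step m nu); rewrite kE.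
by exists (\d_([tuple] : 0.-tuple T))%R.
Qed.

Let mpow0 : mpow m n set0 = 0.
Proof. by have [nu ->] := mpowP. Qed.

Let mpow_ge0 A : 0 <= mpow m n A.
Proof. by have [nu ->] := mpowP. Qed.

Let mpow_sigma_additive : semi_sigma_additive (mpow m n).
Proof. have [nu ->] := mpowP; exact: measure_semi_sigma_additive. Qed.

Let mpow_sigma_finite : sigma_finite setT (mpow m n).
Proof. have [nu ->] := mpowP; exact: sigma_finiteT. Qed.

HB.instance Definition _ := isMeasure.Build _ _ _ (mpow m n)
  mpow0 mpow_ge0 mpow_sigma_additive.
HB.instance Definition _ := Measure_isSigmaFinite.Build _ _ _ (mpow m n)
  mpow_sigma_finite.

End power_measure_sigma_finite.

Section configurations.
Context d (T : measurableType d).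

(* A simple point measure \sum_i \d_(x_i) is identified with its set of atoms;
   it is sigma-finite iff this set is countable. *)
Record config := Config {
  atoms :> set T;
  countable_atoms : countable atoms }.

HB.instance Definition _ := gen_eqMixin config.
HB.instance Definition _ := gen_choiceMixin config.
HB.instance Definition _ := isPointed.Build config (Config (countable0 T)).

Lemma countable_restr (g : config) (A : set T) : countable (g `&` A).
Proof.
exact: sub_countable (subset_card_le (@subIsetl _ g A)) (countable_atoms g).
Qed.

Definition restr (g : config) (A : set T) : config :=
  Config (countable_restr g A).

Lemma countable_superpose (g h : config) : countable (g `|` h).
Proof.
rewrite (_ : g `|` h = \bigcup_(b in [set: bool]) if b then g else h).
  apply: bigcup_countable; first exact/finite_set_countable/finite_finset.
  by case=> _; exact: countable_atoms.
by apply/seteqP; split => [x [?|?]|x [[] _ ?]];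
  [exists true|exists false|left|right].
Qed.

Definition superpose (g h : config) : config :=
  Config (countable_superpose g h).

Definition config_seq (s : seq T) : config :=
  Config (finite_set_countable (finite_seq s)).

Definition config_display : measure_display.
Proof. by constructor. Qed.

(* generated by the counting maps g |-> g(B), B measurable: the sets
   {g(B) = k}, k a natural number, also determine the event {g(B) = +oo} *)
Definition config_measurable : set (set config) :=
  <<s [set [set g : config | g `&` B #= `I_k] | B in measurable & k in setT] >>.

Let config_measurable0 : config_measurable set0.
Proof. exact: sigma_algebra0. Qed.

Let config_measurableC (U : set config) :
  config_measurable U -> config_measurable (~` U).
Proof. exact: sigma_algebraC. Qed.

Let config_measurableU (F : (set config)^nat) :
  (forall i, config_measurable (F i)) -> config_measurable (\bigcup_i F i).
Proof. exact: sigma_algebra_bigcup. Qed.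

HB.instance Definition _ := @isMeasurable.Build config_display config
  config_measurable config_measurable0 config_measurableC config_measurableU.

End configurations.

(* The mark space carries its Borel sigma-algebra; R^d is d.-tuple R with the
   product sigma-algebra. *)
Notation mark S := (g_sigma_algebraType (@open S)).
Notation Rspace R d := (d.-tuple (measurableTypeR R)).
Notation mpoint R d S := (Rspace R d * mark S)%type.

Section marked_points.
Context (R : realType) (d : nat) (S : normedModType R).
Variable Q : probability (mark S) R.
Local Notation E := (mpoint R d S).

Definition bounded_window (L : set (Rspace R d)) :=
  exists M : R, forall x, L x -> forall i, (`|tnth x i : R| <= M)%R.

Definition bounded_region (A : set E) :=
  exists M : R, forall x, A x ->
    (forall i, (`|tnth x.1 i : R| <= M)%R) /\ (`|x.2 : S| <= M)%R.

Definition volume : set (Rspace R d) -> \bar R := mpow lebesgue_measure d.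

Definition lam : set E -> \bar R := volume \x Q.

HB.instance Definition _ := SigmaFiniteMeasure.on volume.
HB.instance Definition _ := Measure.on lam.
HB.instance Definition _ := Measure_isSigmaFinite.Build _ _ _ lam
  (@sigma_finite_product _ _ _ _ _ volume Q).

(* g_L : the atoms with position in L *)
Definition window (g : config E) (L : set (Rspace R d)) : config E :=
  restr g (L `*` setT).

Definition supported_in (L : set (Rspace R d)) : set (config E) :=
  [set g | g `<=` L `*` setT].

(* \tilde\pi^z. Tuples with two equal positions are lam^N-null; discarding them
   keeps t |-> {t_1, .., t_N} measurable when S is not separable. *)
Definition poisson_unnormalized (z : R) (A : set (config E)) : \bar R :=
  \sum_(0 <= N <oo) (z ^+ N / N`!%:R)%:E *
    mpow lam N [set t : N.-tuple E |
      uniq [seq x.1 | x <- t] /\ A (config_seq t)].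

Definition poisson_in (z : R) (L : set (Rspace R d)) (A : set (config E)) :=
  expeR (- (z%:E * volume L)) * poisson_unnormalized z (A `&` supported_in L).

End marked_points.

Section energies.
Context (R : realType) (d : nat) (S : normedModType R).
Local Notation E := (mpoint R d S).
Variables (Psi : E -> \bar R) (Phi : E -> E -> \bar R).

Definition pair_energy (s : seq E) : \bar R :=
  \sum_(i < size s) \sum_(j < size s | (i < j)%N)
    Phi (tnth (in_tuple s) i) (tnth (in_tuple s) j).

(* For finite g. The enumeration chosen by fset_set is immaterial when Phi is
   symmetric. *)
Definition energy (g : config E) : \bar R :=
  \sum_(x <- fset_set g) Psi x + pair_energy (fset_set g).

(* E_Phi(g | xi) is well defined when the negative parts are summable, so that
   each E_Phi(x | xi), x in g, is a sum in ]-oo, +oo]. Otherwise point_energy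
   below is -oo by convention. *)
Definition cond_energy_defined (g xi : config E) : Prop :=
  forall x, atoms g x -> \esum_(y in xi) (Phi x)^\- y < +oo.

Definition point_energy (x : E) (xi : config E) : \bar R :=
  \esum_(y in xi) (Phi x)^\+ y - \esum_(y in xi) (Phi x)^\- y.

Definition cond_energy (g xi : config E) : \bar R :=
  \sum_(x \in g) point_energy x xi.

End energies.

Section gibbs.
Context (R : realType) (d : nat) (S : normedModType R).
Variable Q : probability (mark S) R.
Local Notation E := (mpoint R d S).
Variables (Psi : E -> \bar R) (Phi : E -> E -> \bar R) (z beta : R).

Definition gibbs_weight (L : set (Rspace R d)) (g xi : config E) : \bar R :=
  expeR (- (beta%:E * (energy Psi Phi (window g L) +
                       cond_energy Phi (window g L) (window xi (~` L))))).

Definition partition_function (L : set (Rspace R d)) (xi : config E) : \bar R :=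
  \int[poisson_in Q z L]_(g in supported_in L) gibbs_weight L g xi.

(* The inverse of +oo is 0 and 0 * +oo = 0, so that the equation for F = 1
   forces the partition function to be finite P-almost surely. *)
Definition gibbs (P : probability (config E) R) : Prop :=
  forall L : set (Rspace R d), measurable L -> bounded_window L ->
    (forall g : config E, finite_set g ->
      {ae P, forall xi, cond_energy_defined Phi (window g L)
                                             (window xi (~` L))}) /\
    (forall F : config E -> R, measurable_fun setT F ->
      (forall g, (0 <= F g)%R) -> (exists K : R, forall g, (F g <= K)%R) ->
      \int[P]_g (F g)%:E =
      \int[P]_xi ((partition_function L xi)^-1 *
        \int[poisson_in Q z L]_(g in supported_in L)
          ((F (superpose (window g L) (window xi (~` L))))%:E *
           gibbs_weight L g xi))).

End gibbs.

Section correlations.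
Context d (T : measurableType d) (R : realType).

(* g^(N)(dx_1 .. dx_N) = g(dx_1) (g \ {x_1})(dx_2) .. *)
Fixpoint factorial_measure (N : nat) (g : set T) : set (N.-tuple T) -> \bar R :=
  match N with
  | 0 => \d_([tuple] : 0.-tuple T)
  | k.+1 => fun B => \esum_(x in g)
      @factorial_measure k (g `\ x) [set t : k.-tuple T | B (cons_tuple x t)]
  end.

Definition factorial_moment (P : probability (config T) R) (N : nat)
    (B : set (N.-tuple T)) : \bar R :=
  \int[P]_g factorial_measure g B.

(* rho is a version of the density of the N-th factorial moment measure of P
   with respect to m^N *)
Definition correlation_function (m : set T -> \bar R)
    (P : probability (config T) R) (N : nat) (rho : N.-tuple T -> \bar R) :=
  [/\ measurable_fun setT rho, (forall t, 0 <= rho t) &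
    forall B, measurable B ->
      factorial_moment P B = \int[mpow m N]_(t in B) rho t].

End correlations.

Definition sigma (R : realType) (d : nat) (S : normedModType R)
    (Q : probability (mark S) R) (Psi : mpoint R d S -> \bar R) (beta : R)
    (A : set (mpoint R d S)) : \bar R :=
  \int[lam Q]_(x in A) expeR (- (beta%:E * Psi x)).

(* Main.v *)
(* A Gibbs process satisfies the multivariate Mecke (GNZ) equation, so its
   correlation functions are rho(x_1, .., x_N) =
   prod_(i<j) e^{-beta Phi(x_i, x_j)} * E[prod_i e^{-beta E(x_i | xi)}].
   Expanding e^{-beta E(x | xi)} = prod_(y in xi) (1 + f(x, y)), with
   f = e^{-beta Phi} - 1, into sums over finite subsets of xi and applying the
   Mecke equation again expresses rho(x, x') through the functions rho(x', y):
   these are the Kirkwood-Salsburg equations.  The alternating expansion need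
   not converge absolutely before it is integrated, so terms of either sign are
   kept on their own side of each equation.

   If two solutions differ by at most c prod_i e^{a(x_i) + b(x_i)}, then choosing
   x by weak stability bounds the product of the e^{-beta Phi(x, x_i)} by e^{b(x)},
   and weighted regularity bounds the remaining series by e^{(z / zcrit) a(x)};
   hence they differ by at most e^{-(1 - z / zcrit) a0} c prod_i e^{a(x_i) + b(x_i)}.
   The Ruelle bound starts this iteration at c = 1, so the correlation functions
   coincide.  The same expansion with f = - 1_B recovers the void probabilities
   P(xi(B) = 0) from them, and these determine the law of a simple point process. *)
From HB Require Import structures.
Require Import Defs.
From mathcomp Require Import all_boot all_order all_algebra finmap.
From mathcomp Require Import all_classical all_reals all_analysis.
From mathcomp Require Import measurable_realfun ring lra zify.

Set Implicit Arguments.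
Unset Strict Implicit.
Unset Printing Implicit Defensive.

Import Order.TTheory GRing.Theory Num.Theory.
Import numFieldNormedType.Exports.

Local Open Scope classical_set_scope.
Local Open Scope ring_scope.
Local Open Scope ereal_scope.

(** * Integrals of non-negative functions and iterated integrals *)

(** Three obstacles shape the proof. The mark space may be non-separable, and then the diagonal of
    the product can fail to be measurable; points are therefore told apart by their positions, which
    almost surely never coincide because hyperplanes of [R^d] are Lebesgue null. Next, the integrand
    of the Gibbs equation, with its conventions for infinite or undefined energies, is not known to
    be measurable in the configuration: it is replaced, off a null set, by a measurable function of
    finite sequences of points, integrated one variable at a time. Finally, the Ruelle bound and
    every comparison deduced from it hold only almost everywhere, whereas the point chosen by weak
    stability depends on the configuration; almost-everywhere statements are therefore given a form
    that pulls back along the deletion of any coordinate. The partition function is never evaluated: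
    it is carried as an abstract factor through the derivation of the Mecke equation and reabsorbed
    at the end. *)

Section integral_without_measurability.
Import HBNNSimple.
Context d (T : measurableType d) (R : realType).
Variable mu : {measure set T -> \bar R}.
Implicit Types f g : T -> \bar R.

(** The integral of a non-negative function is a supremum over the simple functions below it, and
    this supremum is monotone even for non-measurable functions. The integrands of the Gibbs
    equation require this generality. *)
Lemma ge0_le_integralW f g : (forall x, 0 <= f x) -> (forall x, f x <= g x) ->
  \int[mu]_x f x <= \int[mu]_x g x.
Proof.
move=> f0 fg; have g0 x : 0 <= g x by exact: le_trans (f0 x) (fg x).
rewrite !ge0_integralTE//; apply: le_ereal_sup => _ [h hf <-].
by exists h => // x; exact: le_trans (hf x) (fg x).
Qed.

(** Each simple function below [f] can be cut down to [G] without changing its integral, so the two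
    suprema agree although [f] may be non-measurable. *)
Lemma ge0_integral_full f (G : set T) : measurable G -> mu (~` G) = 0 ->
  (forall x, 0 <= f x) -> \int[mu]_x f x = \int[mu]_(x in G) f x.
Proof.
move=> mG muG f0; apply/eqP; rewrite eq_le; apply/andP; split; last first.
  rewrite [leLHS]integral_mkcond; apply: ge0_le_integralW => x.
    by rewrite patchE; case: ifP.
  by rewrite patchE; case: ifP.
rewrite [leRHS]integral_mkcond !ge0_integralTE//; last first.
  by move=> x; rewrite patchE; case: ifP.
apply: ge_ereal_sup => _ [h hf <-].
pose h' := proj_nnsfun h mG.
have h'E x : h' x = (h \_ G) x by rewrite mrestrict.
apply: ereal_sup_ge; exists (sintegral mu h').
  exists h' => // x; rewrite h'E !patchE; case: ifPn => // _; exact: hf.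
rewrite -!integralT_nnsfun.
have -> : \int[mu]_x (h x)%:E = \int[mu]_(x in G) (h x)%:E.
  rewrite (ge0_negligible_integral (measurableC mG) measurableT _ _ muG).
  - by rewrite setTD setCK.
  - exact/measurable_EFinP.
  - by move=> x _; rewrite lee_fin.
rewrite integral_mkcond; apply: ge0_le_integralW => x.
  by rewrite patchE; case: ifPn => // _; rewrite lee_fin.
by rewrite h'E !patchE; case: ifP.
Qed.

Lemma ae_ge0_le_integralW f g : (forall x, 0 <= f x) -> (forall x, 0 <= g x) ->
  {ae mu, forall x, f x <= g x} -> \int[mu]_x f x <= \int[mu]_x g x.
Proof.
move=> f0 g0 [N [mN N0 fgN]].
rewrite !(@ge0_integral_full _ (~` N))//; do ?[exact: measurableC|by rewrite setCK].
rewrite integral_mkcond [leRHS]integral_mkcond; apply: ge0_le_integralW => x.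
  by rewrite patchE; case: ifP.
rewrite !patchE; case: ifPn => //; rewrite inE => Nx.
by apply: contrapT => fgx; apply: Nx; exact: fgN.
Qed.

Lemma ae_ge0_eq_integralW f g : (forall x, 0 <= f x) -> (forall x, 0 <= g x) ->
  {ae mu, forall x, f x = g x} -> \int[mu]_x f x = \int[mu]_x g x.
Proof.
move=> f0 g0 fg; apply/eqP; rewrite eq_le; apply/andP; split;
  apply: ae_ge0_le_integralW => //; apply: filterS fg => x -> //.
Qed.

Lemma ge0_cvg_integral (f_ : (T -> \bar R)^nat) f :
  (forall n, measurable_fun setT (f_ n)) -> (forall n x, 0 <= f_ n x) ->
  (forall x, {homo f_ ^~ x : n m / (n <= m)%N >-> n <= m}) ->
  (forall x, f_ n x @[n --> \oo] --> f x) ->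
  \int[mu]_x f_ n x @[n --> \oo] --> \int[mu]_x f x.
Proof.
move=> mf f0 ndf ff.
have := @cvg_monotone_convergence _ _ _ mu setT measurableT f_ mf
  (fun n x _ => f0 n x) (fun x _ => ndf x).
have -> // : (fun x => limn (f_ ^~ x)) = f.
by apply/funext => x; apply/cvg_lim => //; exact: ff.
Qed.

End integral_without_measurability.

Section sequence_measurability.
Context d (T : measurableType d).

(* Joint measurability of a family of functions of finite sequences,
   restricted to the sequences of length [n]. *)
Definition mseqn dX (X : measurableType dX) dY (Y : measurableType dY) (n : nat)
    (F : X -> seq T -> Y) :=
  measurable_fun setT (fun q : X * n.-tuple T => F q.1 q.2).

Definition mseq dX (X : measurableType dX) dY (Y : measurableType dY)
    (F : X -> seq T -> Y) := forall n, mseqn n F.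

Lemma mseqn0 dX (X : measurableType dX) dY (Y : measurableType dY)
    (F : X -> seq T -> Y) :
  mseqn 0 F <-> measurable_fun setT (F ^~ [::]).
Proof.
split=> mF.
  pose t0 : 0.-tuple T := [tuple].
  have -> : F ^~ [::] = (fun q : X * 0.-tuple T => F q.1 q.2) \o (fun x => (x, t0)).
    by [].
  by apply: measurableT_comp => //; exact: measurable_pair2.
rewrite /mseqn (_ : (fun q : X * 0.-tuple T => F q.1 q.2) = (F ^~ [::]) \o fst);
  last first.
  by apply/funext => -[x t]/=; rewrite (tuple0 t).
exact: measurableT_comp.
Qed.

(** Moving the head of the sequence into the parameter is the step of all inductions on the length;
    the parameter space of [mseqn] exists for this purpose. *)
Lemma mseqnS dX (X : measurableType dX) dY (Y : measurableType dY) n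
    (F : X -> seq T -> Y) :
  mseqn n.+1 F <-> mseqn n (fun (q : X * T) s => F q.1 (q.2 :: s)).
Proof.
split=> mF; rewrite /mseqn.
  pose c (q : (X * T) * n.-tuple T) : X * n.+1.-tuple T :=
    (q.1.1, [the n.+1.-tuple T of q.1.2 :: q.2]).
  have mc : measurable_fun setT c; last exact: (measurableT_comp mF mc).
  apply/measurable_fun_pairP; split=> /=.
    exact: (measurableT_comp measurable_fst measurable_fst).
  apply: measurable_cons => //.
  exact: (measurableT_comp measurable_snd measurable_fst).
pose c (q : X * n.+1.-tuple T) : (X * T) * n.-tuple T :=
  ((q.1, thead q.2), [tuple of behead q.2]).
rewrite (_ : (fun _ => _) =
   (fun q : (X * T) * n.-tuple T => F q.1.1 (q.1.2 :: q.2)) \o c); last first.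
  by apply/funext => -[x t]/=; rewrite {1}(tuple_eta t).
have mc : measurable_fun setT c; last exact: (measurableT_comp mF mc).
apply/measurable_fun_pairP; split=> /=.
  apply: measurable_fun_pair => //.
  exact: (measurableT_comp (measurable_tnth _) measurable_snd).
exact: (measurableT_comp (@measurable_behead _ _ n) measurable_snd).
Qed.

Lemma mseqn_comp dX (X : measurableType dX) dX' (X' : measurableType dX')
    dY (Y : measurableType dY) n (F : X -> seq T -> Y) (g : X' -> X) :
  measurable_fun setT g -> mseqn n F -> mseqn n (fun x => F (g x)).
Proof.
move=> mg mF; pose c (q : X' * n.-tuple T) := (g q.1, q.2).
have mc : measurable_fun setT c; last exact: (measurableT_comp mF mc).
apply: measurable_fun_pair => //.
exact: (measurableT_comp mg measurable_fst).
Qed.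

Lemma mseq_cons dX (X : measurableType dX) dY (Y : measurableType dY)
    (F : X -> seq T -> Y) :
  mseq F -> mseq (fun (q : X * T) s => F q.1 (q.2 :: s)).
Proof. by move=> mF n; apply/mseqnS; exact: mF. Qed.

End sequence_measurability.

Section iterated_integral.
Context d (T : measurableType d) (R : realType).
Variable mu : {sigma_finite_measure set T -> \bar R}.
Implicit Types F G : seq T -> \bar R.

Fixpoint iint (n : nat) (F : seq T -> \bar R) : \bar R :=
  if n is n'.+1 then \int[mu]_x iint n' (fun s => F (x :: s)) else F [::].

(** Null sets are taken one variable at a time, the later ones depending on the earlier points. This
    form can be split along a concatenation by mere unfolding and pulled back along deletions. *)
Fixpoint aeseq (n : nat) (Pr : seq T -> Prop) : Prop :=
  if n is n'.+1 then {ae mu, forall x, aeseq n' (fun s => Pr (x :: s))}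
  else Pr [::].

Lemma iint_ge0 n F : (forall s, 0 <= F s) -> 0 <= iint n F.
Proof.
by elim: n F => [|n IH] F F0//=; apply: integral_ge0 => x _; exact: IH.
Qed.

Lemma aeseqW n (Pr : seq T -> Prop) :
  (forall s, size s = n -> Pr s) -> aeseq n Pr.
Proof.
elim: n Pr => [|n IH] Pr H/=; first exact: H.
by apply: aeW => x; apply: IH => s sn; apply: H; rewrite /= sn.
Qed.

Lemma aeseq_impl n (Pr Pr' : seq T -> Prop) :
  (forall s, size s = n -> Pr s -> Pr' s) -> aeseq n Pr -> aeseq n Pr'.
Proof.
elim: n Pr Pr' => [|n IH] Pr Pr' H/=; first exact: H.
apply: filterS => x; apply: IH => s sn; apply: H; first by rewrite /= sn.
Qed.

Lemma aeseq_and n (Pr Pr' : seq T -> Prop) :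
  aeseq n Pr -> aeseq n Pr' -> aeseq n (fun s => Pr s /\ Pr' s).
Proof.
elim: n Pr Pr' => [|n IH] Pr Pr'//= H H'.
by apply: filterS2 H H' => x; exact: IH.
Qed.

Lemma aeseq_forall n (Pr : nat -> seq T -> Prop) :
  (forall k, aeseq n (Pr k)) -> aeseq n (fun s => forall k, Pr k s).
Proof.
elim: n Pr => [|n IH] Pr//= H.
by have := ae_foralln H; apply: filterS => x; exact: IH.
Qed.

Lemma aeseq_cat n k (Pr : seq T -> Prop) : aeseq (n + k) Pr ->
  aeseq n (fun s => aeseq k (fun t => Pr (s ++ t))).
Proof.
elim: n Pr => [|n IH] Pr//= H.
by apply: filterS H => x; exact: IH.
Qed.

Lemma aeseq_all n (p : T -> Prop) : {ae mu, forall x, p x} ->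
  aeseq n (fun s => {in s, forall x, p x}).
Proof.
move=> mp; elim: n => [|n IH]//=; apply: filterS mp => x px.
apply: aeseq_impl IH => s _ H y; rewrite inE => /orP[/eqP ->//|]; exact: H.
Qed.

(** The property ignores the deleted coordinate, so any value of it is allowed. In the contraction
    argument the deleted point is the one given by weak stability. *)
Lemma aeseq_del n (j : nat) (Pr : seq T -> Prop) : (j <= n)%N -> aeseq n Pr ->
  aeseq n.+1 (fun s => Pr (take j s ++ drop j.+1 s)).
Proof.
elim: n j Pr => [|n IH] [|j] Pr jn H //.
- by apply: aeseqW => -[|x [|y s]].
- have : {ae mu, forall x : T, aeseq n.+1 Pr} by exact: aeW.
  by apply: filterS => x; apply: aeseq_impl => s _; rewrite /= ?drop0.
- by move: H => /=; apply: filterS => x; exact: IH.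
Qed.

Lemma le_iint n F G : (forall s, 0 <= F s) -> (forall s, 0 <= G s) ->
  aeseq n (fun s => F s <= G s) -> iint n F <= iint n G.
Proof.
elim: n F G => [|n IH] F G F0 G0//= FG.
apply: ae_ge0_le_integralW.
- by move=> x; exact: iint_ge0.
- by move=> x; exact: iint_ge0.
- by apply: filterS FG => x; exact: IH.
Qed.

Lemma eq_iint n F G : (forall s, 0 <= F s) -> (forall s, 0 <= G s) ->
  aeseq n (fun s => F s = G s) -> iint n F = iint n G.
Proof.
move=> F0 G0 FG; apply/eqP; rewrite eq_le; apply/andP; split;
  by apply: le_iint => //; apply: aeseq_impl FG => s _ ->.
Qed.

Lemma eq_iintW n F G : (forall s, size s = n -> F s = G s) -> iint n F = iint n G.
Proof.
elim: n F G => [|n IH] F G FG/=; first exact: FG.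
by apply: eq_integral => x _; apply: IH => s sn; apply: FG; rewrite /= sn.
Qed.

Lemma measurable_iint n dX (X : measurableType dX) (F : X -> seq T -> \bar R) :
  mseqn n F -> (forall x s, 0 <= F x s) ->
  measurable_fun setT (fun x => iint n (F x)).
Proof.
elim: n dX X F => [|n IH] dX X F mF F0; first exact/mseqn0.
move/mseqnS : mF => /IH /= /(_ (fun _ _ => F0 _ _)) mF.
apply: (measurable_fun_fubini_tonelli_F
  (fun q : X * T => iint n (fun s => F q.1 (q.2 :: s))) mF) => q.
exact: iint_ge0.
Qed.

Lemma measurable_iint_cons n dX (X : measurableType dX)
    (F : X -> seq T -> \bar R) p :
  mseqn n.+1 F -> (forall x s, 0 <= F x s) ->
  measurable_fun setT (fun x => iint n (fun s => F p (x :: s))).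
Proof.
move=> /mseqnS mF F0; apply: (@measurable_iint n _ _ (fun x s => F p (x :: s))) => //.
exact: (mseqn_comp (pair1_measurable p) mF).
Qed.

Lemma iintD n dX (X : measurableType dX) (F G : X -> seq T -> \bar R) p :
  mseqn n F -> mseqn n G ->
  (forall x s, 0 <= F x s) -> (forall x s, 0 <= G x s) ->
  iint n (fun s => F p s + G p s) = iint n (F p) + iint n (G p).
Proof.
elim: n dX X F G p => [|n IH] dX X F G p mF mG F0 G0//=.
rewrite -ge0_integralD//; do ?[by move=> x _; exact: iint_ge0
  |exact: measurable_iint_cons].
apply: eq_integral => x _; move/mseqnS : mF => mF; move/mseqnS : mG => mG.
exact: (IH _ _ _ _ (p, x) mF mG).
Qed.

Lemma iintZl n dX (X : measurableType dX) (F : X -> seq T -> \bar R) p k :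
  mseqn n F -> (forall x s, 0 <= F x s) -> 0 <= k ->
  iint n (fun s => k * F p s) = k * iint n (F p).
Proof.
elim: n dX X F p => [|n IH] dX X F p mF F0 k0//=.
rewrite -ge0_integralZl//; do ?[by move=> x _; exact: iint_ge0
  |exact: measurable_iint_cons].
apply: eq_integral => x _; move/mseqnS : mF => mF.
exact: (IH _ _ _ (p, x) mF).
Qed.

(** Tonelli, applied once for each of the [n] variables; the extra parameter [p] collects the
    variables already treated. *)
Lemma integral_iint n dX (X : measurableType dX) dY (Y : measurableType dY)
    (nu : {sigma_finite_measure set Y -> \bar R})
    (F : X * Y -> seq T -> \bar R) p :
  mseqn n F -> (forall x s, 0 <= F x s) ->
  \int[nu]_y iint n (F (p, y)) = iint n (fun s => \int[nu]_y F (p, y) s).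
Proof.
elim: n dX X F p => [|n IH] dX X F p mF F0//=.
move/mseqnS : mF => mF.
pose c (q : X * T * Y) : X * Y * T := (q.1.1, q.2, q.1.2).
have mc : measurable_fun setT c.
  apply: measurable_fun_pair; last exact: (measurableT_comp measurable_snd measurable_fst).
  apply: measurable_fun_pair; last exact: measurable_snd.
  exact: (measurableT_comp measurable_fst measurable_fst).
pose c' (q : Y * T) : X * Y * T := (p, q.1, q.2).
have mc' : measurable_fun setT c'.
  apply: measurable_fun_pair; last exact: measurable_snd.
  by apply: measurable_fun_pair.
rewrite (fubini_tonelli (fun q : Y * T => iint n (fun s => F (p, q.1) (q.2 :: s)))).
- apply: eq_integral => x _.
  exact: (IH _ _ _ (p, x) (mseqn_comp mc mF)).
- apply: (@measurable_iint n _ _ (fun (q : Y * T) s => F (p, q.1) (q.2 :: s))) => //.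
  exact: (mseqn_comp mc' mF).
- by move=> q; exact: iint_ge0.
Qed.

Lemma cvg_iint n dX (X : measurableType dX)
    (F_ : nat -> X -> seq T -> \bar R) (F : X -> seq T -> \bar R) p :
  (forall m, mseqn n (F_ m)) -> (forall m x s, 0 <= F_ m x s) ->
  (forall x s, {homo F_^~ x ^~ s : k m / (k <= m)%N >-> k <= m}) ->
  (forall x s, F_ m x s @[m --> \oo] --> F x s) ->
  iint n (F_ m p) @[m --> \oo] --> iint n (F p).
Proof.
elim: n dX X F_ F p => [|n IH] dX X F_ F p mF F0 ndF FF//=.
apply: ge0_cvg_integral.
- by move=> m; exact: measurable_iint_cons.
- by move=> m x; exact: iint_ge0.
- by move=> x k m km; apply: le_iint => //; apply: aeseqW => t _; exact: ndF.
- move=> x.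
  have := IH _ _ (fun m (q : X * T) s => F_ m q.1 (q.2 :: s))
    (fun q s => F q.1 (q.2 :: s)) (p, x).
  by apply => // m; apply/mseqnS; exact: mF.
Qed.

Lemma iint_mpow n dX (X : measurableType dX) (F : X -> seq T -> \bar R) p :
  mseqn n F -> (forall x s, 0 <= F x s) ->
  \int[mpow mu n]_t F p t = iint n (F p).
Proof.
elim: n dX X F p => [|n IH] dX X F p mF F0.
  rewrite /= integral_dirac//; last exact: (measurableT_comp mF (pair1_measurable p)).
  by rewrite diracT mul1e.
pose c (q : T * n.-tuple T) := cons_tuple q.1 q.2.
have mc : measurable_fun setT c.
  exact: (measurable_cons measurable_fst measurable_snd).
have mFp : measurable_fun setT (fun t : n.+1.-tuple T => F p t).
  exact: (measurableT_comp mF (pair1_measurable p)).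
rewrite (@ge0_integral_pushforward _ _ _ _ _ c mc (mu \x mpow mu n) setT (fun t => F p t))//.
rewrite preimage_setT (@fubini_tonelli1 _ _ _ _ _ mu (mpow mu n) ((fun t => F p (tval t)) \o c))//.
  apply: eq_integral => x _; rewrite /fubini_F/=.
  have := IH _ _ (fun (q : X * T) s => F q.1 (q.2 :: s)) (p, x).
  by apply => //; exact/mseqnS.
  exact: (measurableT_comp mFp mc).
by move=> q; exact: F0.
Qed.

Lemma iint_eq0 n dX (X : measurableType dX) (F : X -> seq T -> \bar R) p :
  mseqn n F -> (forall x s, 0 <= F x s) -> iint n (F p) = 0 ->
  aeseq n (fun s => F p s = 0).
Proof.
elim: n dX X F p => [|n IH] dX X F p mF F0//= FE0.
have : \int[mu]_x `|iint n (fun s => F p (x :: s))| = 0.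
  rewrite -[RHS]FE0; apply: eq_integral => x _.
  by rewrite gee0_abs//; exact: iint_ge0.
move/(ae_eq_integral_abs _ measurableT (measurable_iint_cons p mF F0)).
apply: filterS => x /(_ Logic.I) xE0.
by apply: (IH _ _ (fun (q : X * T) s => F q.1 (q.2 :: s)) (p, x)) => //; exact/mseqnS.
Qed.

(** The value is 0 on sequences of any length other than [n], which makes the indicator of a set of
    tuples an integrand for [iint]. *)
Definition seq_indic n (B : set (n.-tuple T)) (s : seq T) : \bar R :=
  if insub s is Some t then (\1_B (t : n.-tuple T))%:E else 0.

Lemma seq_indicE n (B : set (n.-tuple T)) (t : n.-tuple T) :
  seq_indic B t = (\1_B t)%:E.
Proof. by rewrite /seq_indic valK. Qed.

Lemma seq_indic_ge0 n (B : set (n.-tuple T)) s : 0 <= seq_indic B s.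
Proof. by rewrite /seq_indic; case: insub => // t; rewrite lee_fin. Qed.

Lemma mseq_seq_indic n (B : set (n.-tuple T)) : measurable B ->
  mseq (fun _ : unit => seq_indic B).
Proof.
move=> mB m; have [->|mn] := eqVneq m n.
  have mi : measurable_fun setT (fun t : n.-tuple T => (\1_B t : R)%:E).
    by apply/measurable_EFinP; exact: measurable_indic.
  rewrite /mseqn (_ : (fun _ => _) = (fun t => (\1_B t : R)%:E) \o snd).
    exact: (measurableT_comp mi measurable_snd).
  by apply/funext => q/=; rewrite seq_indicE.
rewrite /mseqn (_ : (fun _ => _) = cst 0)//.
apply/funext => -[_ t]/=; rewrite /seq_indic insubF//.
by rewrite size_tuple; exact/negbTE.
Qed.

(** The iterated integral of the indicator of the exceptional set vanishes, hence that indicator is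
    0 for almost every value of each variable in turn. *)
Lemma ae_mpow n (Pr : seq T -> Prop) :
  {ae mpow mu n, forall t : n.-tuple T, Pr t} -> aeseq n Pr.
Proof.
move=> [N [mN N0 PrN]].
have mi := @mseq_seq_indic _ _ mN n.
have : iint n (seq_indic N) = 0.
  rewrite -(iint_mpow tt mi); last by move=> _; exact: seq_indic_ge0.
  rewrite (eq_integral (EFin \o \1_N)); last by move=> t _; rewrite seq_indicE.
  by rewrite integral_indic// setIT.
move/(iint_eq0 (p := tt) mi (fun _ => @seq_indic_ge0 _ _)).
apply: aeseq_impl => s /eqP sn.
rewrite -[s]/(tval (Tuple sn)) seq_indicE => /eqP.
rewrite eqe indicE; case: (boolP (_ \in _)) => [_|/negP NN _]; first by rewrite oner_eq0.
by apply: contrapT => Prs; apply: NN; rewrite inE; exact: PrN.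
Qed.
End iterated_integral.

(** * Sums over subsequences and the Mecke formula *)

Section sums_over_subsequences.
Context (T : eqType) (R : realType).
Implicit Types F : T -> seq T -> \bar R.

(* [rsum F [:: x_1; ..; x_n]] is the sum of the [F x_i] of the sequence
   deprived of its [i]-th term. *)
Fixpoint rsum (F : T -> seq T -> \bar R) (s : seq T) : \bar R :=
  if s is x :: s' then F x s' + rsum (fun y r => F y (x :: r)) s' else 0.

(** Summation over the ordered choices of [k] terms at distinct indices, [H] receiving the chosen
    terms and the rest: the factorial measure of a finite configuration, with the reduced
    configuration kept at hand. *)
Fixpoint ssum (k : nat) (H : seq T -> seq T -> \bar R) (s : seq T) : \bar R :=
  if k is k'.+1 then rsum (fun x => ssum k' (fun y => H (x :: y))) s
  else H [::] s.

Lemma rsum_ge0 F s : (forall x r, 0 <= F x r) -> 0 <= rsum F s.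
Proof. by elim: s F => //= x s IH F F0; rewrite adde_ge0// IH. Qed.

Lemma ssum_ge0 k (H : seq T -> seq T -> \bar R) s : (forall y r, 0 <= H y r) ->
  0 <= ssum k H s.
Proof.
by elim: k H s => //= k IH H s H0; apply: rsum_ge0 => x r; exact: IH.
Qed.

Lemma eq_rsum F G s : (forall x r, perm_eq (x :: r) s -> F x r = G x r) ->
  rsum F s = rsum G s.
Proof.
elim: s F G => //= x s IH F G FG; rewrite FG//; congr +%E.
apply: IH => y r yr; apply: FG.
by rewrite (perm_catCA [:: y] [:: x] r)/= perm_cons.
Qed.

Lemma eq_ssum k (H K : seq T -> seq T -> \bar R) s :
  (forall y r, size y = k -> perm_eq (y ++ r) s -> H y r = K y r) ->
  ssum k H s = ssum k K s.
Proof.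
elim: k H K s => [|k IH] H K s HK/=; first exact: HK.
apply: eq_rsum => x r xr; apply: IH => y r' yk yr'.
by apply: HK; rewrite /= ?yk// -(permPr xr) perm_cons.
Qed.

Lemma rsumD F G s : (forall x r, 0 <= F x r) -> (forall x r, 0 <= G x r) ->
  rsum (fun x r => F x r + G x r) s = rsum F s + rsum G s.
Proof.
elim: s F G => [|x s IH] F G F0 G0/=; first by rewrite adde0.
by rewrite IH//= addeACA.
Qed.

Lemma rsumZ F s k : (forall x r, 0 <= F x r) -> 0 <= k ->
  rsum (fun x r => k * F x r) s = k * rsum F s.
Proof.
elim: s F => [|x s IH] F F0 k0/=; first by rewrite mule0.
by rewrite IH//= ge0_muleDr// rsum_ge0.
Qed.

Lemma ssumD k (H K : seq T -> seq T -> \bar R) s : (forall x r, 0 <= H x r) ->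
  (forall x r, 0 <= K x r) ->
  ssum k (fun x r => H x r + K x r) s = ssum k H s + ssum k K s.
Proof.
elim: k H K s => [|k IH] H K s H0 K0//=.
rewrite -rsumD; do ?by move=> x r; exact: ssum_ge0.
by apply: eq_rsum => x r _; exact: IH.
Qed.

Lemma ssumZ k (H : seq T -> seq T -> \bar R) s c : (forall x r, 0 <= H x r) ->
  0 <= c ->
  ssum k (fun x r => c * H x r) s = c * ssum k H s.
Proof.
elim: k H s => [|k IH] H s H0 c0//=.
rewrite -rsumZ//; first by apply: eq_rsum => x r _; exact: IH.
by move=> x r; exact: ssum_ge0.
Qed.

(* For a symmetric [h], choosing an ordered [k.+1]-tuple from [x :: s] either
   avoids [x] or places it in one of [k.+1] positions. *)
Lemma ssum_cons k (h : seq T -> \bar R) x s :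
  (forall s t, perm_eq s t -> h s = h t) -> (forall s, 0 <= h s) ->
  ssum k.+1 (fun y _ => h y) (x :: s) =
  ssum k.+1 (fun y _ => h y) s + k.+1%:R%:E * ssum k (fun y _ => h (x :: y)) s.
Proof.
elim: k h x s => [|k IH] h x s hperm h0; first by rewrite /= mul1e addeC.
have -> : ssum k.+2 (fun y _ => h y) (x :: s) =
    ssum k.+1 (fun y _ => h (x :: y)) s +
    rsum (fun y r => ssum k.+1 (fun y' _ => h (y :: y')) (x :: r)) s by [].
rewrite (@eq_rsum _ (fun y r => ssum k.+1 (fun y' _ => h (y :: y')) r +
   k.+1%:R%:E * ssum k (fun y' _ => h (x :: y :: y')) r)); last first.
  move=> y r _; rewrite IH//; last by move=> u v uv; apply: hperm; rewrite perm_cons.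
  congr (_ + _ * _); apply: eq_ssum => y' _ _ _; apply: hperm.
  exact: (permEl (perm_catCA [:: y] [:: x] y')).
rewrite rsumD; last 2 first.
- by move=> y r; apply: ssum_ge0.
- by move=> y r; rewrite mule_ge0// ssum_ge0.
rewrite rsumZ//; last by move=> y r; apply: ssum_ge0.
have -> : rsum (fun y r => ssum k.+1 (fun y' _ => h (y :: y')) r) s =
    ssum k.+2 (fun y _ => h y) s by [].
have -> : rsum (fun y r => ssum k (fun y' _ => h (x :: y :: y')) r) s =
    ssum k.+1 (fun y _ => h (x :: y)) s by [].
rewrite addeCA; congr (_ + _).
rewrite [in RHS]mulrS EFinD ge0_muleDl//= ?lee_fin// ?mul1e//.
Qed.

End sums_over_subsequences.

Section mecke.
Context d (T : measurableType d) (R : realType).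
Variable mu : {sigma_finite_measure set T -> \bar R}.

Lemma mseq_rsum dX (X : measurableType dX) (F : X -> T -> seq T -> \bar R) :
  mseq (fun (q : X * T) s => F q.1 q.2 s) -> mseq (fun p => rsum (F p)).
Proof.
move=> mF n; elim: n dX X F mF => [|n IH] dX X F mF.
  by apply/mseqn0 => /=; exact: measurable_cst.
apply/mseqnS => /=; apply: emeasurable_funD; first exact: mF.
apply: (IH _ _ (fun (q : X * T) y r => F q.1 y (q.2 :: r))).
move=> m; have := mF m.+1 => /mseqnS mFS.
pose c (q : X * T * T) : X * T * T := (q.1.1, q.2, q.1.2).
have mc : measurable_fun setT c.
  apply: measurable_fun_pair; last exact: (measurableT_comp measurable_snd measurable_fst).
  apply: measurable_fun_pair; last exact: measurable_snd.
  exact: (measurableT_comp measurable_fst measurable_fst).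
exact: (mseqn_comp mc mFS).
Qed.

(** By Tonelli the selected variable may be integrated first, whatever its place, so the [n.+1]
    places contribute equally. *)
Lemma iint_rsum n dX (X : measurableType dX) (F : X -> T -> seq T -> \bar R) p :
  mseq (fun (q : X * T) s => F q.1 q.2 s) -> (forall p x s, 0 <= F p x s) ->
  iint mu n.+1 (rsum (F p)) = n.+1%:R%:E * \int[mu]_x iint mu n (F p x).
Proof.
elim: n dX X F p => [|n IH] dX X F p mF F0.
  by rewrite mul1e /=; apply: eq_integral => x _; rewrite adde0.
have mF' : mseq (fun (q : X * T * T) s => F q.1.1 q.2 (q.1.2 :: s)).
  move=> m; have := mF m.+1 => /mseqnS mFS.
  pose c (q : X * T * T) : X * T * T := (q.1.1, q.2, q.1.2).
  have mc : measurable_fun setT c.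
    apply: measurable_fun_pair; last exact: (measurableT_comp measurable_snd measurable_fst).
    apply: measurable_fun_pair; last exact: measurable_snd.
    exact: (measurableT_comp measurable_fst measurable_fst).
  exact: (mseqn_comp mc mFS).
have mp : measurable_fun setT (fun x : T => (p, x)) by exact: pair1_measurable.
transitivity (\int[mu]_x (iint mu n.+1 (F p x) +
    iint mu n.+1 (rsum (fun y r => F p y (x :: r))))).
  rewrite [LHS]/=; apply: eq_integral => x _.
  rewrite -/(iint mu n.+1 (fun s => F p x s + rsum (fun y r => F p y (x :: r)) s)).
  apply: (@iintD _ _ _ _ n.+1 _ _ (fun (q : X * T) s => F q.1 q.2 s)
    (fun (q : X * T) => rsum (fun y r => F q.1 y (q.2 :: r))) (p, x)) => //.
    exact: (@mseq_rsum _ _ (fun (q : X * T) y r => F q.1 y (q.2 :: r))).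
  by move=> q s; apply: rsum_ge0.
have m1 : measurable_fun setT (fun x => iint mu n.+1 (F p x)).
  by apply: measurable_iint; [exact: (mseqn_comp mp (mF n.+1))|exact: F0].
rewrite ge0_integralD//; last 3 first.
- by move=> x _; exact: iint_ge0.
- by move=> x _; apply: iint_ge0 => s; exact: rsum_ge0.
- apply: (@measurable_iint _ _ _ _ _ _ _ (fun x => rsum (fun y r => F p y (x :: r)))).
    apply: (@mseq_rsum _ _ (fun x y r => F p y (x :: r))) => m.
    pose c (q : T * T) : X * T * T := (p, q.1, q.2).
    have mc : measurable_fun setT c.
      by apply: measurable_fun_pair => //; apply: measurable_fun_pair.
    exact: (mseqn_comp mc (mF' m)).
  by move=> x s; exact: rsum_ge0.
rewrite [in RHS]mulrS EFinD ge0_muleDl ?lee_fin// mul1e; congr (_ + _).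
transitivity (\int[mu]_x (n.+1%:R%:E * \int[mu]_y iint mu n (fun r => F p y (x :: r)))).
  apply: eq_integral => x _.
  exact: (IH _ _ (fun (q : X * T) y r => F q.1 y (q.2 :: r)) (p, x)).
pose c (q : T * T) : X * T * T := (p, q.1, q.2).
have mc : measurable_fun setT c.
  by apply: measurable_fun_pair => //; apply: measurable_fun_pair.
have m2 : measurable_fun setT (fun q : T * T => iint mu n (fun r => F p q.2 (q.1 :: r))).
  apply: (@measurable_iint _ _ _ mu n _ _ (fun q r => F p q.2 (q.1 :: r))).
    exact: (mseqn_comp mc (mF' n)).
  by move=> *; exact: F0.
rewrite ge0_integralZl//; last 2 first.
- apply: (measurable_fun_fubini_tonelli_F _ m2) => q; exact: iint_ge0.
- by move=> x _; apply: integral_ge0 => y _; exact: iint_ge0.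
congr (_ * _).
rewrite (fubini_tonelli _ m2)//= => q; exact: iint_ge0.
Qed.

Definition poisson_sum (z : R) (F : seq T -> \bar R) : \bar R :=
  \sum_(0 <= n <oo) (z ^+ n / n`!%:R)%:E * iint mu n F.

Lemma poisson_sum_ge0 z F : (0 <= z)%R -> (forall s, 0 <= F s) ->
  0 <= poisson_sum z F.
Proof.
move=> z0 F0; apply: nneseries_ge0 => n _ _.
by rewrite mule_ge0 ?iint_ge0// lee_fin divr_ge0// exprn_ge0.
Qed.

Lemma measurable_poisson_sum z dX (X : measurableType dX)
    (F : X -> seq T -> \bar R) : (0 <= z)%R ->
  mseq F -> (forall x s, 0 <= F x s) ->
  measurable_fun setT (fun p => poisson_sum z (F p)).
Proof.
move=> z0 mF F0; apply: ge0_emeasurable_sum => [n x _ _|n _].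
  by rewrite mule_ge0 ?iint_ge0// lee_fin divr_ge0// exprn_ge0.
apply: emeasurable_funM; first exact: measurable_cst.
exact: measurable_iint.
Qed.

(** Mecke formula of the Poisson process: the factor [n.+1] from [iint_rsum] turns the coefficient
    of order [n.+1] into [z] times the coefficient of order [n]. The term of order 0 vanishes, since
    nothing can be selected from an empty sequence. *)
Lemma poisson_sum_rsum z dX (X : measurableType dX) (F : X -> T -> seq T -> \bar R) p :
  (0 <= z)%R ->
  mseq (fun (q : X * T) s => F q.1 q.2 s) -> (forall p x s, 0 <= F p x s) ->
  poisson_sum z (rsum (F p)) = z%:E * \int[mu]_x poisson_sum z (F p x).
Proof.
move=> z0 mF F0; rewrite /poisson_sum integral_nneseries//; last 2 first.
- move=> n; apply: emeasurable_funM; first exact: measurable_cst.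
  apply: measurable_iint => //; exact: (mseqn_comp (pair1_measurable p) (mF n)).
- by move=> n x _; rewrite mule_ge0 ?iint_ge0// lee_fin divr_ge0// exprn_ge0.
rewrite nneseries_recl//=; last first.
  move=> n _; rewrite mule_ge0// ?lee_fin ?divr_ge0 ?exprn_ge0//.
  by apply: iint_ge0 => s; exact: rsum_ge0.
rewrite mule0 add0e -nneseries_addn; last first.
  move=> n; rewrite mule_ge0// ?lee_fin ?divr_ge0 ?exprn_ge0//.
  by apply: iint_ge0 => s; exact: rsum_ge0.
rewrite -nneseriesZl//; last first.
  move=> n _; apply: integral_ge0 => x _.
  by rewrite mule_ge0 ?iint_ge0// lee_fin divr_ge0// exprn_ge0.
apply: eq_eseriesr => n _; rewrite addn1 iint_rsum// ge0_integralZl//; last 3 first.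
- by apply: measurable_iint => //; exact: (mseqn_comp (pair1_measurable p) (mF n)).
- by move=> x _; exact: iint_ge0.
- by rewrite lee_fin divr_ge0// exprn_ge0.
rewrite !muleA -!EFinM; congr (_%:E * _).
rewrite exprS factS natrM invfM; field.
by rewrite nat1r !pnatr_eq0 -lt0n fact_gt0.
Qed.

Lemma measurable_cons_param dX (X : measurableType dX) k :
  measurable_fun setT (fun q : X * T * k.-tuple T =>
    (q.1.1, [the k.+1.-tuple T of q.1.2 :: q.2])).
Proof.
apply: measurable_fun_pair; first exact: (measurableT_comp measurable_fst measurable_fst).
apply: measurable_cons; last exact: measurable_snd.
exact: (measurableT_comp measurable_snd measurable_fst).
Qed.

Lemma mseq_ssum k dX (X : measurableType dX) (H : X -> seq T -> seq T -> \bar R) :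
  mseq (fun (q : X * k.-tuple T) s => H q.1 q.2 s) ->
  mseq (fun p => ssum k (H p)).
Proof.
elim: k dX X H => [|k IH] dX X H mH n.
  apply: (@mseqn_comp _ _ _ _ _ _ _ _ _ _ (fun p => (p, [tuple]))
    _ (mH n)); exact: measurable_pair2.
apply: (@mseq_rsum _ _ (fun p x => ssum k (fun y => H p (x :: y)))).
apply: (IH _ _ (fun (q : X * T) y => H q.1 (q.2 :: y))) => m.
exact: (mseqn_comp (@measurable_cons_param _ X k) (mH m)).
Qed.

(** The multivariate Mecke formula, by selecting the [k] points one after the other; the points
    already selected become parameters. *)
Lemma poisson_sum_ssum z k dX (X : measurableType dX)
    (H : X -> seq T -> seq T -> \bar R) p :
  (0 <= z)%R ->
  mseq (fun (q : X * k.-tuple T) s => H q.1 q.2 s) ->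
  (forall p y s, 0 <= H p y s) ->
  poisson_sum z (ssum k (H p)) =
  (z ^+ k)%:E * iint mu k (fun y => poisson_sum z (H p y)).
Proof.
move=> z0; elim: k dX X H p => [|k IH] dX X H p mH H0.
  by rewrite expr0 mul1e.
have mH' : mseq (fun (q : X * T * k.-tuple T) s => H q.1.1 (q.1.2 :: q.2) s).
  by move=> m; exact: (mseqn_comp (@measurable_cons_param _ X k) (mH m)).
rewrite (@poisson_sum_rsum _ _ _ (fun p x => ssum k (fun y => H p (x :: y))))//; last 2 first.
- exact: (@mseq_ssum _ _ _ (fun (q : X * T) y => H q.1 (q.2 :: y))).
- by move=> *; exact: ssum_ge0.
rewrite exprS EFinM -muleA; congr (_ * _).
rewrite [X in _ = _ * X]/= -ge0_integralZl//; last 3 first.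
- apply: (@measurable_iint _ _ _ _ _ _ _ (fun x y => poisson_sum z (H p (x :: y)))).
    apply: (@measurable_poisson_sum z _ _ (fun q : T * k.-tuple T => H p (q.1 :: q.2))) => //.
    move=> m; pose c (q : T * k.-tuple T) := ((p, q.1), q.2).
    have mc : measurable_fun setT c by apply: measurable_fun_pair => //; exact: measurable_fun_pair.
    exact: (mseqn_comp mc (mH' m)).
  by move=> *; exact: poisson_sum_ge0.
- by move=> *; apply: iint_ge0 => *; exact: poisson_sum_ge0.
- by rewrite lee_fin exprn_ge0.
by apply: eq_integral => x _; exact: (IH _ _ (fun (q : X * T) y => H q.1 (q.2 :: y)) (p, x)).
Qed.

End mecke.

Section monotone_sums.
Context (R : realType) (I : choiceType).

Lemma nd_cvg_lee (u : (\bar R)^nat) l : {homo u : n m / (n <= m)%N >-> n <= m} ->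
  u n @[n --> \oo] --> l -> forall n, u n <= l.
Proof.
move=> ndu ul n; have ul' := ereal_nondecreasing_cvgn ndu.
rewrite -(cvg_lim _ ul)// (cvg_lim _ ul')//.
by apply: ereal_sup_ubound; exists n.
Qed.

(** Monotone convergence for the counting measure: limits are exchanged with finite sums, and the
    two suprema, over the index and over finite subsets, commute. *)
Lemma cvg_esum (g : set I) (f_ : nat -> I -> \bar R) (f : I -> \bar R) :
  (forall n x, 0 <= f_ n x) ->
  (forall x, {homo f_ ^~ x : n m / (n <= m)%N >-> n <= m}) ->
  (forall x, f_ n x @[n --> \oo] --> f x) ->
  \esum_(x in g) f_ n x @[n --> \oo] --> \esum_(x in g) f x.
Proof.
move=> f0 ndf ff.
have ndE : {homo (fun n => \esum_(x in g) f_ n x) : n m / (n <= m)%N >-> n <= m}.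
  by move=> n m nm; apply: le_esum => x _; exact: ndf.
suff -> : \esum_(x in g) f x = ereal_sup (range (fun n => \esum_(x in g) f_ n x)).
  exact: ereal_nondecreasing_cvgn.
apply/eqP; rewrite eq_le; apply/andP; split; last first.
  apply: ge_ereal_sup => _ [n _ <-]; apply: le_esum => x _.
  exact: (nd_cvg_lee (ndf x) (ff x)).
rewrite /esum; apply: ge_ereal_sup => _ [F [finF Fg] <-].
have FE n : \sum_(x \in F) f_ n x = \sum_(x <- fset_set F) f_ n x by rewrite fsbig_finite.
rewrite fsbig_finite//=.
have cF : (\sum_(x <- fset_set F) f_ n x) @[n --> \oo] --> \sum_(x <- fset_set F) f x.
  apply: (@cvg_nnesum _ _ _ _ _ _ (fun x n => f_ n x) f) => [x _|x _]; last exact: ff.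
  by apply: nearW => n; exact: f0.
rewrite -(cvg_lim _ cF)//; apply: lime_le; first exact: cvgP cF.
apply: nearW => n; apply: le_trans (ereal_sup_ubound _); last by exists n.
by rewrite -FE; apply: ereal_sup_ubound; exists F.
Qed.

End monotone_sums.

Lemma cvg_nneseries (R : realType) (f_ : nat -> nat -> \bar R) (f : nat -> \bar R) :
  (forall n k, 0 <= f_ n k) ->
  (forall k, {homo f_ ^~ k : n m / (n <= m)%N >-> n <= m}) ->
  (forall k, f_ n k @[n --> \oo] --> f k) ->
  \sum_(0 <= k <oo) f_ n k @[n --> \oo] --> \sum_(0 <= k <oo) f k.
Proof.
move=> f0 ndf ff; rewrite nneseries_esumT; last first.
  by move=> k; apply: le_trans (f0 0%N k) (nd_cvg_lee (ndf k) (ff k) 0%N).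
under eq_fun do rewrite nneseries_esumT//.
exact: cvg_esum.
Qed.

Section nonneg_bigop.
Context (R : realType) (T : choiceType).

Lemma esum_seq (s : seq T) (f : T -> \bar R) : uniq s -> (forall x, 0 <= f x) ->
  \esum_(x in [set` s]) f x = \sum_(x <- s) f x.
Proof.
move=> us f0; rewrite esum_fset; last 2 first.
- exact: finite_seq.
- by move=> x _; exact: f0.
by rewrite -fsbig_seq.
Qed.

End nonneg_bigop.

Section tuple_sums.
Context (R : realType) (T : choiceType) (D : eqType) (pos : T -> D).
Implicit Types (h : seq T -> \bar R) (g : set T).

Fixpoint tsum (k : nat) h (s : seq T) : \bar R :=
  if k is k'.+1 then \sum_(x <- s) tsum k' (fun y => h (x :: y)) s else h [::].

(** Unlike in [fsum], the set is the same at every stage and repetitions are allowed: such iterated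
    sums over one configuration depend measurably on it. Repetitions are removed by composing [h]
    with [if_upos]. *)
Fixpoint gsum (k : nat) h g : \bar R :=
  if k is k'.+1 then \esum_(x in g) gsum k' (fun y => h (x :: y)) g else h [::].

Fixpoint fsum (k : nat) h g : \bar R :=
  if k is k'.+1 then \esum_(x in g) fsum k' (fun y => h (x :: y)) (g `\ x)
  else h [::].

(** Distinctness is tested on positions, whose equality is a measurable relation even when equality
    of marked points is not. *)
Definition upos (s : seq T) := uniq [seq pos x | x <- s].
Definition if_upos h (s : seq T) : \bar R := if upos s then h s else 0.

Lemma if_upos_ge0 h : (forall s, 0 <= h s) -> forall s, 0 <= if_upos h s.
Proof. by move=> h0 s; rewrite /if_upos; case: ifP. Qed.

Lemma gsum_ge0 k h g : (forall s, 0 <= h s) -> 0 <= gsum k h g.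
Proof. by elim: k h => //= k IH h h0; apply: esum_ge0 => x _; exact: IH. Qed.

Lemma tsum0 k s : tsum k (fun=> 0) s = 0 :> \bar R.
Proof. by elim: k => //= k IH; rewrite big1. Qed.

Lemma gsum0 k g : gsum k (fun=> 0) g = 0 :> \bar R.
Proof. by elim: k => //= k IH; rewrite esum1. Qed.

Lemma le_gsum k h h' g : (forall s, h s <= h' s) -> gsum k h g <= gsum k h' g.
Proof.
by elim: k h h' => [|k IH] h h' hh //=; apply: le_esum => x _; exact: IH.
Qed.

Lemma cvg_gsum k (h_ : nat -> seq T -> \bar R) h g :
  (forall n s, 0 <= h_ n s) ->
  (forall s, {homo h_ ^~ s : n m / (n <= m)%N >-> n <= m}) ->
  (forall s, h_ n s @[n --> \oo] --> h s) ->
  gsum k (h_ n) g @[n --> \oo] --> gsum k h g.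
Proof.
elim: k h_ h => [|k IH] h_ h h0 ndh hh //=; apply: cvg_esum.
- by move=> n x; exact: gsum_ge0.
- by move=> x n m nm; apply: le_gsum => s; exact: ndh.
- by move=> x; exact: (IH (fun n y => h_ n (x :: y))).
Qed.

Lemma gsum_seq k h s : uniq s -> (forall s, 0 <= h s) ->
  gsum k h [set` s] = tsum k h s.
Proof.
move=> us; elim: k h => //= k IH h h0.
by rewrite esum_seq//; [apply: eq_bigr => x _; exact: IH|move=> x; exact: gsum_ge0].
Qed.

Lemma tsum_all k h (p : pred T) s :
  tsum k (fun y => if all p y then h y else 0) s = tsum k h [seq x <- s | p x].
Proof.
elim: k h => //= k IH h; rewrite big_filter [RHS]big_mkcond/=.
apply: eq_bigr => x _; case: ifPn => px /=; first exact: IH.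
by rewrite -[RHS](tsum0 k s).
Qed.

Lemma gsum_all k h (p : pred T) g : (forall s, 0 <= h s) ->
  gsum k (fun y => if all p y then h y else 0) g = gsum k h (g `&` [set x | p x]).
Proof.
elim: k h => //= k IH h h0; rewrite esum_mkcondr.
apply: eq_esum => x _; case: (boolP (p x)) => px /=.
  by rewrite mem_set// IH.
by rewrite memNset//= ?gsum0//; exact/negP.
Qed.

Lemma upos_uniq s : upos s -> uniq s. Proof. exact: map_uniq. Qed.

Lemma if_upos_cons h x : (fun y => if_upos h (x :: y)) =
  (fun y => if all [pred z | pos z != pos x] y
    then if_upos (fun y => h (x :: y)) y else 0).
Proof.
apply/funext => y; rewrite /if_upos /upos/=.
rewrite (_ : all _ _ = (pos x \notin [seq pos x0 | x0 <- y])); last first.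
  elim: y => //= z y ->; rewrite inE negb_or eq_sym//.
by case: (_ \in _).
Qed.

Lemma tsum_upos_ssum (h : seq T -> \bar R) k s : upos s ->
  tsum k (if_upos h) s = ssum k (fun y _ => h y) s.
Proof.
elim: k h s => [|k IH] h s us //=.
have -> : \sum_(x <- s) tsum k (fun y => if_upos h (x :: y)) s =
  \sum_(x <- s) ssum k (fun y _ => h (x :: y)) [seq z <- s | pos z != pos x].
  apply: eq_bigr => x _; rewrite if_upos_cons tsum_all IH//.
  by apply: subseq_uniq us; apply: map_subseq; exact: filter_subseq.
(* With distinct positions, discarding the points located at [pos x] discards [x] alone, which is
   what [rsum] does; [F] is general because the induction changes it. *)
suff gen (F : T -> seq T -> \bar R) : upos s ->
    \sum_(x <- s) F x [seq z <- s | pos z != pos x] = rsum F s by exact: gen.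
elim: s F {us IH} => [|x s IH] F /=; first by rewrite big_nil.
move=> /andP[xs us]; rewrite big_cons /= eqxx/=; congr +%E.
  congr (F x _); apply/all_filterP/allP => z zs; apply: contra xs => /eqP <-; exact: map_f.
rewrite -IH//; apply: eq_big_seq => z zs.
rewrite (_ : pos x != pos z)//; apply: contra xs => /eqP ->; exact: map_f.
Qed.

(** When positions determine points, removing a used point amounts to forbidding its position. This
    carries the factorial measure over to sums whose measurability is available. *)
Lemma fsum_gsum k h g : {in g &, injective pos} -> (forall s, 0 <= h s) ->
  fsum k h g = gsum k (if_upos h) g.
Proof.
elim: k h g => [|k IH] h g gi h0 //=.
apply: eq_esum => x gx; rewrite if_upos_cons gsum_all; last exact: if_upos_ge0.
rewrite IH//; last first.
  by move=> y z; rewrite !inE => -[gy _] [gz _]; apply: gi; rewrite inE.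
congr gsum; apply/seteqP; split=> y [gy] /= yx; split=> //.
  by apply/eqP => pyx; apply: yx; apply: gi; rewrite ?inE.
by move=> yE; move: yx; rewrite yE eqxx.
Qed.

End tuple_sums.

(** * Expansion of a product over subsets, with the signs separated *)

Section signed_expansion.
Context (R : realType) (T : choiceType).
Implicit Types (h : seq T -> \bar R) (s : seq T).

(** For symmetric [h] this is the sum of [h] over all subsequences of [s], each counted through its
    [k!] orderings. The series form, with vanishing terms beyond the length of [s], is the one that
    survives for infinite configurations. *)
Definition texp h s : \bar R :=
  \sum_(0 <= k <oo) (k`!%:R^-1)%:E * ssum k (fun y _ => h y) s.

Let coef_ge0 k : 0 <= (k`!%:R^-1)%:E :> \bar R.
Proof. by rewrite lee_fin invr_ge0. Qed.

Lemma texp_nil h : (forall s, 0 <= h s) -> texp h [::] = h [::].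
Proof.
move=> h0; rewrite /texp nneseries_recl//=; last first.
  by move=> k _; rewrite mule_ge0// ssum_ge0.
rewrite fact0 invr1 mul1e -nneseries_addn; last first.
  by move=> k; rewrite mule_ge0// ssum_ge0.
rewrite eseries0 ?adde0// => k _ _; rewrite addn1 /= mule0//.
Qed.

(** A subsequence of [x :: s] either avoids [x] or contains it; in the second case the [k.+1] places
    of [x] reduce the coefficient [1 / (k+1)!] to [1 / k!]. *)
Lemma texp_cons h x s : (forall s t, perm_eq s t -> h s = h t) ->
  (forall s, 0 <= h s) ->
  texp h (x :: s) = texp h s + texp (fun y => h (x :: y)) s.
Proof.
move=> hperm h0; rewrite /texp.
have nn u h' k : (forall s, 0 <= h' s) ->
    0 <= (k`!%:R^-1)%:E * ssum k (fun y _ => h' y) u :> \bar R.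
  by move=> h'0; rewrite mule_ge0// ssum_ge0.
rewrite nneseries_recl//=; last by move=> k _; exact: nn.
rewrite [in RHS]nneseries_recl//=; last by move=> k _; exact: nn.
rewrite -addeA; congr (_ + _).
rewrite -[LHS](@nneseries_addn _ _ 1%N); last by move=> k; exact: nn.
rewrite -[X in _ = X + _](@nneseries_addn _ _ 1%N); last by move=> k; exact: nn.
rewrite -nneseriesD; last 2 first.
- by move=> k _ _; exact: nn.
- by move=> k _ _; apply: nn => y.
apply: eq_eseriesr => k _; rewrite addn1 ssum_cons// ge0_muleDr//; last 2 first.
- exact: ssum_ge0.
- by rewrite mule_ge0 ?lee_fin// ssum_ge0.
congr +%E; rewrite muleA -EFinM; congr (_%:E * _).
by rewrite factS natrM invfM mulrAC mulVf ?mul1r.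
Qed.

Lemma eq_texp h h' s : h =1 h' -> texp h s = texp h' s.
Proof. by move/funext ->. Qed.

Lemma texpD h h' s : (forall s, 0 <= h s) -> (forall s, 0 <= h' s) ->
  texp (fun y => h y + h' y) s = texp h s + texp h' s.
Proof.
move=> h0 h'0; rewrite /texp -nneseriesD; last 2 first.
- by move=> k _ _; rewrite mule_ge0// ssum_ge0.
- by move=> k _ _; rewrite mule_ge0// ssum_ge0.
by apply: eq_eseriesr => k _; rewrite ssumD// ge0_muleDr// ssum_ge0.
Qed.

Lemma texpZ h s (c : R) : (forall s, 0 <= h s) -> (0 <= c)%R ->
  texp (fun y => c%:E * h y) s = c%:E * texp h s.
Proof.
move=> h0 c0; rewrite /texp -nneseriesZl; last first.
  by move=> k _; rewrite mule_ge0// ssum_ge0.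
by apply: eq_eseriesr => k _; rewrite ssumZ// muleCA.
Qed.

Definition posprod (f : T -> R) s : R := Num.max (\prod_(x <- s) f x)%R 0%R.
Definition negprod (f : T -> R) s : R := Num.max (- \prod_(x <- s) f x)%R 0%R.

Lemma posprod_ge0 f s : (0 <= posprod f s)%R.
Proof. by rewrite le_max lexx orbT. Qed.

Lemma negprod_ge0 f s : (0 <= negprod f s)%R.
Proof. by rewrite le_max lexx orbT. Qed.

Lemma posprodD f s : (posprod f s + negprod f s = \prod_(x <- s) `|f x|)%R.
Proof.
rewrite -normr_prod /posprod /negprod; case: (lerP 0 (\prod_(x <- s) f x)%R) => p0.
  by rewrite max_r ?oppr_le0 ?addr0 ?ger0_norm.
by rewrite max_l ?oppr_ge0 ?add0r ?ltr0_norm// ltW.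
Qed.

Lemma posprod_cons f x s : posprod f (x :: s) =
  (Num.max (f x) 0 * posprod f s + Num.max (- f x) 0 * negprod f s)%R.
Proof.
rewrite /posprod /negprod big_cons; set p := (\prod_(_ <- _) _)%R.
case: (lerP 0 (f x)) => fx0; case: (lerP 0 p) => p0;
  rewrite /Num.max; do !case: ifPn => //; rewrite -?leNgt; nra.
Qed.

Lemma negprod_cons f x s : negprod f (x :: s) =
  (Num.max (f x) 0 * negprod f s + Num.max (- f x) 0 * posprod f s)%R.
Proof.
rewrite /posprod /negprod big_cons; set p := (\prod_(_ <- _) _)%R.
case: (lerP 0 (f x)) => fx0; case: (lerP 0 p) => p0;
  rewrite /Num.max; do !case: ifPn => //; rewrite -?leNgt; nra.
Qed.

(** Adding a point with [f x = fp - fn] mixes the positive and the negative sums linearly, and the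
    relation between them is preserved. The negative terms stay on the left, so that no extended
    real is subtracted. *)
Lemma signed_expansion (f : T -> R) s : (forall x, 0 <= 1 + f x)%R ->
  (\prod_(x <- s) (1 + f x))%R%:E + texp (fun y => (negprod f y)%:E) s =
  texp (fun y => (posprod f y)%:E) s.
Proof.
move=> f1.
have p0 y : 0 <= (posprod f y)%:E by rewrite lee_fin posprod_ge0.
have n0 y : 0 <= (negprod f y)%:E by rewrite lee_fin negprod_ge0.
have pperm y z : perm_eq y z -> posprod f y = posprod f z.
  by move=> yz; rewrite /posprod (perm_big _ yz).
have nperm y z : perm_eq y z -> negprod f y = negprod f z.
  by move=> yz; rewrite /negprod (perm_big _ yz).
elim: s => [|x s IH].
  rewrite !texp_nil// /posprod /negprod !big_nil max_r ?lerN10// max_l//.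
  by rewrite adde0.
rewrite !texp_cons//; last 2 first.
- by move=> y z /pperm ->.
- by move=> y z /nperm ->.
set fp := Num.max (f x) 0%R; set fn := Num.max (- f x)%R 0%R.
have fp0 : (0 <= fp)%R by rewrite le_max lexx orbT.
have fn0 : (0 <= fn)%R by rewrite le_max lexx orbT.
have fE : (f x = fp - fn)%R.
  rewrite /fp /fn; case: (lerP 0 (f x)) => fx0; rewrite /Num.max;
    do !case: ifPn => //; rewrite -?leNgt; lra.
have M0 : (0 <= \prod_(x <- s) (1 + f x))%R by exact: prodr_ge0.
move: IH; set M := (\prod_(x <- s) (1 + f x))%R in M0 *.
set TN := texp (fun y => (negprod f y)%:E) s.
set TP := texp (fun y => (posprod f y)%:E) s => IH.
have TN0 : 0 <= TN by apply: nneseries_ge0 => k _ _; rewrite mule_ge0// ssum_ge0.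
rewrite (@eq_texp (fun y => (negprod f (x :: y))%:E)
  (fun y => fp%:E * (negprod f y)%:E + fn%:E * (posprod f y)%:E)); last first.
  by move=> y; rewrite negprod_cons EFinD !EFinM.
rewrite (@eq_texp (fun y => (posprod f (x :: y))%:E)
  (fun y => fp%:E * (posprod f y)%:E + fn%:E * (negprod f y)%:E)); last first.
  by move=> y; rewrite posprod_cons EFinD !EFinM.
rewrite !texpD; do ?by move=> y; rewrite mule_ge0.
rewrite !texpZ// -/TN -/TP -IH big_cons -/M.
rewrite !ge0_muleDr ?lee_fin//.
rewrite [LHS](AC (1*(1*(1*2)))%AC ((1*4)*(2*3*5))%AC).
rewrite [RHS](AC (2*(2*1))%AC ((1*3)*(2*4*5))%AC)/=.
congr (_ + _); rewrite -!EFinM -!EFinD; congr EFin; rewrite fE; ring.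
Qed.

End signed_expansion.

(** * Measurability on the configuration space *)

Section configuration_measurability.
Local Open Scope card_scope.
Context d (T : measurableType d) (R : realType).

Definition ct (A : set T) : \bar R := \esum_(x in A) 1.

Lemma esum_fset_set (A : set T) (f : T -> \bar R) : finite_set A ->
  (forall x, 0 <= f x) -> \esum_(x in A) f x = \sum_(x <- fset_set A) f x.
Proof. by move=> finA f0; rewrite esum_fset// fsbig_finite. Qed.

Lemma ct_finite (A : set T) : finite_set A -> ct A = (#|` fset_set A|)%:R%:E.
Proof.
move=> finA; rewrite /ct esum_fset_set// sumEFin.
by rewrite big_const_seq count_predT iter_addr addr0.
Qed.

Lemma ct_infinite_ge (A : set T) n : ~ finite_set A -> n%:R%:E <= ct A.
Proof.
move=> iA; have [B BA nB] := infinite_set_fset n iA.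
apply: esum_ge; exists [set` B]; first by split.
rewrite fsbig_finite//= set_fsetK sumEFin big_const_seq count_predT.
by rewrite iter_addr addr0 lee_fin ler_nat.
Qed.

Lemma ctP (A : set T) k : (A #= `I_k) <-> ct A = k%:R%:E.
Proof.
split=> [Ak|].
  have finA : finite_set A by apply/finite_setP; exists k.
  rewrite ct_finite//; congr (_%:R%:E); apply/card_eq_fsetP.
  by rewrite fset_setK.
case: (pselect (finite_set A)) => finA.
  rewrite ct_finite// => -[/eqP]; rewrite eqr_nat => /eqP Ak.
  by rewrite -[A]fset_setK//; apply/card_eq_fsetP.
move=> Ak; exfalso.
have := ct_infinite_ge k.+1 finA.
by rewrite Ak lee_fin ler_nat ltnn.
Qed.

Lemma ct_ge0 A : 0 <= ct A. Proof. exact: esum_ge0. Qed.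

Lemma ct_finiteP A : finite_set A <-> ct A < +oo.
Proof.
split=> [finA|ctA]; first by rewrite ct_finite// ltry.
apply: contrapT => iA; move: ctA; apply/negP; rewrite -leNgt leye_eq.
apply/eqP/eqyP => r r0; apply: (@le_trans _ _ (Num.truncn r).+1%:R%:E).
  by rewrite lee_fin ltW// truncnS_gt.
exact/ct_infinite_ge.
Qed.

Lemma ctE A : (exists k : nat, ct A = k%:R%:E) \/ ct A = +oo.
Proof.
case: (pselect (finite_set A)) => finA.
  by left; eexists; exact: ct_finite.
right; apply/eqP; rewrite -leye_eq leNgt; apply/negP => /ct_finiteP.
exact: finA.
Qed.

Lemma ctID (A B : set T) : ct A = ct (A `&` B) + ct (A `&` ~` B).
Proof. by rewrite /ct (esumID B). Qed.

Lemma ctI_indic (A B : set T) : ct (A `&` B) = \esum_(x in A) (\1_B x)%:E.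
Proof.
rewrite /ct esum_mkcondr; apply: eq_esum => x _.
by rewrite indicE; case: ifP.
Qed.

(** Only the events of finite count are generators; the event of an infinite count is the complement
    of their countable union. *)
Lemma measurable_ct (B : set T) : measurable B ->
  measurable_fun setT (fun xi : config T => ct (xi `&` B)).
Proof.
move=> mB _ Y mY; rewrite setTI.
have mk k : measurable [set xi : config T | xi `&` B #= `I_k].
  by apply: sub_sigma_algebra; exists B => //; exists k.
have -> : (fun xi : config T => ct (xi `&` B)) @^-1` Y =
    (\bigcup_(k in [set k | Y k%:R%:E]) [set xi : config T | xi `&` B #= `I_k])
    `|` (if `[< Y +oo >] then ~` \bigcup_k [set xi : config T | xi `&` B #= `I_k]
         else set0).
  apply/seteqP; split=> [xi /= Yxi|xi [[k /= Yk /ctP kE]|]].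
  - case: (ctE (xi `&` B)) => [[k kE]|E].
      by left; exists k; rewrite /= -?kE//; exact/ctP.
    right; rewrite E in Yxi; rewrite asboolT// => -[k _ /= /ctP].
    by rewrite E.
  - by rewrite /= kE.
  - case: asboolP => // Yoo nk; case: (ctE (xi `&` B)) => [[k kE]|E] /=; last by rewrite E.
    by exfalso; apply: nk; exists k => //=; apply/ctP.
apply: measurableU; first by apply: bigcup_measurable => k _; exact: mk.
case: ifP => _ //; apply: measurableC; apply: bigcup_measurable => k _; exact: mk.
Qed.

Lemma measurable_config dY (Y : measurableType dY) (phi : Y -> config T) :
  (forall B, measurable B -> measurable_fun setT (fun y => ct (phi y `&` B))) ->
  measurable_fun setT phi.
Proof.
move=> mphi _ U mU; rewrite setTI.
suff : <<s [set [set g : config T | g `&` B #= `I_k] | B in measurable & k in setT] >>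
    `<=` [set U | measurable (phi @^-1` U)] by exact.
apply: smallest_sub.
  split=> [|A mA|F mF] /=.
  - by rewrite preimage_set0.
  - by rewrite setTD preimage_setC; exact: measurableC.
  - by rewrite preimage_bigcup; apply: bigcup_measurable => k _; exact: mF.
move=> _ [B mB [k _ <-]] /=.
rewrite (_ : _ @^-1` _ = (fun y => ct (phi y `&` B)) @^-1` [set k%:R%:E]).
  by rewrite -[X in measurable X]setTI; exact: mphi.
by apply/seteqP; split=> y /= /ctP.
Qed.

Lemma measurable_config_countP dY (Y : measurableType dY) (phi : Y -> config T) B :
  measurable_fun setT phi -> measurable B ->
  measurable_fun setT (fun y => ct (phi y `&` B)).
Proof.
move=> mphi mB.
exact: (@measurableT_comp _ _ _ _ _ _ (fun xi : config T => ct (xi `&` B)) _ phi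
  (measurable_ct mB) mphi).
Qed.

Section cell_kernel.
Context dY (Y : measurableType dY) (phi : Y -> config T).
Hypothesis mphi : measurable_fun setT phi.
Variables (C : set T) (m : nat).
Hypothesis mC : measurable C.

(** Listing the points in [C] only when there are at most [m] of them bounds the total mass, so that
    the counting measure is a finite kernel and sums of jointly measurable functions over it are
    measurable. *)
Definition cell (y : Y) : seq T :=
  if ct (phi y `&` C) <= m%:R%:E then enum_fset (fset_set (phi y `&` C)) else [::].

Definition cell_measure (y : Y) : {measure set T -> \bar R} :=
  msum (fun i => \d_(nth point (cell y) i)) (size (cell y)).

Lemma integral_cell_measure y (f : T -> \bar R) : measurable_fun setT f ->
  (forall x, 0 <= f x) -> \int[cell_measure y]_x f x = \sum_(x <- cell y) f x.
Proof.
move=> mf f0; rewrite ge0_integral_measure_sum// (big_nth point) big_mkord.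
by apply: eq_bigr => i _; rewrite integral_dirac// diracT mul1e.
Qed.

Lemma cellE y : cell y =
  if ct (phi y `&` C) <= m%:R%:E then enum_fset (fset_set (phi y `&` C)) else [::].
Proof. by []. Qed.

Lemma sum_cell y (f : T -> \bar R) : (forall x, 0 <= f x) ->
  \sum_(x <- cell y) f x =
  if ct (phi y `&` C) <= m%:R%:E then \esum_(x in phi y `&` C) f x else 0.
Proof.
move=> f0; rewrite cellE; case: ifPn => [cm|_]; last by rewrite big_nil.
rewrite esum_fset_set//; apply/ct_finiteP; exact: le_lt_trans cm (ltry _).
Qed.

Lemma cell_measureE y U : measurable U ->
  cell_measure y (U `&` setT) = \sum_(x <- cell y) (\1_U x)%:E.
Proof.
move=> mU; rewrite -integral_indic//.
apply: (@integral_cell_measure y (fun x => (\1_U x)%:E)).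
  by apply/measurable_EFinP; exact: measurable_indic.
by move=> x; rewrite lee_fin.
Qed.

Let measurable_cell_measure U : measurable U ->
  measurable_fun setT (cell_measure ^~ U).
Proof.
move=> mU.
have -> : (cell_measure ^~ U) = (fun y =>
   if ct (phi y `&` C) <= m%:R%:E then ct (phi y `&` (C `&` U)) else 0).
  apply/funext => y; rewrite -(setIT U) cell_measureE//.
  by rewrite sum_cell ?setIT ?setIA ?ctI_indic// => x; rewrite lee_fin.
apply: measurable_fun_ifT.
- by apply: measurable_fun_lee => //; exact: measurable_config_countP.
- by apply: measurable_config_countP => //; exact: measurableI.
- exact: measurable_cst.
Qed.

HB.instance Definition _ := isKernel.Build _ _ _ _ R cell_measure
  measurable_cell_measure.

Let cell_measure_uub : measure_fam_uub cell_measure.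
Proof.
exists (m.+1%:R)%R => y; rewrite -[X in _ X < _](setIT setT) cell_measureE//.
rewrite sum_cell; last by move=> x; rewrite lee_fin.
case: ifPn => [cm|_]; last by rewrite lte_fin.
by rewrite -ctI_indic setIT (le_lt_trans cm)// lte_fin ltr_nat.
Qed.

HB.instance Definition _ := Kernel_isFinite.Build _ _ _ _ R cell_measure
  cell_measure_uub.

Lemma measurable_sum_cell (f : Y * T -> \bar R) : measurable_fun setT f ->
  (forall q, 0 <= f q) ->
  measurable_fun setT (fun y => \sum_(x <- cell y) f (y, x)).
Proof.
move=> mf f0.
have := @measurable_fun_integral_finite_kernel _ _ _ _ _ f cell_measure f0 mf.
congr measurable_fun; apply/funext => y; rewrite integral_cell_measure//.
exact: (measurableT_comp mf (pair1_measurable y)).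
Qed.

End cell_kernel.
End configuration_measurability.

Lemma measurable_EFin_indic d (T : measurableType d) (R : realType) (B : set T) :
  measurable B -> measurable_fun setT (fun x => (\1_B x : R)%:E).
Proof. by move=> mB; apply/measurable_EFinP; exact: measurable_indic. Qed.

Section locally_finite_configurations.
Context d (T : measurableType d) (R : realType).
Variable A : nat -> set T.
Hypothesis mA : forall n, measurable (A n).
Hypothesis ndA : forall n m, (n <= m)%N -> A n `<=` A m.
Hypothesis AT : forall x, exists n, A n x.

Definition lf (xi : config T) := forall n, finite_set (xi `&` A n).

(* Measurability is only available for sums over locally finite
   configurations; the other ones form a null set and are replaced by the empty
   configuration. *)
Definition star (xi : config T) : config T :=
  if `[< lf xi >] then xi else restr xi set0.

Lemma star_lf xi : lf xi -> star xi = xi.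
Proof. by move=> lfx; rewrite /star asboolT. Qed.

Lemma lf_star xi : lf (star xi).
Proof.
rewrite /star; case: asboolP => // _ n.
by apply: sub_finite_set (@finite_set0 T) => x [[_ []]].
Qed.

Lemma esum_star xi (f : T -> \bar R) : \esum_(x in star xi) f x =
  if `[< lf xi >] then \esum_(x in xi) f x else 0.
Proof. by rewrite /star; case: asboolP => // _; rewrite /= setI0 esum_set0. Qed.

Section family.
Context dY (Y : measurableType dY) (phi : Y -> config T).
Hypothesis mphi : measurable_fun setT phi.

Lemma measurable_lf_fun : measurable_fun setT (fun y => `[< lf (phi y) >]).
Proof.
apply: (measurable_fun_bool true); rewrite setTI.
rewrite (_ : _ @^-1` _ =
    \bigcap_n [set y | ct R (phi y `&` A n) < +oo]); last first.
  apply/seteqP; split=> y /=; first by move/asboolP => lfy n _; apply/ct_finiteP; exact: lfy.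
  by move=> H; apply/asboolP => n; apply/(ct_finiteP R); exact: H.
apply: bigcapT_measurable => n; rewrite -[X in measurable X]setTI.
by apply: emeasurable_fun_infty_o => //; exact: measurable_config_countP.
Qed.

(** Two limits of sums over cells: first the truncation level grows, and is eventually harmless
    since a window of a locally finite configuration holds finitely many points; then the windows
    grow. *)
Lemma measurable_esum_star (f : Y * T -> \bar R) : measurable_fun setT f ->
  (forall q, 0 <= f q) ->
  measurable_fun setT (fun y => \esum_(x in star (phi y)) f (y, x)).
Proof.
move=> mf f0.
apply: (@emeasurable_fun_cvg _ _ _ _ (fun n y =>
  if `[< lf (phi y) >] then \esum_(x in phi y `&` A n) f (y, x) else 0)); last first.
  move=> y _; rewrite esum_star; case: asboolP => [_|_]; last exact: cvg_cst.
  under eq_fun do rewrite esum_mkcondr.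
  apply: cvg_esum => [n x|x n m nm|x].
  - by case: ifP.
  - case: ifPn => [|_]; last by case: ifP.
    by rewrite !inE => /(ndA nm) => Am; rewrite ifT// inE.
  - have [n Anx] := AT x; apply: cvg_near_cst; exists n => // m /= nm.
    by rewrite ifT// inE; exact: ndA Anx.
move=> n; apply: (@emeasurable_fun_cvg _ _ _ _ (fun m y =>
  if `[< lf (phi y) >] then \sum_(x <- cell R phi (A n) m y) f (y, x) else 0)); last first.
  move=> y _; case: asboolP => [lfy|_]; last exact: cvg_cst.
  have := lfy n => /(ct_finite R) ctE.
  apply: cvg_near_cst; exists (#|` fset_set (phi y `&` A n)|)%N => // m /= nm.
  by rewrite sum_cell// ifT// ctE lee_fin ler_nat.
move=> m; apply: measurable_fun_ifT.
- exact: measurable_lf_fun.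
- exact: measurable_sum_cell.
- exact: measurable_cst.
Qed.

Lemma measurable_star_fun : measurable_fun setT (fun y => star (phi y)).
Proof.
apply: (@measurable_config _ _ R) => B mB.
under eq_fun do rewrite ctI_indic.
apply: (@measurable_esum_star (fun q => (\1_B q.2)%:E)); last first.
  by move=> q; rewrite lee_fin.
exact: (measurableT_comp (measurable_EFin_indic mB) measurable_snd).
Qed.

End family.

Lemma measurable_gsum k dY (Y : measurableType dY) (phi : Y -> config T)
    (h : Y -> seq T -> \bar R) :
  measurable_fun setT phi -> mseq h -> (forall y s, 0 <= h y s) ->
  measurable_fun setT (fun y => gsum k (h y) (star (phi y))).
Proof.
elim: k dY Y phi h => [|k IH] dY Y phi h mphi mh h0.
  by have /mseqn0 := mh 0%N.
apply: (@measurable_esum_star _ _ _ mphi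
  (fun q => gsum k (fun s => h q.1 (q.2 :: s)) (star (phi q.1)))); last first.
  by move=> q; exact: gsum_ge0.
apply: (IH _ _ (phi \o fst) (fun q s => h q.1 (q.2 :: s))) => //.
  exact: measurableT_comp.
exact: mseq_cons.
Qed.

Lemma measurable_splice (L : set T) dY (Y : measurableType dY)
    (phi psi : Y -> config T) : measurable L ->
  measurable_fun setT phi -> measurable_fun setT psi ->
  measurable_fun setT (fun y => superpose (restr (phi y) L) (restr (psi y) (~` L))).
Proof.
move=> mL mphi mpsi; apply: (@measurable_config _ _ R) => B mB.
have -> : (fun y => ct R (superpose (restr (phi y) L) (restr (psi y) (~` L)) `&` B)) =
    (fun y => ct R (phi y `&` (L `&` B)) + ct R (psi y `&` (~` L `&` B))).
  apply/funext => y; rewrite (ctID _ _ L); congr (_ + _); congr ct => /=.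
    apply/seteqP; split=> x /=; first by move=> [[[[? ?]|[? ?]] ?] ?].
    by move=> [? [? ?]]; split=> //; split=> //; left.
  apply/seteqP; split=> x /=; first by move=> [[[[? ?]|[? ?]] ?] ?].
  by move=> [? [? ?]]; split=> //; split=> //; right.
apply: emeasurable_funD; apply: measurable_config_countP => //; apply: measurableI => //.
exact: measurableC.
Qed.

Lemma mseq_big dX (X : measurableType dX) (f : X * T -> \bar R) :
  measurable_fun setT f -> mseq (fun p s => \sum_(x <- s) f (p, x)).
Proof.
move=> mf n; elim: n => [|n IH].
  by apply/mseqn0; under eq_fun do rewrite big_nil; exact: measurable_cst.
apply/mseqnS; rewrite /mseqn/=; under eq_fun do rewrite big_cons.
apply: emeasurable_funD.
  rewrite (_ : (fun _ => _) = f \o fst); first exact: measurableT_comp.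
  by apply/funext => -[[]].
exact: (mseqn_comp (F := fun p s => \sum_(x <- s) f (p, x)) measurable_fst IH).
Qed.

Lemma mseq_all dX (X : measurableType dX) (b : X * T -> bool) :
  measurable_fun setT b -> mseq (fun p s => all (fun x => b (p, x)) s).
Proof.
move=> mb n; elim: n => [|n IH].
  by apply/mseqn0; exact: measurable_cst.
apply/mseqnS; rewrite /mseqn/=; apply: measurable_and.
  rewrite (_ : (fun _ => _) = b \o fst); first exact: measurableT_comp.
  by apply/funext => -[[]].
exact: (mseqn_comp (F := fun p s => all (fun x => b (p, x)) s) measurable_fst IH).
Qed.

Section positions.
Context (D : eqType) (pos : T -> D).
Hypothesis mpos : measurable_fun setT (fun q : T * T => pos q.1 == pos q.2).

Lemma measurable_pos2 dX (X : measurableType dX) :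
  measurable_fun setT (fun q : X * T * T => pos q.1.2 == pos q.2).
Proof.
have mc : measurable_fun setT (fun q : X * T * T => (q.1.2, q.2)).
  apply: measurable_fun_pair => //.
  exact: (measurableT_comp measurable_snd measurable_fst).
exact: (measurableT_comp mpos mc).
Qed.

Lemma mseq_upos dX (X : measurableType dX) : mseq (fun (_ : X) s => upos pos s).
Proof.
move=> n; elim: n => [|n IH].
  by apply/mseqn0; exact: measurable_cst.
apply/mseqnS; rewrite /mseqn.
rewrite (_ : (fun _ => _) = (fun q : X * T * n.-tuple T =>
   all (fun z => ~~ (pos q.1.2 == pos z)) q.2 && upos pos q.2)); last first.
  apply/funext => q; rewrite /upos /=; congr andb.
  by elim: (tval q.2) => //= z y IHy; rewrite inE negb_or IHy.
apply: measurable_and.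
  apply: (@mseq_all _ _ (fun q : X * T * T => ~~ (pos q.1.2 == pos q.2))).
  exact: (measurable_neg (@measurable_pos2 _ X)).
exact: (mseqn_comp (F := fun (_ : X) s => upos pos s) measurable_fst IH).
Qed.

Lemma mseq_if_upos dX (X : measurableType dX) (h : X -> seq T -> \bar R) :
  mseq h -> mseq (fun p => if_upos pos (h p)).
Proof.
move=> mh n; apply: measurable_fun_ifT; [exact: mseq_upos|exact: mh|].
exact: measurable_cst.
Qed.

Definition upos_config (s : seq T) := config_seq (if upos pos s then s else [::]).

Lemma mseq_upos_config dX (X : measurableType dX) :
  mseq (fun _ : X => upos_config).
Proof.
move=> n; apply: (@measurable_config _ _ R) => B mB.
rewrite [X in measurable_fun _ X](_ : _ = (fun q : X * n.-tuple T =>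
   if upos pos q.2 then \sum_(x <- q.2) (\1_B x)%:E else 0)).
  apply: measurable_fun_ifT; [exact: mseq_upos| |exact: measurable_cst].
  apply: (@mseq_big _ _ (fun q => (\1_B q.2)%:E)).
  exact: (measurableT_comp (measurable_EFin_indic mB) measurable_snd).
apply/funext => q; rewrite ctI_indic /upos_config; case: ifPn => [us|_] /=.
  by rewrite esum_seq//; exact: upos_uniq us.
by rewrite (_ : [set` [::]] = set0) ?esum_set0//; apply/seteqP; split.
Qed.

Definition simple_lf := [set xi : config T | lf xi /\ {in (xi : set T) &, injective pos}].

Lemma measurable_simple_lf : measurable simple_lf.
Proof.
(* [w] is 1 exactly when the position of the point is occupied more than once, so on locally finite
   configurations its sum vanishes precisely when positions are distinct. *)
pose w (q : config T * T) : \bar R :=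
  if \esum_(y in star q.1) (if pos q.2 == pos y then 1 else 0) <= 1 :> \bar R then 0 else 1.
have w0 q : 0 <= w q by rewrite /w; case: ifP.
have mw : measurable_fun setT w.
  apply: measurable_fun_ifT; [|exact: measurable_cst|exact: measurable_cst].
  apply: measurable_fun_lee; last exact: measurable_cst.
  apply: (@measurable_esum_star _ _ fst measurable_fst
    (fun q : config T * T * T => if pos q.1.2 == pos q.2 then 1 else 0)); last first.
    by move=> q; case: ifP.
  apply: measurable_fun_ifT; [|exact: measurable_cst|exact: measurable_cst].
  exact: measurable_pos2.
rewrite (_ : simple_lf = [set xi | `[< lf xi >] ] `&`
    [set xi | \esum_(x in star xi) w (xi, x) <= 0]).
  apply: measurableI.
    have := @measurable_lf_fun _ _ id (@measurable_id _ _ setT) measurableT [set true].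
    by rewrite setTI; exact.
  rewrite -[X in measurable X]setTI; apply: emeasurable_fun_infty_c => //.
  exact: (@measurable_esum_star _ _ id (@measurable_id _ _ setT) w).
apply/seteqP; split=> xi /=.
  move=> [lfx inj]; split; first exact/asboolP.
  rewrite esum1// => x; rewrite /= star_lf// => xix; rewrite /w /= star_lf// ifT//.
  rewrite (@eq_esum _ _ _ _ (fun y => if y \in [set x] then 1 else 0)).
    rewrite -esum_mkcondr (_ : _ `&` _ = [set x]) ?esum_set1//.
    by apply/seteqP; split=> y /=; [case|move=> ->].
  move=> y xiy; have [pxy|pxy] := eqVneq (pos x) (pos y).
    by rewrite ifT// inE/=; apply/esym/inj; rewrite ?inE.
  by rewrite memNset//= => yx; move: pxy; rewrite yx eqxx.
move=> [/asboolP lfx]; rewrite star_lf// => wE; split=> // x y; rewrite !inE => xix xiy pxy.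
apply: contrapT => xy.
have : w (xi, x) <= 0.
  apply: le_trans wE; rewrite -(@esum_set1 R T x (fun z => w (xi, z)))//.
  apply: (@le_trans _ _ (\esum_(z in xi) if z \in [set x] then w (xi, z) else 0)).
    rewrite -esum_mkcondr (_ : xi `&` [set x] = [set x]) ?esum_set1//.
    by apply/seteqP; split=> z /=; [case|move=> ->].
  by apply: le_esum => z _; case: ifP.
rewrite /w/= star_lf//; case: ifPn => [|_]; last by rewrite lee_fin ler10.
rewrite leNgt => /negP[]; apply: (@lt_le_trans _ _ (2%:R%:E)); first by rewrite lte_fin ltr1n.
apply: esum_ge; exists [set` [fset x; y]%fset].
  by split=> // z /=; rewrite !inE => /orP[/eqP ->|/eqP ->].
rewrite fsbig_finite//= set_fsetK big_fsetU1/=; last by rewrite inE; apply/eqP.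
by rewrite big_seq_fset1 eqxx pxy eqxx.
Qed.

End positions.
End locally_finite_configurations.

(** * Boltzmann factors *)

Section boltzmann_factors.
Context (R : realType).
Variable beta : R.
Hypothesis beta0 : (0 < beta)%R.
Implicit Types p n : \bar R.

(* [bexp p n] is the Boltzmann factor of an energy with positive part [p] and
   negative part [n]; it is set to [0] when [n] is infinite, which makes it
   multiplicative without exception. *)
Definition nexp p : R := if p == +oo then 0%R else expR (- (beta * fine p)).
Definition pexp n : R := if n == +oo then 0%R else expR (beta * fine n).
Definition bexp p n : R := (nexp p * pexp n)%R.

Lemma nexp_ge0 p : (0 <= nexp p)%R.
Proof. by rewrite /nexp; case: ifP => // _; rewrite expR_ge0. Qed.

Lemma pexp_ge0 n : (0 <= pexp n)%R.
Proof. by rewrite /pexp; case: ifP => // _; rewrite expR_ge0. Qed.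

Lemma bexp_ge0 p n : (0 <= bexp p n)%R.
Proof. exact: mulr_ge0 (nexp_ge0 _) (pexp_ge0 _). Qed.

Lemma bexp0 : bexp 0 0 = 1%R.
Proof. by rewrite /bexp /nexp /pexp/= mulr0 oppr0 expR0 mulr1. Qed.

Lemma nexpD p p' : 0 <= p -> 0 <= p' -> nexp (p + p') = (nexp p * nexp p')%R.
Proof.
rewrite /nexp; move: p p' => [p| |] [p'| |] //= _ _; rewrite ?mulr0 ?mul0r//.
by rewrite mulrDr opprD expRD.
Qed.

Lemma pexpD p p' : 0 <= p -> 0 <= p' -> pexp (p + p') = (pexp p * pexp p')%R.
Proof.
rewrite /pexp; move: p p' => [p| |] [p'| |] //= _ _; rewrite ?mulr0 ?mul0r//.
by rewrite mulrDr expRD.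
Qed.

Lemma bexpD p p' n n' : 0 <= p -> 0 <= p' -> 0 <= n -> 0 <= n' ->
  bexp (p + p') (n + n') = (bexp p n * bexp p' n')%R.
Proof. by move=> *; rewrite /bexp nexpD// pexpD// mulrACA. Qed.

Lemma bexp_sum (I : Type) (s : seq I) (P N : I -> \bar R) :
  (forall i, 0 <= P i) -> (forall i, 0 <= N i) ->
  bexp (\sum_(i <- s) P i) (\sum_(i <- s) N i) = (\prod_(i <- s) bexp (P i) (N i))%R.
Proof.
move=> P0 N0; elim: s => [|i s IH]; first by rewrite !big_nil bexp0.
by rewrite !big_cons bexpD ?IH ?sume_ge0.
Qed.

Lemma measurable_nexp dX (X : measurableType dX) (p : X -> \bar R) :
  measurable_fun setT p -> measurable_fun setT (fun x => nexp (p x)).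
Proof.
move=> mp; apply: measurable_fun_ifT; [exact: measurable_fun_eqe|exact: measurable_cst|].
apply: (measurableT_comp (@measurable_expR R)); apply: measurable_funN.
by apply: measurable_funM => //; exact: (measurableT_comp (fine_measurable measurableT) mp).
Qed.

Lemma measurable_pexp dX (X : measurableType dX) (p : X -> \bar R) :
  measurable_fun setT p -> measurable_fun setT (fun x => pexp (p x)).
Proof.
move=> mp; apply: measurable_fun_ifT; [exact: measurable_fun_eqe|exact: measurable_cst|].
apply: (measurableT_comp (@measurable_expR R)).
by apply: measurable_funM => //; exact: (measurableT_comp (fine_measurable measurableT) mp).
Qed.

Lemma measurable_bexp dX (X : measurableType dX) (p n : X -> \bar R) :
  measurable_fun setT p -> measurable_fun setT n ->
  measurable_fun setT (fun x => bexp (p x) (n x)).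
Proof.
by move=> mp mn; apply: measurable_funM; [exact: measurable_nexp|exact: measurable_pexp].
Qed.

Lemma expeR_bexp p n : 0 <= p -> 0 <= n -> n < +oo ->
  expeR (- (beta%:E * (p - n))) = (bexp p n)%:E.
Proof.
rewrite /bexp /nexp /pexp; move: p n => [p| |] [n| |] //= _ _ _.
  rewrite -expRD; congr (expR _)%:E; ring.
by rewrite gt0_muley ?lte_fin//= mul0r.
Qed.

Lemma expeR_neg_mulD (u v : \bar R) : -oo < u -> -oo < v ->
  expeR (- (beta%:E * (u + v))) = expeR (- (beta%:E * u)) * expeR (- (beta%:E * v)).
Proof.
move: u v => [u| |] [v| |] //= _ _.
- by rewrite mulrDr opprD expRD EFinM.
- by rewrite gt0_muley ?lte_fin//= mule0.
- by rewrite gt0_muley ?lte_fin//= mul0e.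
- by rewrite gt0_muley ?lte_fin//= mul0e.
Qed.

Lemma cvg_nexp (p_ : nat -> \bar R) p : (forall k, 0 <= p_ k) ->
  p_ k @[k --> \oo] --> p -> nexp (p_ k) @[k --> \oo] --> nexp p.
Proof.
move=> p0 pp; have p0' : 0 <= p.
  by rewrite -(cvg_lim _ pp)//; apply: lime_ge; [exact: cvgP pp|exact: nearW].
case: p pp p0' => [p| |]//= pp _.
  have [pfin ppf] := iffLR (fine_cvgP _ _) pp.
  have cg : {for p, continuous (fun x : R => expR (- (beta * x)))}.
    apply: (@continuous_comp _ _ _ (fun x : R => - (beta * x))%R expR).
      by apply: continuousN; exact: mulrl_continuous.
    exact: continuous_expR.
  have cgp := continuous_cvg _ cg ppf.
  have H : {near \oo, (fun k => expR (- (beta * (fine \o p_) k))) =1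
      (fun k => nexp (p_ k))}.
    apply: filterS pfin => k pk; rewrite /nexp /= ifF//.
    by apply/negbTE; move: pk; case: (p_ k).
  exact: (cvg_trans (near_eq_cvg H) (cgp _)).
have -> : nexp +oo = 0%R by rewrite /nexp eqxx.
apply/cvgrPdist_lt => eps eps0.
have /cvgrPdist_lt/(_ eps eps0)[m _ mE] := @cvgn_expR R.
have := mE m (leqnn m); rewrite sub0r normrN ger0_norm ?expR_ge0// => meps.
have /cvgeyPge/(_ (m%:R / beta)%R) := pp.
apply: filterS => k pk; rewrite sub0r normrN ger0_norm ?nexp_ge0//.
apply: le_lt_trans meps; rewrite /nexp; case: ifPn => [_|]; first exact: expR_ge0.
move: pk; case: (p_ k) => [q| |]//= qm _.
by rewrite ler_expR lerN2 mulrC -ler_pdivrMr.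
Qed.

End boltzmann_factors.

(** * Multiplicative form of the interaction between finite and infinite configurations *)

Section interaction.
Context d (T : measurableType d) (R : realType).
Variable beta : R.
Hypothesis beta0 : (0 < beta)%R.
Variables (Psi : T -> \bar R) (Phi : T -> T -> \bar R).
Hypothesis Phi_sym : forall x y, Phi x y = Phi y x.
Implicit Types (s t : seq T) (g : set T).

Definition psi x : R := bexp beta (Psi^\+ x) (Psi^\- x).
Definition pairb x y : R := bexp beta ((Phi x)^\+ y) ((Phi x)^\- y).
(** The factor [e^{-beta E(x | g)}], with the two signs summed separately. Its value 0 for a
    divergent negative part makes it multiplicative over disjoint unions for all configurations. *)
Definition condb x g : R :=
  bexp beta (\esum_(y in g) (Phi x)^\+ y) (\esum_(y in g) (Phi x)^\- y).
Definition condbs s g : R := (\prod_(x <- s) condb x g)%R.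
Definition cross s t : R := (\prod_(x <- s) \prod_(y <- t) pairb x y)%R.
Fixpoint selfb s : R :=
  if s is x :: s' then ((\prod_(y <- s') pairb x y) * selfb s')%R else 1%R.

Lemma pairb_sym x y : pairb x y = pairb y x.
Proof. by rewrite /pairb !funeposE !funenegE Phi_sym. Qed.

Lemma psi_ge0 x : (0 <= psi x)%R. Proof. exact: bexp_ge0. Qed.
Lemma pairb_ge0 x y : (0 <= pairb x y)%R. Proof. exact: bexp_ge0. Qed.
Lemma condb_ge0 x g : (0 <= condb x g)%R. Proof. exact: bexp_ge0. Qed.
Lemma condbs_ge0 s g : (0 <= condbs s g)%R.
Proof. by apply: prodr_ge0 => x _; exact: condb_ge0. Qed.
Lemma cross_ge0 s t : (0 <= cross s t)%R.
Proof. by apply: prodr_ge0 => x _; apply: prodr_ge0 => y _; exact: pairb_ge0. Qed.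
Lemma selfb_ge0 s : (0 <= selfb s)%R.
Proof.
by elim: s => //= x s IH; rewrite mulr_ge0// prodr_ge0// => y _; exact: pairb_ge0.
Qed.

Lemma cross_sym s t : cross s t = cross t s.
Proof.
rewrite /cross exchange_big/=; apply: eq_bigr => x _; apply: eq_bigr => y _.
exact: pairb_sym.
Qed.

Lemma cross_consl x s t : cross (x :: s) t = ((\prod_(y <- t) pairb x y) * cross s t)%R.
Proof. by rewrite /cross big_cons. Qed.

Lemma cross_catl s s' t : cross (s ++ s') t = (cross s t * cross s' t)%R.
Proof. by rewrite /cross big_cat. Qed.

Lemma cross_catr s t t' : cross s (t ++ t') = (cross s t * cross s t')%R.
Proof. by rewrite cross_sym cross_catl !(cross_sym s). Qed.

Lemma cross_permr s t t' : perm_eq t t' -> cross s t = cross s t'.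
Proof. by move=> tt'; apply: eq_bigr => x _; rewrite (perm_big _ tt'). Qed.

Lemma selfb_cat s t : selfb (s ++ t) = (selfb s * cross s t * selfb t)%R.
Proof.
elim: s => [|x s IH] /=; first by rewrite /cross big_nil !mul1r.
by rewrite IH big_cat cross_consl /=; ring.
Qed.

Lemma selfb_perm s t : perm_eq s t -> selfb s = selfb t.
Proof.
elim: s t => [|x s IH] t; first by move/perm_size/esym/size0nil => ->.
move=> st; have xt : x \in t by rewrite -(perm_mem st) mem_head.
case/splitPr: xt st => t1 t2 st.
have st' : perm_eq s (t1 ++ t2).
  rewrite -(perm_cons x) (permPl st); apply/permPl.
  exact: (perm_catCA t1 [:: x] t2).
rewrite /= (IH _ st') (perm_big _ st')/= !selfb_cat /= big_cat/=.
rewrite -cat1s cross_catr (cross_sym t1 [:: x]) cross_consl /cross big_nil.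
by ring.
Qed.

Lemma condbs_cat s t g : condbs (s ++ t) g = (condbs s g * condbs t g)%R.
Proof. by rewrite /condbs big_cat. Qed.

Lemma condbs_perm s t g : perm_eq s t -> condbs s g = condbs t g.
Proof. by move=> st; rewrite /condbs (perm_big _ st). Qed.

Lemma esum_setU g g' (f : T -> \bar R) : (forall x, 0 <= f x) -> g `&` g' = set0 ->
  \esum_(x in g `|` g') f x = \esum_(x in g) f x + \esum_(x in g') f x.
Proof.
move=> f0 gg'; rewrite (esumID g)//; congr (_ + _).
  by rewrite setUK.
congr (\esum_(i in _) _); apply/seteqP; split=> x /=; first by move=> [[]].
by move=> g'x; split; [right|move=> gx; rewrite -[False]/(set0 x) -gg'].
Qed.

Lemma condb_setU x g g' : g `&` g' = set0 ->
  condb x (g `|` g') = (condb x g * condb x g')%R.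
Proof. by move=> gg'; rewrite /condb !esum_setU// bexpD//; exact: esum_ge0. Qed.

Lemma condbs_setU s g g' : g `&` g' = set0 ->
  condbs s (g `|` g') = (condbs s g * condbs s g')%R.
Proof.
move=> gg'; rewrite /condbs -big_split/=; apply: eq_bigr => x _.
exact: condb_setU.
Qed.

Lemma condb_seq x s : uniq s -> condb x [set` s] = (\prod_(y <- s) pairb x y)%R.
Proof. by move=> us; rewrite /condb !esum_seq// bexp_sum. Qed.

Lemma condbs_seq s t : uniq t -> condbs s [set` t] = cross s t.
Proof. by move=> ut; rewrite /condbs; apply: eq_bigr => x _; exact: condb_seq. Qed.

(** The positive parts may increase to infinity, where [nexp] is continuous. The negative parts need
    a finite limit: otherwise the truncated factors may blow up, against the conventional value 0 at
    the limit. *)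
Lemma cvg_condb x (g : set T) (A : nat -> set T) :
  (forall n m, (n <= m)%N -> A n `<=` A m) -> (forall x, exists n, A n x) ->
  \esum_(y in g) (Phi x)^\- y < +oo ->
  condb x (g `&` A n) @[n --> \oo] --> condb x g.
Proof.
move=> ndA AT Noo.
have cvgE (f : T -> \bar R) : (forall y, 0 <= f y) ->
    \esum_(y in g `&` A n) f y @[n --> \oo] --> \esum_(y in g) f y.
  move=> f0; under eq_fun do rewrite esum_mkcondr.
  apply: cvg_esum => [n y|y n m nm|y].
  - by case: ifP.
  - case: ifPn => [|_]; last by case: ifP.
    by rewrite !inE => /(ndA _ _ nm) Am; rewrite ifT// inE.
  - have [n Any] := AT y; apply: cvg_near_cst; exists n => // m /= nm.
    by rewrite ifT// inE; exact: ndA Any.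
have Nn n : \esum_(y in g `&` A n) (Phi x)^\- y <= \esum_(y in g) (Phi x)^\- y.
  by rewrite esum_mkcondr; apply: le_esum => y _; case: ifP.
rewrite /condb /bexp; apply: cvgM.
  apply: cvg_nexp => //; first by move=> k; exact: esum_ge0.
  exact: cvgE.
have Nfin g' : \esum_(y in g') (Phi x)^\- y <= \esum_(y in g) (Phi x)^\- y ->
    \esum_(y in g') (Phi x)^\- y \is a fin_num.
  by move=> Ng'; rewrite ge0_fin_numE ?esum_ge0//; exact: le_lt_trans Noo.
have pexpE g' : \esum_(y in g') (Phi x)^\- y <= \esum_(y in g) (Phi x)^\- y ->
   pexp beta (\esum_(y in g') (Phi x)^\- y) =
   expR (beta * fine (\esum_(y in g') (Phi x)^\- y)).
  by move=> /Nfin; rewrite /pexp; case: ifP => // /eqP ->.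
rewrite pexpE//; under eq_fun do rewrite pexpE//.
apply: continuous_cvg; first exact: continuous_expR.
apply: cvgMr; apply: fine_cvg; rewrite fineK ?Nfin//; exact: cvgE.
Qed.

Section measurability.
Hypothesis mPsi : measurable_fun setT Psi.
Hypothesis mPhi : measurable_fun setT (fun q : T * T => Phi q.1 q.2).

Lemma measurable_psi : measurable_fun setT psi.
Proof.
by apply: measurable_bexp; [exact: measurable_funepos|exact: measurable_funeneg].
Qed.

Lemma measurable_Phi_pos : measurable_fun setT (fun q : T * T => (Phi q.1)^\+ q.2).
Proof.
rewrite (_ : (fun _ => _) = (fun q : T * T => Phi q.1 q.2)^\+).
  exact: measurable_funepos.
by apply/funext => q; rewrite !funeposE.
Qed.

Lemma measurable_Phi_neg : measurable_fun setT (fun q : T * T => (Phi q.1)^\- q.2).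
Proof.
rewrite (_ : (fun _ => _) = (fun q : T * T => Phi q.1 q.2)^\-).
  exact: measurable_funeneg.
by apply/funext => q; rewrite !funenegE.
Qed.

Lemma measurable_pairb : measurable_fun setT (fun q : T * T => pairb q.1 q.2).
Proof.
by apply: measurable_bexp; [exact: measurable_Phi_pos|exact: measurable_Phi_neg].
Qed.

Lemma mseq_prod dX (X : measurableType dX) (f : X * T -> R) :
  measurable_fun setT f -> mseq (fun p s => \prod_(x <- s) f (p, x))%R.
Proof.
move=> mf n; elim: n => [|n IH].
  by apply/mseqn0; under eq_fun do rewrite big_nil; exact: measurable_cst.
apply/mseqnS; rewrite /mseqn/=; under eq_fun do rewrite big_cons.
apply: measurable_funM.
  rewrite (_ : (fun _ => _) = f \o fst); first exact: measurableT_comp.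
  by apply/funext => -[[]].
have := @mseqn_comp _ _ _ _ _ _ _ _ _ _ (@fst X T) measurable_fst IH.
exact.
Qed.

Lemma mseq_selfb dX (X : measurableType dX) : mseq (fun (_ : X) s => selfb s).
Proof.
move=> n; elim: n => [|n IH]; first by apply/mseqn0; exact: measurable_cst.
apply/mseqnS; rewrite /mseqn/=; apply: measurable_funM.
  apply: (@mseq_prod _ _ (fun q : X * T * T => pairb q.1.2 q.2)).
  have mc : measurable_fun setT (fun q : X * T * T => (q.1.2, q.2)).
    apply: measurable_fun_pair => //.
    exact: (measurableT_comp measurable_snd measurable_fst).
  exact: (measurableT_comp measurable_pairb mc).
exact: (mseqn_comp (F := fun (_ : X) s => selfb s) measurable_fst IH).
Qed.

Variable A : nat -> set T.
Hypothesis mA : forall n, measurable (A n).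
Hypothesis ndA : forall n m, (n <= m)%N -> A n `<=` A m.
Hypothesis AT : forall x, exists n, A n x.

Lemma measurable_condb dY (Y : measurableType dY) (x : Y -> T) (L : set T)
    (phi : Y -> config T) : measurable L ->
  measurable_fun setT x -> measurable_fun setT phi ->
  measurable_fun setT (fun y => condb (x y) (star A (phi y) `&` L)).
Proof.
move=> mL mx mphi.
have mE (f : T * T -> \bar R) : measurable_fun setT f -> (forall q, 0 <= f q) ->
    measurable_fun setT (fun y => \esum_(z in star A (phi y) `&` L) f (x y, z)).
  move=> mf f0; under eq_fun do rewrite esum_mkcondr.
  apply: (@measurable_esum_star _ _ _ _ mA ndA AT _ _ _ mphi
    (fun q => if q.2 \in L then f (x q.1, q.2) else 0)); last by move=> q; case: ifP.
  apply: measurable_fun_ifT; last exact: measurable_cst.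
    rewrite (_ : (fun _ => _) = (mem L) \o snd)//.
    apply: (measurableT_comp _ measurable_snd).
    by apply: (measurable_fun_bool true); rewrite setTI (_ : _ @^-1` _ = L)//;
      apply/seteqP; split=> z /=; [move/set_mem|move/mem_set].
  have mc : measurable_fun setT (fun q : Y * T => (x q.1, q.2)).
    apply: measurable_fun_pair => //.
    exact: (measurableT_comp mx measurable_fst).
  exact: (measurableT_comp mf mc).
apply: measurable_bexp.
  exact: (mE (fun q => (Phi q.1)^\+ q.2) measurable_Phi_pos).
exact: (mE (fun q => (Phi q.1)^\- q.2) measurable_Phi_neg).
Qed.

Lemma mseq_condbs dY (Y : measurableType dY) (L : set T)
    (phi : Y -> config T) : measurable L -> measurable_fun setT phi ->
  mseq (fun y s => condbs s (star A (phi y) `&` L)).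
Proof.
move=> mL mphi; apply: (@mseq_prod _ _ (fun q => condb q.2 (star A (phi q.1) `&` L))).
apply: (@measurable_condb _ _ snd L (phi \o fst)) => //.
exact: measurableT_comp.
Qed.

End measurability.
End interaction.

Section sequence_tools.
Context d (T : measurableType d) (R : realType).

Lemma mseq_cat k dX (X : measurableType dX) dY (Y : measurableType dY)
    (F : X -> seq T -> Y) :
  mseq F -> mseq (fun (q : X * k.-tuple T) r => F q.1 (q.2 ++ r)).
Proof.
move=> mF m; pose c (q : X * k.-tuple T * m.-tuple T) : X * (k + m).-tuple T :=
  (q.1.1, cat_tuple q.1.2 q.2).
have mc : measurable_fun setT c.
  apply: measurable_fun_pair.
    exact: (measurableT_comp measurable_fst measurable_fst).
  apply/measurable_fun_tnthP => i.
  have [ik|ki] := ltnP i k.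
    rewrite (_ : _ \o _ = (fun q : X * k.-tuple T * m.-tuple T => tnth q.1.2 (Ordinal ik))).
      apply: (measurableT_comp (measurable_tnth _)).
      exact: (measurableT_comp measurable_snd measurable_fst).
    apply/funext => q /=; rewrite !(tnth_nth (thead [tuple of nseq 1 point]))/=.
    by rewrite nth_cat size_tuple ik.
  have imk : (i - k < m)%N by rewrite ltn_subLR.
  rewrite (_ : _ \o _ = (fun q : X * k.-tuple T * m.-tuple T => tnth q.2 (Ordinal imk))).
    exact: (measurableT_comp (measurable_tnth _) measurable_snd).
  apply/funext => q /=; rewrite !(tnth_nth point)/=.
  by rewrite nth_cat size_tuple ltnNge ki.
exact: (measurableT_comp (mF (k + m)%N) mc).
Qed.

Lemma ssum_weight (T' : eqType) k (c : seq T' -> \bar R) h s :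
  (forall s t, perm_eq s t -> c s = c t) -> (forall s, 0 <= c s) ->
  (forall y, 0 <= h y) ->
  c s * ssum k (fun y _ => h y) s = ssum k (fun y r => c (y ++ r) * h y) s.
Proof.
move=> cperm c0 h0; rewrite -ssumZ//.
by apply: eq_ssum => y r _ yrs; rewrite (cperm _ _ yrs).
Qed.

End sequence_tools.

Section distinct_positions.
Context d (T : measurableType d) (R : realType).
Variable mu : {sigma_finite_measure set T -> \bar R}.
Context (D : eqType) (pos : T -> D).
Hypothesis mu_pos : forall x, {ae mu, forall y, pos y != pos x}.

(** Each new point almost surely avoids the finitely many positions of [y]. *)
Lemma aeseq_avoid n (y : seq T) :
  aeseq mu n (fun s => upos pos (y ++ s) = upos pos y && upos pos s).
Proof.
have : {ae mu, forall z, all (fun x => pos z != pos x) y}.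
  elim: y => [|x y IH]; first exact: aeW.
  by apply: filterS2 (mu_pos x) IH => z /= -> ->.
move=> /(aeseq_all n); apply: aeseq_impl => s _ sy.
rewrite /upos map_cat cat_uniq; congr andb; rewrite andbC -[RHS]andbT; congr andb.
apply/hasPn => p /mapP[z zs ->]; apply/negP => /mapP[x xy pzx].
by have /allP/(_ x xy) := sy z zs; rewrite pzx eqxx.
Qed.

Lemma aeseq_upos n : aeseq mu n (fun s => upos pos s).
Proof.
elim: n => [|n IH] //=; apply: aeW => x.
have := aeseq_and (aeseq_avoid n [:: x]) IH.
by apply: aeseq_impl => s _ [-> ->].
Qed.

End distinct_positions.

(** * The multivariate Mecke equation of a Gibbs process *)

Section gnz.
Context d (T : measurableType d) (R : realType).
Variable lam : {sigma_finite_measure set T -> \bar R}.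
Context (D : eqType) (pos : T -> D).
Hypothesis mpos : measurable_fun setT (fun q : T * T => pos q.1 == pos q.2).
Hypothesis lam_pos : forall x, {ae lam, forall y, pos y != pos x}.
Variable A : nat -> set T.
Hypothesis mA : forall n, measurable (A n).
Hypothesis ndA : forall n m, (n <= m)%N -> A n `<=` A m.
Hypothesis AT : forall x, exists n, A n x.
Variables beta z : R.
Hypothesis beta0 : (0 < beta)%R.
Hypothesis z0 : (0 <= z)%R.
Variables (Psi : T -> \bar R) (Phi : T -> T -> \bar R).
Hypothesis mPsi : measurable_fun setT Psi.
Hypothesis mPhi : measurable_fun setT (fun q : T * T => Phi q.1 q.2).
Hypothesis Phi_sym : forall x y, Phi x y = Phi y x.

Let psi := psi beta Psi.
Let pairb := pairb beta Phi.
Let condb := condb beta Phi.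
Let condbs := condbs beta Phi.
Let cross := cross beta Phi.
Let selfb := selfb beta Phi.
Let star := star A.

(** The weight [e^{-beta H}] of the points listed in [s]. *)
Definition selfwt s : R := ((\prod_(x <- s) psi x) * selfb s)%R.

Definition inwin n s : bool := upos pos s && all (mem (A n)) s.

Definition outer n (xi : config T) : set T := star xi `&` ~` A n.

Definition splice n (xi : config T) s : config T :=
  superpose (restr (upos_config pos s) (A n)) (restr (star xi) (~` A n)).

(* the unnormalized Gibbs density in the window [A n], against a functional [F] *)
Definition specint n (F : config T -> \bar R) (xi : config T) s : \bar R :=
  if inwin n s then F (splice n xi s) * (selfwt s * condbs s (outer n xi))%:E
  else 0.

Variable P : probability (config T) R.

(** The Gibbs equation in the windows [A n], written on sequences. The factor [zeta] stands for the
    inverse partition function times the Poisson normalisation; it is left abstract because the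
    derivation below inserts it and reabsorbs it. *)
Definition dlr := forall n, exists zeta : config T -> \bar R,
  [/\ measurable_fun setT zeta, (forall xi, 0 <= zeta xi) &
   forall F, measurable_fun setT F -> (forall xi, 0 <= F xi) ->
   \int[P]_xi F xi =
   \int[P]_xi (zeta xi * poisson_sum lam z (specint n F xi))].

Lemma selfwt_ge0 s : (0 <= selfwt s)%R.
Proof. by rewrite mulr_ge0 ?selfb_ge0 ?prodr_ge0// => x _; exact: psi_ge0. Qed.

Lemma specint_ge0 n F xi s : (forall xi, 0 <= F xi) -> 0 <= specint n F xi s.
Proof.
move=> F0; rewrite /specint; case: ifP => // _.
by rewrite mule_ge0// lee_fin mulr_ge0 ?selfwt_ge0 ?condbs_ge0.
Qed.

Lemma mseq_inwin n dX (X : measurableType dX) : mseq (fun (_ : X) s => inwin n s).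
Proof.
move=> m; apply: measurable_and; first exact: mseq_upos.
apply: (@mseq_all _ _ _ _ (fun q : X * T => q.2 \in A n)).
apply: (measurableT_comp (f := mem (A n)) _ measurable_snd).
apply: (measurable_fun_bool true); rewrite setTI (_ : _ @^-1` _ = A n)//.
by apply/seteqP; split=> x /=; [move/set_mem|move/mem_set].
Qed.

Lemma mseq_selfwt dX (X : measurableType dX) : mseq (fun (_ : X) s => selfwt s).
Proof.
move=> m; apply: measurable_funM.
  apply: (@mseq_prod _ _ _ _ _ (fun q : X * T => psi q.2)).
  exact: (measurableT_comp (measurable_psi beta mPsi) measurable_snd).
exact: mseq_selfb.
Qed.

Lemma measurable_star dX (X : measurableType dX) (phi : X -> config T) :
  measurable_fun setT phi -> measurable_fun setT (fun x => star (phi x)).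
Proof. exact: (measurable_star_fun R mA ndA AT). Qed.

Lemma mseq_splice n : mseq (splice n).
Proof.
move=> m; apply: (@measurable_splice _ _ R (A n) _ _
  (fun q : config T * m.-tuple T => upos_config pos q.2) (fun q => star q.1)) => //.
  exact: (mseq_upos_config R mpos).
exact: (measurable_star measurable_fst).
Qed.

Lemma mseq_outer n : mseq (fun xi s => condbs s (outer n xi)).
Proof.
apply: (mseq_condbs beta mPhi mA ndA AT (phi := id)); last exact: measurable_id.
exact: measurableC.
Qed.

Lemma mseq_specint n F : measurable_fun setT F -> mseq (specint n F).
Proof.
move=> mF m; apply: measurable_fun_ifT; [exact: mseq_inwin| |exact: measurable_cst].
apply: emeasurable_funM; first exact: (measurableT_comp mF (@mseq_splice n m)).
apply/measurable_EFinP; apply: measurable_funM; first exact: mseq_selfwt.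
exact: mseq_outer.
Qed.

Lemma spliceE n xi s : inwin n s ->
  (splice n xi s : set T) = [set` s] `|` outer n xi.
Proof.
move=> /andP[us /allP sA]; rewrite /splice /= /upos_config us; congr setU.
apply/seteqP; split=> x /=; first by case.
by move=> xs; split=> //; have /= := sA _ xs; rewrite inE.
Qed.

Lemma seq_outer0 n xi s : inwin n s -> [set` s] `&` outer n xi = set0.
Proof.
move=> /andP[_ /allP sA]; apply/seteqP; split=> x //= [xs [_ nAx]]; apply: nAx.
by have /= := sA _ xs; rewrite inE.
Qed.

Lemma star_splice n xi s : star (splice n xi s) = splice n xi s.
Proof.
apply: star_lf => m; rewrite /splice/=; apply: (@sub_finite_set _ _
  ([set` if upos pos s then s else [::]] `|` (star xi `&` A m))).
  by move=> x [[[]|[? _]] Ax]; [left|right].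
by rewrite finite_setU; split; [exact: finite_seq|exact: lf_star].
Qed.

Lemma condbs_splice v n xi s : inwin n s ->
  condbs v (star (splice n xi s)) = (cross v s * condbs v (outer n xi))%R.
Proof.
move=> ws; rewrite star_splice spliceE// /condbs condbs_setU ?seq_outer0//.
by rewrite condbs_seq//; have /andP[/upos_uniq] := ws.
Qed.

(** A function that vanishes as soon as one point lies outside the window sees only the resampled
    points [s], and these can be selected without repetition. *)
Lemma gsum_splice k n xi s (h : seq T -> \bar R) : inwin n s ->
  (forall y, 0 <= h y) -> (forall y, ~~ all (mem (A n)) y -> h y = 0) ->
  gsum k (if_upos pos h) (star (splice n xi s)) = ssum k (fun y _ => h y) s.
Proof.
move=> ws h0 hA; have /andP[us sA] := ws.
have -> : if_upos pos h = (fun y => if all (mem (A n)) y then if_upos pos h y else 0).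
  apply/funext => y; case: ifPn => // /hA hy; rewrite /if_upos hy; by case: ifP.
rewrite gsum_all; last exact: if_upos_ge0.
have -> : star (splice n xi s) `&` [set x | mem (A n) x] = [set` s].
  rewrite star_splice spliceE//; apply/seteqP; split=> x /=.
    by move=> [[//|[_ nAx]]]; rewrite inE.
  by move=> xs; split; [left|exact: (allP sA)].
rewrite gsum_seq ?tsum_upos_ssum//; first exact: upos_uniq us.
exact: if_upos_ge0.
Qed.

Definition cond_mean s : \bar R := \int[P]_xi (condbs s (star xi))%:E.

Lemma cond_mean_ge0 s : 0 <= cond_mean s.
Proof. by apply: integral_ge0 => xi _; rewrite lee_fin condbs_ge0. Qed.

Lemma mseq_condbs_star dX (X : measurableType dX) (phi : X -> config T) :
  measurable_fun setT phi -> mseq (fun x s => condbs s (star (phi x))).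
Proof.
move=> mphi; have := mseq_condbs beta mPhi mA ndA AT measurableT mphi.
by under [X in mseq X -> _]eq_fun do under eq_fun do rewrite setIT.
Qed.

Lemma measurable_condbs_star s dX (X : measurableType dX) (phi : X -> config T) :
  measurable_fun setT phi -> measurable_fun setT (fun x => condbs s (star (phi x))).
Proof.
move=> mphi; have := mseq_condbs_star mphi => /(_ (size s)) ms.
apply: (measurableT_comp ms (g := fun x => (x, in_tuple s))).
exact: measurable_fun_pair.
Qed.

Lemma mseq_cond_mean x' : mseq (fun _ : unit => fun y => cond_mean (x' ++ y)).
Proof.
move=> m.
have mf : measurable_fun setT (fun q : m.-tuple T * config T =>
    (condbs (x' ++ q.1) (star q.2))%:E).
  apply/measurable_EFinP; under eq_fun do rewrite /condbs condbs_cat.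
  apply: measurable_funM.
    exact: (@measurable_condbs_star x' _ _ snd).
  have mc : measurable_fun setT (fun q : m.-tuple T * config T => (q.2, q.1)).
    exact: measurable_fun_pair.
  exact: (measurableT_comp (@mseq_condbs_star _ _ id (@measurable_id _ _ setT) m) mc).
have := @measurable_fun_fubini_tonelli_F _ _ _ _ _ P _ mf.
move=> /(_ (fun q => _)) mF.
apply: (measurableT_comp (mF _) measurable_snd) => q.
by rewrite lee_fin condbs_ge0.
Qed.

Lemma specint_cond n xi s v :
  specint n (fun xi => (condbs v (star xi))%:E) xi s =
  if inwin n s then
    ((cross v s * condbs v (outer n xi)) * (selfwt s * condbs s (outer n xi)))%:E
  else 0.
Proof.
by rewrite /specint; case: ifPn => // ws; rewrite condbs_splice// -EFinM.
Qed.

Lemma mseq_specint_cond n x' k : mseq (fun (q : config T * k.-tuple T) =>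
  specint n (fun xi => (condbs (x' ++ q.2) (star xi))%:E) q.1).
Proof.
move=> m; apply: measurable_fun_ifT; [exact: mseq_inwin| |exact: measurable_cst].
have m1 : measurable_fun setT (fun q : config T * k.-tuple T * m.-tuple T =>
    (q.1.1, q.2)).
  apply: measurable_fun_pair => //.
  exact: (measurableT_comp measurable_fst measurable_fst).
have ms := measurableT_comp (@mseq_splice n m) m1.
apply: emeasurable_funM; apply/measurable_EFinP; last first.
  apply: measurable_funM; first exact: mseq_selfwt.
  exact: (measurableT_comp (@mseq_outer n m) m1).
under eq_fun do rewrite /condbs condbs_cat; apply: measurable_funM.
  exact: (@measurable_condbs_star x' _ _ _ ms).
have mc : measurable_fun setT (fun q : config T * k.-tuple T * m.-tuple T => (q, q.1.2)).
  apply: measurable_fun_pair; first exact: measurable_id.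
  exact: (measurableT_comp measurable_snd measurable_fst).
exact: (measurableT_comp (@mseq_condbs_star _ _ _ ms k) mc).
Qed.

Definition gnz_weight (h : seq T -> R) x' y : R :=
  (h y * (selfwt y * cross x' y))%R.

Lemma mseq_cross x' dX (X : measurableType dX) : mseq (fun (_ : X) y => cross x' y).
Proof.
move=> n; rewrite /mseqn.
under eq_fun do rewrite /cross (cross_sym beta Phi_sym).
apply: (@mseq_prod _ _ _ _ _ (fun q : X * T => (\prod_(w <- x') pairb q.2 w)%R)).
elim: x' => [|x x' IH].
  by under eq_fun do rewrite big_nil; exact: measurable_cst.
under eq_fun do rewrite big_cons; apply: measurable_funM => //.
have mc : measurable_fun setT (fun q : X * T => (q.2, x)) by exact: measurable_fun_pair.
exact: (measurableT_comp (measurable_pairb beta mPhi) mc).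
Qed.

Lemma poisson_sumZ (c : R) (F : seq T -> \bar R) : (0 <= c)%R ->
  mseq (fun _ : unit => F) -> (forall s, 0 <= F s) ->
  poisson_sum lam z (fun s => c%:E * F s) = c%:E * poisson_sum lam z F.
Proof.
move=> c0 mF F0; rewrite /poisson_sum -nneseriesZl; last first.
  by move=> n _; rewrite mule_ge0 ?iint_ge0// lee_fin divr_ge0// exprn_ge0.
apply: eq_eseriesr => n _.
by rewrite (iintZl _ tt (mF n))// muleCA.
Qed.

Lemma eq_poisson_sum (F G : seq T -> \bar R) : (forall s, 0 <= F s) ->
  (forall s, 0 <= G s) -> (forall n, aeseq lam n (fun s => F s = G s)) ->
  poisson_sum lam z F = poisson_sum lam z G.
Proof.
by move=> F0 G0 FG; apply: eq_eseriesr => n _; rewrite (eq_iint F0 G0 (FG n)).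
Qed.

Section gnz_window.
Variables (n k : nat) (x' : seq T) (h : seq T -> R).
Hypothesis mh : mseq (fun _ : unit => h).
Hypothesis h0 : forall y, (0 <= h y)%R.
Hypothesis hA : forall y, ~~ all (mem (A n)) y -> h y = 0%R.

Let F xi := gsum k (if_upos pos (fun y => (h y)%:E)) (star xi) *
  (condbs x' (star xi))%:E.

Let F0 xi : 0 <= F xi.
Proof.
rewrite /F mule_ge0 ?lee_fin ?condbs_ge0//; apply: gsum_ge0.
by apply: if_upos_ge0 => y; rewrite lee_fin.
Qed.

Let mF : measurable_fun setT F.
Proof.
apply: emeasurable_funM; last first.
  apply/measurable_EFinP.
  exact: (@measurable_condbs_star x' _ _ id (@measurable_id _ _ setT)).
apply: (@measurable_gsum _ _ R _ mA ndA AT k _ _ id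
  (fun _ => if_upos pos (fun y => (h y)%:E))) => //.
- apply: (mseq_if_upos mpos (h := fun (_ : config T) y => (h y)%:E)) => m.
  apply/measurable_EFinP.
  have mu : measurable_fun setT (fun _ : config T => tt) by exact: measurable_cst.
  have := mseqn_comp mu (@mh m); exact.
- by move=> _ y; apply: if_upos_ge0 => s; rewrite lee_fin.
Qed.

Let c xi s := specint n (fun xi => (condbs x' (star xi))%:E) xi s.

Let c0 xi s : 0 <= c xi s.
Proof. by apply: specint_ge0 => ?; rewrite lee_fin condbs_ge0. Qed.

Let c_perm xi s t : perm_eq s t -> c xi s = c xi t.
Proof.
move=> st; rewrite /c !specint_cond /inwin /upos.
rewrite (perm_uniq (perm_map pos st)) (perm_all _ st); case: ifP => // _.
rewrite /selfwt (perm_big _ st)/= /selfb (selfb_perm beta Phi_sym st).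
by rewrite /condbs (condbs_perm _ _ _ st) /cross (cross_permr _ _ _ st).
Qed.

(** The symmetric weight of the whole window is brought inside the sum over choices, the form to
    which the Mecke formula applies. *)
Let specintE xi s : specint n F xi s =
  ssum k (fun y r => c xi (y ++ r) * (h y)%:E) s.
Proof.
rewrite -ssum_weight//; last by exact: c_perm.
rewrite /c /specint; case: ifPn => ws; last by rewrite mul0e.
rewrite /F gsum_splice//; first by rewrite -[LHS]muleA [LHS]muleC.
by move=> y /hA ->.
Qed.

(** The weight of [y ++ r] in the presence of [x'] is the weight of [y] against [x'] times the
    weight of [r] in the presence of [x' ++ y]: the interactions of [y] with [r] and with the
    outside become conditional energies of [y]. Almost every [r] avoids the positions of [y]. *)
Let weight_split xi y : poisson_sum lam z (fun r => c xi (y ++ r) * (h y)%:E) =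
  (if upos pos y then gnz_weight h x' y else 0)%R%:E *
  poisson_sum lam z (specint n (fun xi => (condbs (x' ++ y) (star xi))%:E) xi).
Proof.
case: (boolP (all (mem (A n)) y)) => yA; last first.
  rewrite /gnz_weight (hA yA) mul0r if_same mul0e.
  rewrite /poisson_sum eseries0// => m _ _.
  rewrite [X in _ * X](_ : _ = 0) ?mule0//.
  have -> : (fun r => c xi (y ++ r) * 0%:E) = cst 0 by apply/funext => r; rewrite mule0.
  by elim: m => //= m ->; rewrite integral0.
rewrite -poisson_sumZ//; last 3 first.
- case: ifP => // _; rewrite /gnz_weight mulr_ge0// mulr_ge0 ?selfwt_ge0//.
  exact: cross_ge0.
- move=> m; have mt : measurable_fun setT (fun _ : unit => xi) by exact: measurable_cst.
  apply: (mseqn_comp mt); apply: mseq_specint; apply/measurable_EFinP.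
  exact: (@measurable_condbs_star _ _ _ id (@measurable_id _ _ setT)).
- by move=> s; apply: specint_ge0 => ?; rewrite lee_fin condbs_ge0.
have wpos : (0 <= (if upos pos y then gnz_weight h x' y else 0))%R.
  case: ifP => // _; rewrite /gnz_weight mulr_ge0// mulr_ge0 ?selfwt_ge0//.
  exact: cross_ge0.
apply: eq_poisson_sum.
- by move=> s; rewrite mule_ge0 ?lee_fin ?c0.
- move=> s; rewrite mule_ge0 ?lee_fin//; apply: specint_ge0 => ?.
  by rewrite lee_fin condbs_ge0.
move=> m; have := aeseq_avoid lam_pos m y; apply: aeseq_impl => r _ yr.
rewrite /c !specint_cond /inwin yr all_cat yA.
case: (boolP (upos pos y)) => uy /=; last by rewrite !mul0e.
case: ifP => _; last by rewrite mul0e mule0.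
rewrite -!EFinM; congr EFin; rewrite /gnz_weight /selfwt /condbs /cross /selfb.
rewrite !condbs_cat !(cross_catr beta Phi_sym) !(cross_catl beta) selfb_cat big_cat/=.
by ring.
Qed.

Let iint_shape xi : poisson_sum lam z (specint n F xi) =
  (z ^+ k)%:E * iint lam k (fun y => (if upos pos y then gnz_weight h x' y else 0)%R%:E *
    poisson_sum lam z (specint n (fun xi => (condbs (x' ++ y) (star xi))%:E) xi)).
Proof.
have -> : specint n F xi = ssum k (fun y r => c xi (y ++ r) * (h y)%:E).
  by apply/funext => s; exact: specintE.
rewrite (@poisson_sum_ssum _ _ _ lam z k _ _ (fun xi y r => c xi (y ++ r) * (h y)%:E))//.
- by congr (_ * _); apply: eq_iintW => y _; exact: weight_split.
- move=> m; apply: emeasurable_funM.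
    apply: (@mseq_cat _ _ k _ _ _ _ c _ m); apply: mseq_specint; apply/measurable_EFinP.
    exact: (@measurable_condbs_star _ _ _ id (@measurable_id _ _ setT)).
  apply/measurable_EFinP.
  have mt : measurable_fun setT (fun q : config T * k.-tuple T * m.-tuple T => (tt, q.1.2)).
    apply: measurable_fun_pair => //.
    exact: (measurableT_comp measurable_snd measurable_fst).
  exact: (measurableT_comp (@mh k) mt).
- by move=> p y s; rewrite mule_ge0// ?lee_fin//; exact: c0.
Qed.

Hypothesis Pdlr : dlr.

Let K y : \bar R := (if upos pos y then gnz_weight h x' y else 0)%R%:E.

Let K0 y : 0 <= K y.
Proof.
rewrite lee_fin; case: ifP => // _; rewrite /gnz_weight mulr_ge0// mulr_ge0 ?selfwt_ge0//.
exact: cross_ge0.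
Qed.

Let mK dX (X : measurableType dX) : mseq (fun _ : X => K).
Proof.
move=> m; apply/measurable_EFinP; apply: measurable_fun_ifT.
- exact: mseq_upos.
- apply: measurable_funM.
    have mu : measurable_fun setT (fun _ : X => tt) by exact: measurable_cst.
    have := mseqn_comp mu (@mh m); exact.
  by apply: measurable_funM; [exact: mseq_selfwt|exact: mseq_cross].
- exact: measurable_cst.
Qed.

Let PS xi y :=
  poisson_sum lam z (specint n (fun xi => (condbs (x' ++ y) (star xi))%:E) xi).

Let PS0 xi y : 0 <= PS xi y.
Proof.
apply: poisson_sum_ge0 => // s; apply: specint_ge0 => ?.
by rewrite lee_fin condbs_ge0.
Qed.

Let mPS : mseqn k PS.
Proof.
apply: (@measurable_poisson_sum _ _ _ lam z _ _ (fun q : config T * k.-tuple T =>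
  specint n (fun xi => (condbs (x' ++ q.2) (star xi))%:E) q.1)) => //.
  exact: mseq_specint_cond.
by move=> q s; apply: specint_ge0 => ?; rewrite lee_fin condbs_ge0.
Qed.

(** The window equation is used twice: forwards for [F], and, after the Mecke formula of the Poisson
    process has extracted [y], backwards for the Boltzmann factor of [x' ++ y]. In between, [zeta]
    is a constant factor for each outer configuration. *)
Lemma gnz_supported : \int[P]_xi F xi =
  (z ^+ k)%:E * iint lam k (fun y => K y * cond_mean (x' ++ y)).
Proof.
have [zeta [mzeta zeta0 zetaE]] := Pdlr n; rewrite zetaE//.
have mKPS : mseqn k (fun xi y => K y * PS xi y).
  by apply: emeasurable_funM; [exact: mK|exact: mPS].
have KPS0 xi y : 0 <= K y * PS xi y by rewrite mule_ge0.
have mZ : mseqn k (fun xi y => zeta xi * (K y * PS xi y)).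
  by apply: emeasurable_funM => //; exact: (measurableT_comp mzeta measurable_fst).
have Z0 xi y : 0 <= zeta xi * (K y * PS xi y) by rewrite mule_ge0.
transitivity (\int[P]_xi ((z ^+ k)%:E *
    iint lam k (fun y => zeta xi * (K y * PS xi y)))).
  apply: eq_integral => xi _; rewrite iint_shape muleCA; congr (_ * _).
  by rewrite (iintZl lam xi mKPS).
rewrite ge0_integralZl//; last 3 first.
- exact: (measurable_iint lam mZ).
- by move=> xi _; exact: iint_ge0.
- by rewrite lee_fin exprn_ge0.
congr (_ * _).
rewrite (@integral_iint _ _ _ lam k _ unit _ _ P
   (fun q y => zeta q.2 * (K y * PS q.2 y)) tt); last 2 first.
- exact: (mseqn_comp (@measurable_snd _ _ unit (config T)) mZ).
- by move=> q s; exact: Z0.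
apply: eq_iintW => y yk /=.
have mC : measurable_fun setT (fun xi : config T => (condbs (x' ++ y) (star xi))%:E).
  apply/measurable_EFinP.
  exact: (@measurable_condbs_star _ _ _ id (@measurable_id _ _ setT)).
have C0 xi : 0 <= (condbs (x' ++ y) (star xi))%:E by rewrite lee_fin condbs_ge0.
under eq_integral do rewrite muleCA.
rewrite ge0_integralZl//; last 2 first.
- apply: emeasurable_funM => //; apply: measurable_poisson_sum => //.
    exact: mseq_specint.
  by move=> *; exact: specint_ge0.
- by move=> xi _; rewrite mule_ge0.
by congr (_ * _); rewrite /cond_mean zetaE.
Qed.

End gnz_window.

(** Both sides are monotone limits of the identity for [h] cut off to [A n]. The restriction to
    distinct positions disappears on the right because coincidences are negligible for [lam]. *)
Lemma gnz_lam k x' (h : seq T -> R) : dlr ->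
  mseq (fun _ : unit => h) -> (forall y, 0 <= h y)%R ->
  \int[P]_xi (gsum k (if_upos pos (fun y => (h y)%:E)) (star xi) *
    (condbs x' (star xi))%:E) =
  (z ^+ k)%:E * iint lam k (fun y => (gnz_weight h x' y)%:E * cond_mean (x' ++ y)).
Proof.
move=> Pdlr mh h0.
pose hn n y := if all (mem (A n)) y then h y else 0%R.
have hn0 n y : (0 <= hn n y)%R by rewrite /hn; case: ifP.
have hnd y : {homo hn ^~ y : n m / (n <= m)%N >-> (n <= m)%R}.
  move=> n m nm; rewrite /hn; case: ifPn => [nA|_]; last by case: ifP.
  rewrite ifT//; apply/allP => x xy; rewrite inE; apply: (ndA nm).
  by have /= := allP nA x xy; rewrite inE.
have hncst y : exists N, forall n, (N <= n)%N -> hn n y = h y.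
  have [N NA] : exists N, forall n, (N <= n)%N -> all (mem (A n)) y.
    elim: y => [|x y [N IH]]; first by exists 0%N.
    have [M AM] := AT x; exists (maxn N M) => n; rewrite geq_max => /andP[Nn Mn] /=.
    by rewrite IH// andbT inE; exact: ndA AM.
  by exists N => n Nn; rewrite /hn NA.
have mhn n : mseq (fun _ : unit => hn n).
  move=> m; apply: measurable_fun_ifT; [|exact: mh|exact: measurable_cst].
  apply: (@mseq_all _ _ _ _ (fun q : unit * T => q.2 \in A n)).
  apply: (measurableT_comp (f := mem (A n)) _ measurable_snd).
  apply: (measurable_fun_bool true); rewrite setTI (_ : _ @^-1` _ = A n)//.
  by apply/seteqP; split=> x /=; [move/set_mem|move/mem_set].
have hnA n y : ~~ all (mem (A n)) y -> hn n y = 0%R by rewrite /hn => /negbTE ->.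
have gE n := @gnz_supported n k x' (hn n) (mhn n) (hn0 n) (hnA n) Pdlr.
pose u n xi := if_upos pos (fun y => (hn n y)%:E) xi.
have u0 n y : 0 <= u n y by apply: if_upos_ge0 => s; rewrite lee_fin.
have und y : {homo u ^~ y : n m / (n <= m)%N >-> n <= m}.
  by move=> n m nm; rewrite /u /if_upos; case: ifP => // _; rewrite lee_fin hnd.
have cvgL : \int[P]_xi (gsum k (u n) (star xi) * (condbs x' (star xi))%:E)
    @[n --> \oo] --> \int[P]_xi (gsum k (if_upos pos (fun y => (h y)%:E)) (star xi) *
    (condbs x' (star xi))%:E).
  apply: ge0_cvg_integral.
  - move=> n; apply: emeasurable_funM; last first.
      apply/measurable_EFinP.
      exact: (@measurable_condbs_star x' _ _ id (@measurable_id _ _ setT)).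
    apply: (@measurable_gsum _ _ R _ mA ndA AT k _ _ id (fun _ => u n)) => //.
    apply: (mseq_if_upos mpos (h := fun (_ : config T) y => (hn n y)%:E)) => m.
    apply/measurable_EFinP.
    have mu : measurable_fun setT (fun _ : config T => tt) by exact: measurable_cst.
    have := mseqn_comp mu (mhn n m); exact.
  - by move=> n xi; rewrite mule_ge0 ?lee_fin ?condbs_ge0//; exact: gsum_ge0.
  - move=> xi n m nm; apply: lee_pmul => //; first exact: gsum_ge0.
      by rewrite lee_fin condbs_ge0.
    by apply: le_gsum => s; exact: und.
  - move=> xi; under eq_fun do rewrite muleC; rewrite muleC.
    apply: cvgeZl => //; apply: cvg_gsum => // s.
    have [N NE] := hncst s; apply: cvg_near_cst; exists N => // n /= Nn.
    by rewrite /u /if_upos NE.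
have cvgR : (z ^+ k)%:E * iint lam k (fun y =>
     (if upos pos y then gnz_weight (hn n) x' y else 0)%R%:E * cond_mean (x' ++ y))
    @[n --> \oo] --> (z ^+ k)%:E * iint lam k (fun y =>
     (if upos pos y then gnz_weight h x' y else 0)%R%:E * cond_mean (x' ++ y)).
  apply: cvgeZl => //.
  have w0 y : (0 <= selfwt y * cross x' y)%R.
    by rewrite mulr_ge0 ?selfwt_ge0//; exact: cross_ge0.
  apply: (@cvg_iint _ _ _ lam k _ unit (fun n _ y =>
     (if upos pos y then gnz_weight (hn n) x' y else 0)%R%:E * cond_mean (x' ++ y))
     (fun _ y => (if upos pos y then gnz_weight h x' y else 0)%R%:E * cond_mean (x' ++ y))
     tt).
  - move=> n; apply: emeasurable_funM; last exact: mseq_cond_mean.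
    apply/measurable_EFinP; apply: measurable_fun_ifT.
    + exact: mseq_upos.
    + apply: measurable_funM; first exact: mhn.
      by apply: measurable_funM; [exact: mseq_selfwt|exact: mseq_cross].
    + exact: measurable_cst.
  - move=> n _ y; rewrite mule_ge0 ?cond_mean_ge0// lee_fin.
    by case: ifP => // _; rewrite mulr_ge0.
  - move=> _ y n m nm; apply: lee_wpmul2r; first exact: cond_mean_ge0.
    by rewrite lee_fin; case: ifP => // _; rewrite ler_wpM2r// hnd.
  - move=> _ y; have [N NE] := hncst y; apply: cvg_near_cst; exists N => // n /= Nn.
    by rewrite /gnz_weight NE.
have <- : (z ^+ k)%:E * iint lam k (fun y =>
     (if upos pos y then gnz_weight h x' y else 0)%R%:E * cond_mean (x' ++ y)) =
   (z ^+ k)%:E * iint lam k (fun y => (gnz_weight h x' y)%:E * cond_mean (x' ++ y)).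
  have w0 y : (0 <= gnz_weight h x' y)%R.
    by rewrite /gnz_weight mulr_ge0// mulr_ge0 ?selfwt_ge0//; exact: cross_ge0.
  congr (_ * _); apply: eq_iint.
  - by move=> y; rewrite mule_ge0 ?cond_mean_ge0// lee_fin; case: ifP.
  - by move=> y; rewrite mule_ge0 ?cond_mean_ge0// lee_fin.
  - by have := aeseq_upos lam_pos k; apply: aeseq_impl => y _ ->.
rewrite -(cvg_lim _ cvgL)// -(cvg_lim _ cvgR)//.
by congr (limn _); apply/funext => n; exact: gE.
Qed.

End gnz.

Section density.
Context d (T : measurableType d) (R : realType).
Variables mu lam : {sigma_finite_measure set T -> \bar R}.
Variable c : T -> R.
Hypothesis mc : measurable_fun setT c.
Hypothesis c0 : forall x, (0 <= c x)%R.
Hypothesis mu_density : forall f : T -> \bar R, measurable_fun setT f ->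
  (forall x, 0 <= f x) -> \int[mu]_x f x = \int[lam]_x ((c x)%:E * f x).

Lemma iint_density k dX (X : measurableType dX) (F : X -> seq T -> \bar R) p :
  mseqn k F -> (forall x s, 0 <= F x s) ->
  iint mu k (F p) = iint lam k (fun y => (\prod_(x <- y) c x)%R%:E * F p y).
Proof.
elim: k dX X F p => [|k IH] dX X F p mF F0; first by rewrite /= big_nil mul1e.
have mP : mseqn k (fun (q : X * T) y => (\prod_(x <- y) c x)%R%:E * F q.1 (q.2 :: y)).
  apply: emeasurable_funM; last exact/mseqnS.
  apply/measurable_EFinP; apply: (@mseq_prod _ _ _ _ _ (fun q : X * T * T => c q.2)).
  exact: (measurableT_comp mc measurable_snd).
rewrite [LHS]/= mu_density; last 2 first.
- exact: measurable_iint_cons.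
- by move=> x; exact: iint_ge0.
apply: eq_integral => x _.
have pc0 y : (0 <= \prod_(x <- y) c x)%R by exact: prodr_ge0.
rewrite (IH _ _ (fun (q : X * T) s => F q.1 (q.2 :: s)) (p, x)); last 2 first.
- exact/mseqnS.
- by move=> *; exact: F0.
rewrite -(iintZl lam (p, x) mP) ?lee_fin//; last first.
  by move=> q y; rewrite mule_ge0 ?lee_fin.
by apply: eq_iintW => y _; rewrite /= big_cons EFinM muleA.
Qed.

End density.

Section factorial_sums.
Context d (T : measurableType d) (R : realType).

Lemma seq_indic_cons n (B : set (n.+1.-tuple T)) x y :
  seq_indic R B (x :: y) =
  seq_indic R [set t : n.-tuple T | B (cons_tuple x t)] y.
Proof.
have [yn|yn] := eqVneq (size y) n; last by rewrite /seq_indic !insubF//=; exact/negbTE.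
have sy : size y == n by exact/eqP.
have sxy : size (x :: y) == n.+1 by rewrite /= eqSS.
rewrite -[y in RHS]/(tval (Tuple sy)) -[x :: y]/(tval (Tuple sxy)) !seq_indicE.
congr EFin; rewrite !indicE; congr (_%:R); congr nat_of_bool.
have -> : Tuple sxy = cons_tuple x (Tuple sy) by exact: val_inj.
by apply/idP/idP; rewrite !inE.
Qed.

Lemma factorial_fsum n (g : set T) (B : set (n.-tuple T)) :
  factorial_measure R g B = fsum n (seq_indic R B) g.
Proof.
elim: n g B => [|n IH] g B /=.
  by rewrite -[[::]]/(tval [tuple]) seq_indicE diracE indicE.
apply: eq_esum => x _; rewrite IH; congr fsum.
by apply/funext => y; rewrite seq_indic_cons.
Qed.

Lemma fsum_ge0 k (h : seq T -> \bar R) g : (forall s, 0 <= h s) -> 0 <= fsum k h g.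
Proof. by elim: k h g => //= k IH h g h0; apply: esum_ge0 => x _; exact: IH. Qed.

End factorial_sums.

(** * Kirkwood-Salsburg equations *)

Section kirkwood_salsburg.
Context d (T : measurableType d) (R : realType).
Variables lam mu : {sigma_finite_measure set T -> \bar R}.
Context (D : eqType) (pos : T -> D).
Hypothesis mpos : measurable_fun setT (fun q : T * T => pos q.1 == pos q.2).
Hypothesis lam_pos : forall x, {ae lam, forall y, pos y != pos x}.
Variable A : nat -> set T.
Hypothesis mA : forall n, measurable (A n).
Hypothesis ndA : forall n m, (n <= m)%N -> A n `<=` A m.
Hypothesis AT : forall x, exists n, A n x.
Variables beta z : R.
Hypothesis beta0 : (0 < beta)%R.
Hypothesis z0 : (0 <= z)%R.
Variables (Psi : T -> \bar R) (Phi : T -> T -> \bar R).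
Hypothesis mPsi : measurable_fun setT Psi.
Hypothesis mPhi : measurable_fun setT (fun q : T * T => Phi q.1 q.2).
Hypothesis Phi_sym : forall x y, Phi x y = Phi y x.
Hypothesis mu_density : forall f : T -> \bar R, measurable_fun setT f ->
  (forall x, 0 <= f x) ->
  \int[mu]_x f x = \int[lam]_x ((z * psi beta Psi x)%:E * f x).
Variable P : probability (config T) R.
Hypothesis Pdlr : dlr lam pos A beta z Psi Phi P.
Hypothesis Psimple : {ae P, forall xi, simple_lf A pos xi}.

Let cb := condbs beta Phi.
Let cmean := cond_mean A beta Phi P.

(** The closed formula for the correlation function, taken as definition at every sequence; this
    fixes one version, so that the equations below hold pointwise. *)
Definition corr s : \bar R := (selfb beta Phi s)%:E * cmean s.

Lemma corr_ge0 s : 0 <= corr s.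
Proof. by rewrite mule_ge0 ?lee_fin ?selfb_ge0 ?cond_mean_ge0. Qed.

Lemma corr_perm s t : perm_eq s t -> corr s = corr t.
Proof.
move=> st; rewrite /corr (selfb_perm beta Phi_sym st); congr (_ * _).
by apply: eq_integral => xi _; rewrite (condbs_perm _ _ _ st).
Qed.

Lemma corr_nil : corr [::] = 1.
Proof.
rewrite /corr mul1e /cmean /cond_mean.
rewrite (eq_integral (cst 1)); last by move=> xi _; rewrite /condbs big_nil.
by rewrite integral_cst// mul1e; exact: probability_setT.
Qed.

Lemma mseq_corr x' : mseq (fun (_ : unit) y => corr (x' ++ y)).
Proof.
move=> m; apply: emeasurable_funM; last exact: mseq_cond_mean.
apply/measurable_EFinP; rewrite /=.
under eq_fun do rewrite selfb_cat.
apply: measurable_funM; last exact: mseq_selfb.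
apply: measurable_funM; first exact: measurable_cst.
exact: mseq_cross.
Qed.

(** [gnz_lam] relative to the activity measure: the factors [z] and [psi] are absorbed in [mu], and
    the self-interactions of [x'] and [y] together with their mutual interaction form the
    self-interaction of [x' ++ y]. *)
Lemma gnz k x' (h : seq T -> R) :
  mseq (fun _ : unit => h) -> (forall y, 0 <= h y)%R ->
  (selfb beta Phi x')%:E *
  \int[P]_xi (gsum k (if_upos pos (fun y => (h y)%:E)) (star A xi) *
    (cb x' (star A xi))%:E) =
  iint mu k (fun y => (h y)%:E * corr (x' ++ y)).
Proof.
move=> mh h0.
have mhE dX (X : measurableType dX) : mseq (fun _ : X => h).
  move=> m; have mu0 : measurable_fun setT (fun _ : X => tt) by exact: measurable_cst.
  have := mseqn_comp mu0 (mh m); exact.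
have psiz x : (0 <= z * psi beta Psi x)%R by rewrite mulr_ge0 ?psi_ge0.
rewrite (iint_density (measurable_funM (measurable_cst z) (measurable_psi beta mPsi))
   psiz mu_density tt (F := fun _ y => (h y)%:E * corr (x' ++ y))); last 2 first.
- apply: emeasurable_funM; last exact: mseq_corr.
  by apply/measurable_EFinP; exact: mhE.
- by move=> _ y; rewrite mule_ge0 ?corr_ge0 ?lee_fin.
rewrite (gnz_lam mpos lam_pos mA ndA AT z0 mPsi mPhi Phi_sym k x' Pdlr mh h0).
have mG : mseqn k (fun (_ : unit) y =>
    (gnz_weight beta Psi Phi h x' y)%:E * cmean (x' ++ y)).
  apply: emeasurable_funM; last exact: mseq_cond_mean.
  apply/measurable_EFinP; apply: measurable_funM; first exact: mhE.
  by apply: measurable_funM; [exact: mseq_selfwt|exact: mseq_cross].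
have G0 (u : unit) y : 0 <= (gnz_weight beta Psi Phi h x' y)%:E * cmean (x' ++ y).
  rewrite mule_ge0 ?cond_mean_ge0// lee_fin /gnz_weight mulr_ge0//.
  by rewrite mulr_ge0 ?selfwt_ge0 ?cross_ge0.
rewrite muleA -EFinM -(iintZl lam tt mG G0); last first.
  by rewrite lee_fin mulr_ge0 ?selfb_ge0 ?exprn_ge0.
apply: eq_iintW => y yk; rewrite /corr !muleA -!EFinM; congr (_%:E * _).
have -> : (\prod_(x <- y) (z * psi beta Psi x) = z ^+ k * \prod_(x <- y) psi beta Psi x)%R.
  rewrite -yk; elim: y {yk} => [|x y IH]; first by rewrite !big_nil mulr1.
  by rewrite !big_cons IH /= exprS; ring.
by rewrite /gnz_weight /selfwt selfb_cat; ring.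
Qed.

(** The Mecke equation with no conditioning point and an indicator for [h]. Through this identity
    the Ruelle bound, assumed for densities of the factorial moment measure, reaches [corr]. *)
Lemma corr_correlation N : correlation_function mu P (fun t : N.-tuple T => corr t).
Proof.
have mc : measurable_fun setT (fun t : N.-tuple T => corr t).
  exact: (measurableT_comp (@mseq_corr [::] N) (pair1_measurable tt)).
split=> [//|t|B mB]; first exact: corr_ge0.
pose h s : R := fine (seq_indic R B s).
have hE s : (h s)%:E = seq_indic R B s.
  by rewrite /h fineK// /seq_indic; case: insub.
have h0 s : (0 <= h s)%R by rewrite -lee_fin hE seq_indic_ge0.
have mh : mseq (fun _ : unit => h).
  move=> m; have ms := @mseq_seq_indic _ _ R _ _ mB m.
  exact: (measurableT_comp (fine_measurable measurableT) ms).
have := gnz N [::] mh h0.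
rewrite mul1e => gE; transitivity (\int[P]_xi (gsum N (if_upos pos (fun y => (h y)%:E))
    (star A xi) * (cb [::] (star A xi))%:E)).
  apply: ae_ge0_eq_integralW.
  - move=> xi; rewrite factorial_fsum; apply: fsum_ge0 => s; exact: seq_indic_ge0.
  - move=> xi; rewrite mule_ge0 ?lee_fin ?condbs_ge0//; apply: gsum_ge0.
    by apply: if_upos_ge0 => s; rewrite lee_fin.
  - apply: filterS Psimple => xi [lfx inj].
    rewrite factorial_fsum (fsum_gsum _ inj); last by move=> s; exact: seq_indic_ge0.
    rewrite star_lf// /cb /condbs big_nil mule1; congr (gsum _ (if_upos _ _) _).
    by apply/funext => s; rewrite hE.
rewrite gE integral_mkcond.
rewrite (@eq_iintW _ _ _ mu N _ (fun s => seq_indic R B s * corr s)); last first.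
  by move=> s _; rewrite hE.
rewrite -(@iint_mpow _ _ _ mu N _ unit (fun _ s => seq_indic R B s * corr s) tt); last 2 first.
- by apply: emeasurable_funM; [exact: mseq_seq_indic|exact: (@mseq_corr [::])].
- by move=> _ s; rewrite mule_ge0 ?seq_indic_ge0 ?corr_ge0.
apply: eq_integral => t _; rewrite patchE seq_indicE indicE.
by case: (t \in B); rewrite ?mul1e ?mul0e.
Qed.

(** The analogue of [texp] for infinite configurations; [ks_sum] is the form it takes after
    integration by the Mecke equation. *)
Definition gexp (h : seq T -> R) (g : set T) : \bar R :=
  \sum_(0 <= k <oo) (k`!%:R^-1)%:E * gsum k (if_upos pos (fun y => (h y)%:E)) g.

Definition ks_sum (h : seq T -> R) (F : seq T -> \bar R) : \bar R :=
  \sum_(0 <= k <oo) (k`!%:R^-1)%:E * iint mu k (fun y => (h y)%:E * F y).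

Lemma gexp_seq h s : upos pos s -> (forall y, 0 <= h y)%R ->
  gexp h [set` s] = texp (fun y => (h y)%:E) s.
Proof.
move=> us h0; apply: eq_eseriesr => k _; congr (_ * _).
rewrite gsum_seq ?tsum_upos_ssum//; first exact: upos_uniq us.
by apply: if_upos_ge0 => y; rewrite lee_fin.
Qed.

Lemma cvg_gexp h g : (forall y, 0 <= h y)%R ->
  gexp h (g `&` A n) @[n --> \oo] --> gexp h g.
Proof.
move=> h0; have i0 y : 0 <= if_upos pos (fun y => (h y)%:E) y.
  by apply: if_upos_ge0 => ?; rewrite lee_fin.
have Am n : (fun y => all (mem (A n)) y) = (fun y => all (mem (A n)) y) by [].
pose hn n y := if all (mem (A n)) y then if_upos pos (fun y => (h y)%:E) y else 0.
have hn0 n y : 0 <= hn n y by rewrite /hn; case: ifP.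
have hnd y : {homo hn ^~ y : n m / (n <= m)%N >-> n <= m}.
  move=> n m nm; rewrite /hn; case: ifPn => [nA|_]; last by case: ifP.
  rewrite ifT//; apply/allP => x xy; rewrite inE; apply: (ndA nm).
  by have /= := allP nA x xy; rewrite inE.
have gE n k : gsum k (if_upos pos (fun y => (h y)%:E)) (g `&` A n) = gsum k (hn n) g.
  rewrite /hn gsum_all//; congr gsum; congr setI.
  by apply/seteqP; split=> x /=; [move/mem_set|move/set_mem].
rewrite /gexp; under eq_fun do under eq_eseriesr do rewrite gE.
apply: cvg_nneseries.
- by move=> n k; rewrite mule_ge0 ?lee_fin ?invr_ge0//; exact: gsum_ge0.
- move=> k n m nm; apply: lee_wpmul2l; first by rewrite lee_fin invr_ge0.
  by apply: le_gsum => y; exact: hnd.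
move=> k; apply: cvgeZl => //; apply: cvg_gsum => // y.
have [N NA] : exists N, forall n, (N <= n)%N -> all (mem (A n)) y.
  elim: y => [|x y [N IH]]; first by exists 0%N.
  have [M AM] := AT x; exists (maxn N M) => n; rewrite geq_max => /andP[Nn Mn] /=.
  by rewrite IH// andbT inE; exact: ndA AM.
by apply: cvg_near_cst; exists N => // n /= Nn; rewrite /hn NA.
Qed.

Lemma gexp_ge0 h g : (forall y, 0 <= h y)%R -> 0 <= gexp h g.
Proof.
move=> h0; apply: nneseries_ge0 => k _ _; rewrite mule_ge0 ?lee_fin ?invr_ge0//.
by apply: gsum_ge0; apply: if_upos_ge0 => y; rewrite lee_fin.
Qed.

(* The expansion of [\prod_(y in xi) (1 + f y)], with the terms of each sign on
   their own side. *)
Lemma gexp_identity (f : T -> R) (M : set T -> R) (xi : config T) :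
  simple_lf A pos xi -> (forall x, 0 <= 1 + f x)%R ->
  (forall s, upos pos s -> M [set` s] = \prod_(y <- s) (1 + f y))%R ->
  M (xi `&` A n) @[n --> \oo] --> M xi ->
  (M xi)%:E + gexp (negprod f) xi = gexp (posprod f) xi.
Proof.
move=> [lfx inj] f1 ME Mcvg.
have n0 y : (0 <= negprod f y)%R by exact: negprod_ge0.
have p0 y : (0 <= posprod f y)%R by exact: posprod_ge0.
have E n : (M (xi `&` A n))%:E + gexp (negprod f) (xi `&` A n) =
    gexp (posprod f) (xi `&` A n).
  have finA := lfx n; rewrite -(fset_setK finA).
  have us : upos pos (fset_set (xi `&` A n)).
    rewrite /upos map_inj_in_uniq ?fset_uniq// => x y.
    rewrite !in_fset_set// !inE => -[xix _] [xiy _]; apply: inj; exact/mem_set.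
  by rewrite ME// !gexp_seq//; exact: signed_expansion.
have := @cvg_gexp _ xi p0; under eq_fun do rewrite -E.
move=> cp; have cn : (M (xi `&` A n))%:E + gexp (negprod f) (xi `&` A n)
    @[n --> \oo] --> (M xi)%:E + gexp (negprod f) xi.
  apply: cvgeD; last exact: cvg_gexp.
    by rewrite /adde_def /=.
  by apply: cvg_EFin => //; exact: nearW.
by rewrite -(cvg_lim _ cp)// -(cvg_lim _ cn).
Qed.

(** All terms are non-negative, so the series may be integrated term by term, each term by [gnz]. *)
Lemma ks_sum_gexp (x' : seq T) (h : seq T -> R) : mseq (fun _ : unit => h) -> (forall y, 0 <= h y)%R ->
  ks_sum h (fun y => corr (x' ++ y)) = (selfb beta Phi x')%:E *
    \int[P]_xi (gexp h (star A xi) * (cb x' (star A xi))%:E) /\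
  measurable_fun setT (fun xi => gexp h (star A xi)).
Proof.
move=> mh h0.
have i0 y : 0 <= if_upos pos (fun y => (h y)%:E) y.
  by apply: if_upos_ge0 => ?; rewrite lee_fin.
have mcb : measurable_fun setT (fun xi => (cb x' (star A xi))%:E).
  apply/measurable_EFinP.
  exact: (measurable_condbs_star mA ndA AT beta mPhi x' (@measurable_id _ _ setT)).
have mg k : measurable_fun setT
    (fun xi => gsum k (if_upos pos (fun y => (h y)%:E)) (star A xi)).
  apply: (@measurable_gsum _ _ R _ mA ndA AT k _ _ id
    (fun _ => if_upos pos (fun y => (h y)%:E))) => //.
  apply: (mseq_if_upos mpos (h := fun (_ : config T) y => (h y)%:E)) => m.
  apply/measurable_EFinP.
  have mu0 : measurable_fun setT (fun _ : config T => tt) by exact: measurable_cst.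
  have := mseqn_comp mu0 (mh m); exact.
have mgc k : measurable_fun setT
    (fun xi => (k`!%:R^-1)%:E * gsum k (if_upos pos (fun y => (h y)%:E)) (star A xi)).
  by apply: emeasurable_funM => //; exact: measurable_cst.
have gc0 k xi : 0 <= (k`!%:R^-1)%:E *
    gsum k (if_upos pos (fun y => (h y)%:E)) (star A xi).
  by rewrite mule_ge0 ?lee_fin ?invr_ge0//; exact: gsum_ge0.
split; last by apply: ge0_emeasurable_sum => [k xi _ _|k _].
transitivity ((selfb beta Phi x')%:E * \int[P]_xi \sum_(0 <= k <oo)
    ((k`!%:R^-1)%:E * gsum k (if_upos pos (fun y => (h y)%:E)) (star A xi) *
     (cb x' (star A xi))%:E)).
  rewrite integral_nneseries//; last 2 first.
  - by move=> k; exact: emeasurable_funM.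
  - by move=> k xi _; rewrite mule_ge0 ?lee_fin ?condbs_ge0.
  rewrite -nneseriesZl; last first.
    by move=> k _; apply: integral_ge0 => xi _; rewrite mule_ge0 ?lee_fin ?condbs_ge0.
  apply: eq_eseriesr => k _; rewrite -gnz// muleCA; congr (_ * _).
  rewrite -ge0_integralZl//; last 2 first.
  - exact: emeasurable_funM.
  - by move=> xi _; rewrite mule_ge0 ?lee_fin ?condbs_ge0//; exact: gsum_ge0.
  by apply: eq_integral => xi _; rewrite muleA.
congr (_ * _); apply: eq_integral => xi _.
rewrite muleC -nneseriesZl; last by move=> k _; exact: gc0.
by apply: eq_eseriesr => k _; rewrite muleC.
Qed.

Lemma mseq_posprod (f : T -> R) : measurable_fun setT f ->
  mseq (fun _ : unit => posprod f) /\ mseq (fun _ : unit => negprod f).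
Proof.
move=> mf; have mp := @mseq_prod _ T R _ unit (f \o snd) (measurableT_comp mf measurable_snd).
split=> n; apply: measurable_maxr; do ?exact: measurable_cst.
- exact: mp.
- by apply: measurable_funN; exact: mp.
Qed.

(** The pointwise expansion is multiplied by the Boltzmann factor of [x'] and integrated. [M] is
    general because it is used as the Boltzmann factor of one more point, and later as the indicator
    of a void. *)
Lemma ks_identity (x' : seq T) (f : T -> R) (M : config T -> R) : measurable_fun setT f ->
  (forall xi, 0 <= M xi)%R -> measurable_fun setT (fun xi => M (star A xi)) ->
  {ae P, forall xi, (M xi)%:E + gexp (negprod f) xi = gexp (posprod f) xi} ->
  (selfb beta Phi x')%:E *
    \int[P]_xi (M (star A xi) * cb x' (star A xi))%:E +
  ks_sum (negprod f) (fun y => corr (x' ++ y)) =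
  ks_sum (posprod f) (fun y => corr (x' ++ y)).
Proof.
move=> mf M0 mM ME; have [mpos' mneg] := mseq_posprod mf.
have [-> mgn] := ks_sum_gexp x' mneg (negprod_ge0 f).
have [-> mgp] := ks_sum_gexp x' mpos' (posprod_ge0 f).
have mcb : measurable_fun setT (fun xi => cb x' (star A xi)).
  exact: (measurable_condbs_star mA ndA AT beta mPhi x' (@measurable_id _ _ setT)).
have ge0 h xi : (forall y, 0 <= h y)%R ->
    0 <= gexp h (star A xi) * (cb x' (star A xi))%:E.
  by move=> h0; rewrite mule_ge0 ?gexp_ge0 ?lee_fin ?condbs_ge0.
have Mc0 xi : 0 <= (M (star A xi) * cb x' (star A xi))%:E.
  by rewrite lee_fin mulr_ge0 ?condbs_ge0.
rewrite -ge0_muleDr; last 2 first.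
- by apply: integral_ge0 => xi _.
- by apply: integral_ge0 => xi _; apply: ge0; exact: negprod_ge0.
congr (_ * _); rewrite -ge0_integralD//; last 3 first.
- by apply/measurable_EFinP; exact: measurable_funM.
- by move=> xi _; apply: ge0; exact: negprod_ge0.
- by apply: emeasurable_funM => //; exact/measurable_EFinP.
apply: ae_ge0_eq_integralW.
- by move=> xi; apply: adde_ge0 => //; apply: ge0; exact: negprod_ge0.
- by move=> xi; apply: ge0; exact: posprod_ge0.
- apply: filterS2 Psimple ME => xi [lfx _]; rewrite star_lf// => <-.
  rewrite ge0_muleDl ?lee_fin//; exact/gexp_ge0/negprod_ge0.
Qed.

End kirkwood_salsburg.

Section exponential_series.
Context (R : realType).

Lemma nneseries_expR (j : R) :
  \sum_(0 <= k <oo) (k`!%:R^-1 * j ^+ k)%:E = (expR j)%:E :> \bar R.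
Proof.
have c := is_cvg_series_exp_coeff j.
rewrite /expR -EFin_lim//; congr (limn _); apply/funext => n /=.
rewrite sumEFin; congr EFin; rewrite /series /=; apply: eq_bigr => k _.
by rewrite /exp_coeff /= mulrC.
Qed.

End exponential_series.

(** * Contraction *)

Section ks_contraction.
Context d (T : measurableType d) (R : realType).
Variables lam mu : {sigma_finite_measure set T -> \bar R}.
Context (D : eqType) (pos : T -> D).
Hypothesis mpos : measurable_fun setT (fun q : T * T => pos q.1 == pos q.2).
Hypothesis lam_pos : forall x, {ae lam, forall y, pos y != pos x}.
Variable A : nat -> set T.
Hypothesis mA : forall n, measurable (A n).
Hypothesis ndA : forall n m, (n <= m)%N -> A n `<=` A m.
Hypothesis AT : forall x, exists n, A n x.
Variables beta z : R.
Hypothesis beta0 : (0 < beta)%R.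
Hypothesis z0 : (0 <= z)%R.
Variables (Psi : T -> \bar R) (Phi : T -> T -> \bar R).
Hypothesis mPsi : measurable_fun setT Psi.
Hypothesis mPhi : measurable_fun setT (fun q : T * T => Phi q.1 q.2).
Hypothesis Phi_sym : forall x y, Phi x y = Phi y x.
Hypothesis mu_density : forall f : T -> \bar R, measurable_fun setT f ->
  (forall x, 0 <= f x) ->
  \int[mu]_x f x = \int[lam]_x ((z * psi beta Psi x)%:E * f x).
Variables (a b : T -> R) (theta a0 : R).
Hypothesis ma : measurable_fun setT a.
Hypothesis mb : measurable_fun setT b.
Hypothesis a0a : forall x, (a0 <= a x)%R.

Let f x y : R := (pairb beta Phi x y - 1)%R.

Hypothesis regular : forall x,
  \int[mu]_y (expR (a y + b y) * `|f x y|)%:E <= (theta * a x)%:E.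
Hypothesis stable : forall s, s != [::] -> uniq s -> exists s1 x s2,
  s = s1 ++ x :: s2 /\ (\prod_(y <- s1 ++ s2) pairb beta Phi x y <= expR (b x))%R.

Definition weight s : R := (\prod_(x <- s) expR (a x + b x))%R.

Lemma weight_ge0 s : (0 <= weight s)%R.
Proof. by apply: prodr_ge0 => x _; rewrite expR_ge0. Qed.

Lemma weight_cat s t : weight (s ++ t) = (weight s * weight t)%R.
Proof. by rewrite /weight big_cat. Qed.

Lemma mseq_weight dX (X : measurableType dX) : mseq (fun (_ : X) s => weight s).
Proof.
apply: (@mseq_prod _ T R _ X (fun q => expR (a q.2 + b q.2))).
apply: (measurableT_comp (@measurable_expR R)); apply: measurable_funD.
  exact: (measurableT_comp ma measurable_snd).
exact: (measurableT_comp mb measurable_snd).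
Qed.

Lemma iint_prod (v : T -> R) (j : R) k : measurable_fun setT v ->
  (forall x, 0 <= v x)%R -> \int[mu]_x (v x)%:E = j%:E ->
  iint mu k (fun y => (\prod_(x <- y) v x)%R%:E) = (j ^+ k)%:E.
Proof.
move=> mv v0 jE; have mP n : mseqn n (fun (_ : unit) y => (\prod_(x <- y) v x)%R%:E).
  apply/measurable_EFinP; apply: (@mseq_prod _ T R _ unit (fun q => v q.2)).
  exact: (measurableT_comp mv measurable_snd).
have P0 y : 0 <= (\prod_(x <- y) v x)%R%:E by rewrite lee_fin prodr_ge0.
elim: k => [|k IH]; first by rewrite /= big_nil expr0.
have j0 : (0 <= j)%R.
  by rewrite -lee_fin -jE; apply: integral_ge0 => x _; rewrite lee_fin.
rewrite /= exprSr EFinM -jE -ge0_integralZl//; last 3 first.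
- exact/measurable_EFinP.
- by move=> x _; rewrite lee_fin.
- by rewrite lee_fin exprn_ge0.
apply: eq_integral => x _; under eq_iintW do rewrite big_cons EFinM.
rewrite (iintZl mu tt (mP k))// ?lee_fin//.
by rewrite IH muleC.
Qed.

Lemma measurable_f x : measurable_fun setT (f x).
Proof.
apply: measurable_funB; last exact: measurable_cst.
exact: (measurableT_comp (measurable_pairb beta mPhi) (pair1_measurable x)).
Qed.

(** The integrand of order [k] is a product of one-point functions, so the series is the exponential
    of the one-point integral. *)
Lemma absprod_sum (g : T -> R) (r : R) : measurable_fun setT g ->
  \int[mu]_y (expR (a y + b y) * `|g y|)%:E <= r%:E ->
  \sum_(0 <= k <oo) (k`!%:R^-1)%:E *
    iint mu k (fun y => (\prod_(w <- y) `|g w| * weight y)%R%:E) <= (expR r)%:E.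
Proof.
move=> mg gr; pose v y : R := (expR (a y + b y) * `|g y|)%R.
have mv : measurable_fun setT v.
  apply: measurable_funM.
    by apply: (measurableT_comp (@measurable_expR R)); exact: measurable_funD.
  exact: (measurableT_comp (@normr_measurable R setT) mg).
have v0 y : (0 <= v y)%R by rewrite mulr_ge0 ?expR_ge0.
pose j := fine (\int[mu]_y (v y)%:E).
have jE : \int[mu]_y (v y)%:E = j%:E.
  rewrite fineK// ge0_fin_numE; first exact: le_lt_trans gr (ltry _).
  by apply: integral_ge0 => y _; rewrite lee_fin.
have jle : (j <= r)%R by rewrite -lee_fin -jE.
apply: (@le_trans _ _ (expR j)%:E); last by rewrite lee_fin ler_expR.
rewrite -nneseries_expR; rewrite le_eqVlt; apply/orP; left; apply/eqP.
apply: eq_eseriesr => k _; rewrite EFinM; congr (_ * _).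
rewrite -(iint_prod k mv v0 jE); apply: eq_iintW => y _; congr EFin.
by rewrite /weight -big_split/=; apply: eq_bigr => w _; rewrite /v mulrC.
Qed.

Lemma le_ks_sum (h : seq T -> R) (F G : seq T -> \bar R) : (forall y, 0 <= h y)%R ->
  (forall y, 0 <= F y) -> (forall y, 0 <= G y) ->
  (forall k, aeseq mu k (fun y => F y <= G y)) ->
  ks_sum mu h F <= ks_sum mu h G.
Proof.
move=> h0 F0 G0 FG; apply: lee_nneseries => [k _ _|k _].
  by rewrite mule_ge0 ?lee_fin ?invr_ge0// iint_ge0// => y; rewrite mule_ge0 ?lee_fin.
apply: lee_wpmul2l; first by rewrite lee_fin invr_ge0.
apply: le_iint => [y|y|]; rewrite ?mule_ge0 ?lee_fin//.
by apply: aeseq_impl (FG k) => y _ Fy; rewrite lee_wpmul2l ?lee_fin.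
Qed.

Lemma ks_sum_affine x' (h : seq T -> R) (F : seq T -> \bar R) (c : R) :
  mseq (fun _ : unit => h) -> (forall y, 0 <= h y)%R ->
  mseq (fun _ : unit => F) -> (forall y, 0 <= F y) -> (0 <= c)%R ->
  ks_sum mu h (fun y => F y + (c * weight (x' ++ y))%:E) =
  ks_sum mu h F + (c * weight x')%:E * ks_sum mu h (fun y => (weight y)%:E).
Proof.
move=> mh h0 mF F0 c0.
have wE y : (c * weight (x' ++ y))%:E = (c * weight x')%:E * (weight y)%:E.
  by rewrite weight_cat -EFinM mulrA.
have cw0 : (0 <= c * weight x')%R by rewrite mulr_ge0 ?weight_ge0.
have w0 y : 0 <= (weight y)%:E by rewrite lee_fin weight_ge0.
have mw n : mseqn n (fun (_ : unit) y => (h y)%:E * (weight y)%:E).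
  by apply: emeasurable_funM; apply/measurable_EFinP; [exact: mh|exact: mseq_weight].
have mhF n : mseqn n (fun (_ : unit) y => (h y)%:E * F y).
  by apply: emeasurable_funM; [apply/measurable_EFinP; exact: mh|exact: mF].
rewrite /ks_sum -nneseriesZl; last first.
  move=> k _; rewrite mule_ge0 ?lee_fin ?invr_ge0 ?cw0// iint_ge0// => y.
  by rewrite mule_ge0 ?lee_fin ?weight_ge0.
rewrite -nneseriesD; last 2 first.
- move=> k _ _; rewrite mule_ge0 ?lee_fin ?invr_ge0 ?cw0// iint_ge0// => y.
  by rewrite mule_ge0 ?lee_fin ?weight_ge0.
- move=> k _ _; rewrite !mule_ge0 ?lee_fin ?invr_ge0 ?cw0// iint_ge0// => y.
  by rewrite mule_ge0 ?lee_fin ?weight_ge0.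
apply: eq_eseriesr => k _; rewrite muleCA -ge0_muleDr; last 2 first.
- by apply: iint_ge0 => y; rewrite mule_ge0 ?lee_fin ?weight_ge0.
- by rewrite mule_ge0 ?lee_fin ?cw0// iint_ge0// => y; rewrite mule_ge0 ?lee_fin ?weight_ge0.
congr (_ * _).
rewrite -(iintZl mu tt (mw k))//; last by move=> _ y; rewrite mule_ge0 ?lee_fin ?weight_ge0.
rewrite -(@iintD _ _ _ mu k _ unit (fun _ y => (h y)%:E * F y)
  (fun _ y => (c * weight x')%:E * ((h y)%:E * (weight y)%:E)) tt)//; last 3 first.
- by apply: emeasurable_funM; [exact: measurable_cst|exact: mw].
- by move=> _ y; rewrite mule_ge0 ?lee_fin ?weight_ge0.
- by move=> _ y; rewrite !mule_ge0 ?lee_fin ?weight_ge0.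
apply: eq_iintW => y _; rewrite wE ge0_muleDr//; first by rewrite muleCA.
by rewrite mule_ge0 ?lee_fin ?weight_ge0.
Qed.

(** The positive and negative parts of a product add up to the product of the absolute values, so
    separating the signs costs nothing in the bound. *)
Lemma ks_sum_weight (g : T -> R) (r : R) : measurable_fun setT g ->
  \int[mu]_y (expR (a y + b y) * `|g y|)%:E <= r%:E ->
  ks_sum mu (negprod g) (fun y => (weight y)%:E) +
  ks_sum mu (posprod g) (fun y => (weight y)%:E) <= (expR r)%:E.
Proof.
move=> mg gr; have [mpp mnp] := mseq_posprod mg.
have m0 (h : seq T -> R) n : mseq (fun _ : unit => h) ->
    mseqn n (fun (_ : unit) y => (h y)%:E * (weight y)%:E).
  by move=> mh; apply: emeasurable_funM; apply/measurable_EFinP;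
    [exact: mh|exact: mseq_weight].
have h0 (h : seq T -> R) y : (forall y, 0 <= h y)%R -> 0 <= (h y)%:E * (weight y)%:E.
  by move=> hh; rewrite mule_ge0 ?lee_fin ?weight_ge0.
have p0 := posprod_ge0 g; have n0 := negprod_ge0 g.
rewrite /ks_sum -nneseriesD; last 2 first.
- by move=> k _ _; rewrite mule_ge0 ?lee_fin ?invr_ge0// iint_ge0// => y; exact: h0.
- by move=> k _ _; rewrite mule_ge0 ?lee_fin ?invr_ge0// iint_ge0// => y; exact: h0.
apply: le_trans (absprod_sum mg gr); rewrite le_eqVlt; apply/orP; left; apply/eqP.
apply: eq_eseriesr => k _; rewrite -ge0_muleDr; last 2 first.
- by apply: iint_ge0 => y; exact: h0.
- by apply: iint_ge0 => y; exact: h0.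
congr (_ * _); rewrite -(@iintD _ _ _ mu k _ unit (fun _ y => (negprod g y)%:E * (weight y)%:E)
  (fun _ y => (posprod g y)%:E * (weight y)%:E) tt); last 4 first.
- exact: m0.
- exact: m0.
- by move=> _ y; exact: h0.
- by move=> _ y; exact: h0.
by apply: eq_iintW => y _; rewrite -!EFinM -EFinD -mulrDl addrC posprodD.
Qed.

Hypothesis mu_pos : forall x, {ae mu, forall y, pos y != pos x}.
Hypothesis a0_gt0 : (0 < a0)%R.
Hypothesis theta_lt1 : (theta < 1)%R.

(** All that the contraction argument retains of a Gibbs process. The third property, for each fixed
    [x], is what the expansion of the Boltzmann factor of [x] over an infinite configuration
    requires. *)
Definition admissible (P : probability (config T) R) := [/\
  dlr lam pos A beta z Psi Phi P,
  {ae P, forall xi, simple_lf A pos xi},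
  (forall x, {ae P, forall xi : config T, \esum_(y in xi) (Phi x)^\- y < +oo}) &
  forall n, aeseq mu n (fun s => corr A beta Phi P s <= (weight s)%:E)].

(** The interaction of [x] with [x'] is kept out: multiplied by it, the first term becomes [corr] at
    [x :: x']. Weak stability bounds this factor later. The equation holds for every [x] and [x'],
    so [x] may be chosen freely. *)
Lemma ks_equation P x x' : admissible P ->
  (selfb beta Phi x')%:E * cond_mean A beta Phi P (x :: x') +
  ks_sum mu (negprod (f x)) (fun y => corr A beta Phi P (x' ++ y)) =
  ks_sum mu (posprod (f x)) (fun y => corr A beta Phi P (x' ++ y)).
Proof.
move=> [Pdlr Psimple PN _].
have f1 w : (1 + f x w)%R = pairb beta Phi x w by rewrite /f addrC subrK.
rewrite -(ks_identity mpos lam_pos mA ndA AT z0 mPsi mPhi Phi_sym mu_density Pdlr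
   Psimple x' (measurable_f x) (M := fun xi : config T => condb beta Phi x xi)).
- congr (_ * _ + _); apply: eq_integral => xi _; congr EFin.
  by rewrite /condbs big_cons.
- by move=> xi; exact: condb_ge0.
- have := measurable_condbs_star mA ndA AT beta mPhi [:: x] (@measurable_id _ (config T) setT).
  by under eq_fun do rewrite /condbs big_seq1.
apply: filterS2 Psimple (PN x) => xi sxi Nxi.
apply: (gexp_identity ndA AT (M := condb beta Phi x)) => //.
- by move=> w; rewrite f1 pairb_ge0.
- move=> s us; rewrite condb_seq; last exact: upos_uniq us.
  by apply: eq_bigr => w _; rewrite f1.
- exact: cvg_condb.
Qed.

(** From [X + B = C] and [X' + B' = C'], the upper bounds on [C] by [C'] and on [B'] by [B] give
    [X + B <= X' + B] plus an error, and [B] is then cancelled. Both directions of closeness are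
    needed, one for each sign. *)
Lemma ks_comparison P P' (c : R) x x' : (0 <= c)%R ->
  admissible P -> admissible P' ->
  (forall k, aeseq mu k (fun y => [/\
     corr A beta Phi P (x' ++ y) <= corr A beta Phi P' (x' ++ y) + (c * weight (x' ++ y))%:E,
     corr A beta Phi P' (x' ++ y) <= corr A beta Phi P (x' ++ y) + (c * weight (x' ++ y))%:E &
     corr A beta Phi P (x' ++ y) <= (weight (x' ++ y))%:E])) ->
  (selfb beta Phi x')%:E * cond_mean A beta Phi P (x :: x') <=
  (selfb beta Phi x')%:E * cond_mean A beta Phi P' (x :: x') +
  (c * weight x' * expR (theta * a x))%:E.
Proof.
move=> c0 aP aP' H.
set X := _ * cond_mean _ _ _ P _; set X' := _ * cond_mean _ _ _ P' _.
have eP := ks_equation x x' aP; have eP' := ks_equation x x' aP'.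
rewrite -/X in eP; rewrite -/X' in eP'.
set B := ks_sum mu (negprod _) _ in eP; set B' := ks_sum mu (negprod _) _ in eP'.
set C := ks_sum mu (posprod _) _ in eP; set C' := ks_sum mu (posprod _) _ in eP'.
have [mpp mnp] := mseq_posprod (measurable_f x).
have p0 := posprod_ge0 (f x); have n0 := negprod_ge0 (f x).
pose Kp := ks_sum mu (posprod (f x)) (fun y => (weight y)%:E).
pose Kn := ks_sum mu (negprod (f x)) (fun y => (weight y)%:E).
have Kle : Kn + Kp <= (expR (theta * a x))%:E by exact: ks_sum_weight (measurable_f x) (regular x).
have w0 y : 0 <= (weight y)%:E by rewrite lee_fin weight_ge0.
have K0 (h : seq T -> R) : (forall y, 0 <= h y)%R ->
    0 <= ks_sum mu h (fun y => (weight y)%:E).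
  move=> h0; apply: nneseries_ge0 => k _ _; rewrite mule_ge0 ?lee_fin ?invr_ge0//.
  by apply: iint_ge0 => y; rewrite mule_ge0 ?lee_fin ?weight_ge0.
have cw0 : (0 <= c * weight x')%R by rewrite mulr_ge0 ?weight_ge0.
have co0 Q y : 0 <= corr A beta Phi Q (x' ++ y) by exact: corr_ge0.
have cow0 Q y : 0 <= corr A beta Phi Q (x' ++ y) + (c * weight (x' ++ y))%:E.
  by rewrite adde_ge0// lee_fin mulr_ge0 ?weight_ge0.
have CC' : C <= C' + (c * weight x')%:E * Kp.
  rewrite /C' /Kp -ks_sum_affine//; last by move=> n; exact: mseq_corr.
  by apply: le_ks_sum => // k; apply: aeseq_impl (H k) => y _ [].
have B'B : B' <= B + (c * weight x')%:E * Kn.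
  rewrite /B /Kn -ks_sum_affine//; last by move=> n; exact: mseq_corr.
  by apply: le_ks_sum => // k; apply: aeseq_impl (H k) => y _ [].
(* Finiteness of the negative sum, which permits the cancellation, comes from the Ruelle bound. *)
have Bfin : B \is a fin_num.
  rewrite ge0_fin_numE; last first.
    apply: nneseries_ge0 => k _ _; rewrite mule_ge0 ?lee_fin ?invr_ge0//.
    by apply: iint_ge0 => y; rewrite mule_ge0 ?lee_fin.
  (* The weight is written as an affine function with zero constant part and [c = 1], to reuse
     [ks_sum_affine]. *)
  apply: (@le_lt_trans _ _ (ks_sum mu (negprod (f x)) (fun y => 0 + (1 * weight (x' ++ y))%:E))).
    apply: le_ks_sum => //; first by move=> y; rewrite add0e mul1r.
    by move=> k; apply: aeseq_impl (H k) => y _ []; rewrite add0e mul1r.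
  rewrite (ks_sum_affine x' (F := fun=> 0))//; last by move=> n; exact: measurable_cst.
  rewrite mul1r (_ : ks_sum _ _ (fun=> 0) = 0) ?add0e; last first.
    rewrite /ks_sum eseries0// => k _ _; rewrite (eq_iintW _ (G := fun=> 0)).
      by rewrite (_ : iint _ _ _ = 0) ?mule0//; elim: k => //= k ->; rewrite integral0.
    by move=> y _; rewrite mule0.
  apply: lte_mul_pinfty; rewrite ?lee_fin ?weight_ge0//.
  apply: le_lt_trans (ltry (expR (theta * a x))); apply: le_trans Kle.
  by rewrite leeDl// K0.
rewrite -(leeD2rE _ _ Bfin) eP; apply: (le_trans CC'); rewrite -eP'.
apply: (@le_trans _ _ (X' + (B + (c * weight x')%:E * Kn) + (c * weight x')%:E * Kp)).
  by rewrite leeD2r// leeD2l.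
rewrite [leLHS](_ : _ = X' + B + ((c * weight x')%:E * Kn + (c * weight x')%:E * Kp));
  last by rewrite !addeA.
rewrite -ge0_muleDr ?K0// [leRHS]addeAC leeD2l//.
by rewrite [leRHS]EFinM lee_wpmul2l ?lee_fin.
Qed.

Definition rate : R := expR (- ((1 - theta) * a0)).

Definition close P P' (c : R) := forall n, aeseq mu n (fun s =>
  corr A beta Phi P s <= corr A beta Phi P' s + (c * weight s)%:E).

(** For the empty sequence both correlations equal 1, so only non-empty sequences have to gain the
    factor [rate]. *)
Lemma close_contraction P P' c : (0 <= c)%R -> admissible P -> admissible P' ->
  close P P' c -> close P' P c -> close P P' (c * rate)%R.
Proof.
move=> c0 aP aP' PP' P'P; case=> [|n].
  by rewrite /= !corr_nil /weight big_nil leeDl// lee_fin !mulr_ge0 ?expR_ge0.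
pose G s := [/\
     corr A beta Phi P s <= corr A beta Phi P' s + (c * weight s)%:E,
     corr A beta Phi P' s <= corr A beta Phi P s + (c * weight s)%:E &
     corr A beta Phi P s <= (weight s)%:E].
pose good s k := aeseq mu k (fun y => G (s ++ y)).
have H1 : aeseq mu n (fun s => forall k, good s k).
  apply: (aeseq_forall (Pr := fun k s => good s k)) => k.
  apply: (aeseq_cat (Pr := G)).
  have [_ _ _ /(_ (n + k)%N) R1] := aP.
  have := aeseq_and (PP' (n + k)%N) (aeseq_and (P'P (n + k)%N) R1).
  by apply: aeseq_impl => s _ [? [? ?]].
(* The stable point depends on [s], so the comparison has to be available, off one null set, for all
   sequences obtained from [s] by one deletion. *)
have H2 : aeseq mu n.+1 (fun s => forall j, (j <= n)%N ->
    forall k, good (take j s ++ drop j.+1 s) k).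
  apply: (aeseq_forall (Pr := fun j s => (j <= n)%N ->
    forall k, good (take j s ++ drop j.+1 s) k)) => j.
  have [jn|jn] := leqP j n; last by apply: aeseqW => s _.
  by have := aeseq_del jn H1; apply: aeseq_impl => s _ + _.
(* Weak stability concerns sets of points, hence sequences without repetition. *)
have H3 : aeseq mu n.+1 (fun s => upos pos s).
  by apply: aeseq_upos => x; exact: mu_pos.
have := aeseq_and H2 H3; apply: aeseq_impl => s sn [sgood us].
have s0 : s != [::] by rewrite -size_eq0 sn.
have [s1 [x [s2 [sE pb]]]] := stable s0 (upos_uniq us).
have sperm : perm_eq s (x :: s1 ++ s2).
  by rewrite sE; apply/permPl; exact: (perm_catCA s1 [:: x] s2).
have xgood : forall k, good (s1 ++ s2) k.
  have := sgood (size s1); rewrite sE take_size_cat// -cat_rcons drop_size_cat ?size_rcons//.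
  by apply; move: sn; rewrite sE size_cat/= addnS => -[<-]; rewrite leq_addr.
have cperm Q : corr A beta Phi Q s = corr A beta Phi Q (x :: s1 ++ s2).
  exact: corr_perm.
rewrite !cperm.
have := ks_comparison x c0 aP aP' xgood.
set x' := s1 ++ s2 in pb sperm *.
set pp := (\prod_(y <- x') pairb beta Phi x y)%R in pb.
have pp0 : (0 <= pp)%R by apply: prodr_ge0 => y _; exact: pairb_ge0.
have cE Q : corr A beta Phi Q (x :: x') =
    pp%:E * ((selfb beta Phi x')%:E * cond_mean A beta Phi Q (x :: x')).
  by rewrite /corr /= -/pp EFinM muleA.
move=> le1; rewrite !cE.
apply: (le_trans (lee_wpmul2l _ le1)); first by rewrite lee_fin.
rewrite ge0_muleDr; last 2 first.
- by rewrite mule_ge0 ?cond_mean_ge0// lee_fin selfb_ge0.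
- by rewrite lee_fin !mulr_ge0 ?expR_ge0 ?weight_ge0.
rewrite leeD2l// -EFinM lee_fin.
have -> : weight s = (expR (a x + b x) * weight x')%R.
  by rewrite /weight (perm_big _ sperm)/= big_cons.
apply: (@le_trans _ _ (expR (b x) * (c * weight x' * expR (theta * a x)))%R).
  by rewrite ler_wpM2r// !mulr_ge0 ?expR_ge0 ?weight_ge0.
have -> : (expR (b x) * (c * weight x' * expR (theta * a x)) =
   c * weight x' * expR (b x + theta * a x))%R by rewrite expRD; ring.
have -> : (c * rate * (expR (a x + b x) * weight x') =
   c * weight x' * expR (- ((1 - theta) * a0) + (a x + b x)))%R.
  by rewrite [in RHS]expRD /rate; ring.
rewrite ler_wpM2l ?mulr_ge0 ?weight_ge0// ler_expR.
(* The uniform lower bound on [a] gives [theta a(x) <= a(x) - (1 - theta) a0], which makes the rate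
   independent of [x]. *)
have : (0 <= (1 - theta) * (a x - a0))%R by rewrite mulr_ge0// subr_ge0// ltW.
by nra.
Qed.

Lemma close_iter P P' : admissible P -> admissible P' ->
  forall m, close P P' (rate ^+ m)%R.
Proof.
move=> aP aP' m.
have r0 k : (0 <= rate ^+ k)%R by rewrite exprn_ge0// expR_ge0.
suff: close P P' (rate ^+ m)%R /\ close P' P (rate ^+ m)%R by case.
elim: m => [|m [IH IH']]; last first.
  by rewrite exprSr; split; apply: close_contraction.
have [_ _ _ R1] := aP; have [_ _ _ R2] := aP'.
split=> n; [apply: aeseq_impl (R1 n)|apply: aeseq_impl (R2 n)] => s _ sw;
  by rewrite expr0 mul1r (le_trans sw)// leeDr// corr_ge0.
Qed.

(** The bounds for all [m] hold outside one common null set, so [m] may be chosen after [s],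
    according to its weight. *)
Lemma corr_le P P' : admissible P -> admissible P' -> forall n,
  aeseq mu n (fun s => corr A beta Phi P s <= corr A beta Phi P' s).
Proof.
move=> aP aP' n.
have H : aeseq mu n (fun s => forall m,
    corr A beta Phi P s <= corr A beta Phi P' s + (rate ^+ m * weight s)%:E).
  apply: (aeseq_forall (Pr := fun m s =>
    corr A beta Phi P s <= corr A beta Phi P' s + (rate ^+ m * weight s)%:E)) => m.
  exact: close_iter.
apply: aeseq_impl H => s _ H; apply/lee_addgt0Pr => eps eps0.
have rate1 : (`|rate| < 1)%R.
  by rewrite ger0_norm ?expR_ge0// -expR0 ltr_expR oppr_lt0 mulr_gt0// subr_gt0.
have := cvg_expr rate1; move/cvgrPdist_lt => /(_ (eps / (weight s + 1)))%R.
have w1 : (0 < weight s + 1)%R by rewrite ltr_wpDl ?weight_ge0.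
move=> /(_ (divr_gt0 eps0 w1))[m _ /(_ m (leqnn m))] /=.
rewrite sub0r normrN ger0_norm ?exprn_ge0 ?expR_ge0// ltr_pdivlMr// => rm.
apply: (le_trans (H m)); rewrite leeD2l// lee_fin; apply: le_trans (ltW rm).
by rewrite ler_wpM2l ?exprn_ge0 ?expR_ge0// lerDl.
Qed.

Lemma corr_unique P P' : admissible P -> admissible P' -> forall n,
  aeseq mu n (fun s => corr A beta Phi P s = corr A beta Phi P' s).
Proof.
move=> aP aP' n; have := aeseq_and (corr_le aP aP' n) (corr_le aP' aP n).
by apply: aeseq_impl => s _ [? ?]; apply/eqP; rewrite eq_le; apply/andP.
Qed.

(** For [g = - 1_B] the product of the factors [1 + g] over a configuration is the indicator of the
    void. Its expansion involves the law only through the correlation functions, which agree. *)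
Lemma void_probability P P' (B : set T) : admissible P -> admissible P' ->
  measurable B -> \int[mu]_(y in B) (expR (a y + b y))%:E < +oo ->
  P [set xi : config T | xi `&` B = set0] = P' [set xi : config T | xi `&` B = set0].
Proof.
move=> aP aP' mB Boo; pose M (g : set T) : R := `[< g `&` B = set0 >]%:R.
pose g y : R := (- \1_B y)%R.
have mg : measurable_fun setT g.
  by apply: measurable_funN; exact: measurable_indic.
have M0 xi : (0 <= M xi)%R by rewrite /M; case: asbool.
have voidE (xi : config T) : (xi `&` B = set0) <-> ct R (xi `&` B) = 0.
  rewrite -[0]/(0%:R%:E) -ctP II0 card_eq0; split=> [->|/eqP//].
  exact: eqxx.
have mstar := measurable_star_fun R mA ndA AT (@measurable_id _ (config T) setT).
have mM : measurable_fun setT (fun xi => M (star A xi)).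
  rewrite (_ : (fun _ => _) = \1_[set xi | ct R (star A xi `&` B) = 0]).
    apply: measurable_indic; rewrite -[X in measurable X]setTI.
    exact: (@measurable_config_countP _ _ R _ _ _ B mstar mB measurableT [set 0]).
  apply/funext => xi; rewrite /M indicE; congr (_%:R); congr nat_of_bool.
  by apply/asboolP/idP => [/voidE/mem_set|/set_mem/voidE].
have key Q : admissible Q -> Q [set xi : config T | xi `&` B = set0] +
    ks_sum mu (negprod g) (corr A beta Phi Q) =
    ks_sum mu (posprod g) (corr A beta Phi Q).
  move=> [Qdlr Qsimple _ _].
  have := ks_identity mpos lam_pos mA ndA AT z0 mPsi mPhi Phi_sym mu_density Qdlr
    Qsimple [::] mg (M := fun xi : config T => M xi).
  move=> /(_ (fun xi => M0 xi) mM); rewrite mul1e; move=> <-; last first.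
    apply: filterS Qsimple => xi sxi; apply: (gexp_identity ndA AT (M := M)) => //.
    - by move=> x; rewrite /g indicE; case: (x \in B); rewrite ?subrr ?subr0.
    - move=> s us; rewrite /M /g; case: asboolP => sB.
        rewrite big_seq big1// => y ys; rewrite indicE memNset ?subr0// => By.
        by have : ([set` s] `&` B) y by []; rewrite sB.
      have /set0P[y [ys By]] : [set` s] `&` B != set0 by apply/eqP.
      by rewrite (big_rem y)//= indicE mem_set// subrr mul0r.
    - case: (pselect (xi `&` B = set0)) => xB.
        rewrite /M asboolT//; apply: cvg_near_cst; apply: nearW => n.
        by rewrite asboolT// setIAC xB set0I.
      have /set0P[y [xiy By]] : xi `&` B != set0 by apply/eqP.
      have [N AN] := AT y; rewrite /M asboolF//; apply: cvg_near_cst.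
      exists N => // n /= Nn; rewrite asboolF// => E.
      suff : (xi `&` A n `&` B) y by rewrite E.
      by split=> //; split=> //; exact: ndA AN.
  congr (_ + _); have mV : measurable [set xi : config T | xi `&` B = set0].
    rewrite (_ : [set _ | _] = (fun xi : config T => ct R (xi `&` B)) @^-1` [set 0]).
      rewrite -[X in measurable X]setTI.
      by have /(_ measurableT [set 0]) := @measurable_ct _ T R B mB; exact.
    by apply/seteqP; split=> xi /voidE.
  rewrite -[in LHS](setIT [set _ | _]) -integral_indic//; apply: ae_ge0_eq_integralW.
  - by move=> xi; rewrite lee_fin.
  - by move=> xi; rewrite lee_fin mulr_ge0// condbs_ge0.
  apply: filterS Qsimple => xi [lfx _]; rewrite star_lf// /condbs big_nil mulr1.
  by rewrite /M indicE; case: asboolP => xB; [rewrite mem_set|rewrite memNset].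
have [j Bj] : exists j : R, \int[mu]_y (expR (a y + b y) * `|g y|)%:E <= j%:E.
  exists (fine (\int[mu]_(y in B) (expR (a y + b y))%:E)).
  have i0 : 0 <= \int[mu]_(y in B) (expR (a y + b y))%:E.
    by apply: integral_ge0 => y _; rewrite lee_fin expR_ge0.
  rewrite fineK ?ge0_fin_numE// [leRHS]integral_mkcond le_eqVlt.
  apply/orP; left; apply/eqP; apply: eq_integral => y _; rewrite patchE /g indicE.
  by case: (y \in B); rewrite normrN ?normr1 ?normr0 ?mulr1 ?mulr0.
have w0 y : 0 <= (weight y)%:E by rewrite lee_fin weight_ge0.
have eq_ks (h : seq T -> R) : (forall y, 0 <= h y)%R ->
    ks_sum mu h (corr A beta Phi P) = ks_sum mu h (corr A beta Phi P').
  move=> h0; apply: eq_eseriesr => k _; congr (_ * _); apply: eq_iint.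
  - by move=> y; rewrite mule_ge0 ?corr_ge0// lee_fin.
  - by move=> y; rewrite mule_ge0 ?corr_ge0// lee_fin.
  - by apply: aeseq_impl (corr_unique aP aP' k) => y _ ->.
(* The Ruelle bound and the finite weighted mass of [B] make the negative sum finite, hence
   cancellable. *)
have nfin : ks_sum mu (negprod g) (corr A beta Phi P) \is a fin_num.
  have [_ _ _ R1] := aP; rewrite ge0_fin_numE; last first.
    apply: nneseries_ge0 => k _ _; rewrite mule_ge0 ?lee_fin ?invr_ge0//.
    by apply: iint_ge0 => y; rewrite mule_ge0 ?corr_ge0 ?lee_fin ?negprod_ge0.
  apply: le_lt_trans (ltry (expR j)); apply: le_trans (ks_sum_weight mg Bj).
  apply: (@le_trans _ _ (ks_sum mu (negprod g) (fun y => (weight y)%:E))).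
    apply: le_ks_sum => // y; [exact: negprod_ge0|exact: corr_ge0].
  rewrite leeDl// nneseries_ge0// => k _ _; rewrite mule_ge0 ?lee_fin ?invr_ge0//.
  by apply: iint_ge0 => y; rewrite mule_ge0 ?lee_fin ?weight_ge0 ?posprod_ge0.
have eP := key _ aP; have := key _ aP'.
rewrite -!eq_ks; [|exact: posprod_ge0|exact: negprod_ge0]; rewrite -eP => PP'.
by rewrite -[LHS](addeK _ nfin) -[RHS](addeK _ nfin) PP'.
Qed.

End ks_contraction.

(** * Void probabilities determine the law *)

Section void_probabilities.
Local Open Scope card_scope.
Context d (T : measurableType d) (R : realType).
Variables (Bd H : nat -> set T).
Hypothesis mBd : forall n, measurable (Bd n).
Hypothesis ndBd : forall n m, (n <= m)%N -> Bd n `<=` Bd m.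
Hypothesis BdT : forall x, exists n, Bd n x.
Hypothesis mH : forall n, measurable (H n).
Variable G : set (config T).
Hypothesis mG : measurable G.
Hypothesis sepG : forall xi : config T, G xi -> forall x y, atoms xi x -> atoms xi y -> x <> y ->
  exists i, H i x /\ ~ H i y \/ H i y /\ ~ H i x.

Let void (B : set T) := [set xi : config T | xi `&` B = set0].

Definition void_events : set (set (config T)) :=
  [set void B | B in [set B | measurable B /\ exists n, B `<=` Bd n]].

Let V := <<s void_events >>.

(** Recovering counts from voids requires points separated by the sets [H i], as holds on [G];
    events are therefore compared through their traces on [G]. *)
Definition void_on : set (set (config T)) :=
  [set U | exists2 W, V W & U `&` G = W `&` G].

Lemma void_on_sigma_algebra : sigma_algebra setT void_on.
Proof.
split.
- by exists set0 => //; exact: sigma_algebra0.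
- move=> U [W VW UW]; exists (~` W); first exact: sigma_algebraC.
  rewrite setTD; apply/seteqP; split=> xi [nU Gxi]; split=> // /= h; apply: nU.
    by have [] : (U `&` G) xi by rewrite UW.
  by have [] : (W `&` G) xi by rewrite -UW.
- move=> U /(_ _)/cid2 W; exists (\bigcup_i s2val (W i)).
    by apply: sigma_algebra_bigcup => i; exact: (s2valP (W i)).
  by rewrite !setI_bigcupl; apply: eq_bigcupr => i _; exact: (s2valP' (W i)).
Qed.

Let void_onC U : void_on U -> void_on (~` U).
Proof.
by move=> VU; have [_ + _] := void_on_sigma_algebra => /(_ _ VU); rewrite setTD.
Qed.

Let void_on_bigcup (F : nat -> set (config T)) : (forall i, void_on (F i)) ->
  void_on (\bigcup_i F i).
Proof. by have [_ _] := void_on_sigma_algebra; exact. Qed.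

Let void_onI U W : void_on U -> void_on W -> void_on (U `&` W).
Proof.
move=> VU VW; rewrite -[_ `&` _]setCK setCI; apply: void_onC.
rewrite -bigcup2E; apply: void_on_bigcup => -[|[|i]] /=; do ?exact: void_onC.
by have [] := void_on_sigma_algebra.
Qed.

Let void_on_void B : measurable B -> void_on (void B).
Proof.
move=> mB; rewrite (_ : void B = \bigcap_n void (B `&` Bd n)); last first.
  apply/seteqP; split=> xi; rewrite /void/=.
    by move=> h n _ /=; rewrite setIA h set0I.
  move=> h; apply/seteqP; split=> x //= -[xix Bx]; have [n Bdx] := BdT x.
  have hn : xi `&` (B `&` Bd n) = set0 by exact: (h n I).
  by have : (xi `&` (B `&` Bd n)) x by []; rewrite hn.
rewrite -[\bigcap_n _]setCK setC_bigcap; apply: void_onC.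
apply: void_on_bigcup => n; apply: void_onC; exists (void (B `&` Bd n)) => //.
apply: sub_sigma_algebra; exists (B `&` Bd n) => //; split; first exact: measurableI.
by exists n => x [].
Qed.

Let atleast m (B : set T) := [set xi : config T | m%:R%:E <= ct R (xi `&` B)].

Lemma ct_gt0 (B : set T) : (1%:R%:E <= ct R B) <-> (B !=set0).
Proof.
split=> [B1|[x Bx]]; last first.
  apply: esum_ge; exists [set x]; first by split => // y ->.
  by rewrite fsbig_set1.
apply/set0P/eqP => B0; move: B1; rewrite B0 /ct esum_set0 lee_fin.
by rewrite ler10.
Qed.

Lemma ct_two (B : set T) : 2%:R%:E <= ct R B -> exists x y, [/\ B x, B y & x <> y].
Proof.
move=> B2; have /ct_gt0[x Bx] : 1%:R%:E <= ct R B.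
  by apply: le_trans B2; rewrite lee_fin ler_nat.
apply: contrapT => h; have BE : B = [set x].
  apply/seteqP; split=> [y By|y ->//]; apply: contrapT => yx.
  by apply: h; exists y, x; split.
move: B2; rewrite BE /ct esum_set1// lee_fin.
by rewrite -[leRHS]/(1%:R)%R ler_nat.
Qed.

(** If [C] holds more than [m] points, [m] are kept there and one outside; otherwise all those in
    [C] are kept, and the outside supplies the rest. *)
Lemma ct_split m (B C : set T) : (0 < m)%N -> m.+1%:R%:E <= ct R B ->
  B `&` C !=set0 -> B `&` ~` C !=set0 ->
  exists2 k, (k < m)%N &
    (k.+1%:R%:E <= ct R (B `&` C)) /\ ((m - k)%:R%:E <= ct R (B `&` ~` C)).
Proof.
move=> m0 Bm /ct_gt0 c1 /ct_gt0 c2; move: Bm; rewrite (ctID R B C).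
have [[p pE]|poo] := ctE R (B `&` C); last first.
  move=> _; exists m.-1; first by rewrite ltn_predL.
  by rewrite poo leey; split=> //; rewrite -[X in (X - _)%N](prednK m0) subSnn.
have [[q qE]|qoo] := ctE R (B `&` ~` C); last first.
  by move=> _; exists 0%N => //; rewrite c1 qoo leey.
move: c1 c2; rewrite pE qE -EFinD -natrD !lee_fin !ler_nat => p1 q1 pq.
have [pm|mp] := leqP p m; last by exists m.-1; rewrite ?lee_fin ?ler_nat; lia.
by exists p.-1; rewrite ?lee_fin ?ler_nat; lia.
Qed.

(** Strong induction on the count. Some [H i] separates two points of a configuration in [G] with at
    least [m.+2] points in [B], so both parts of [B] are occupied and the count splits into two
    thresholds between 1 and [m.+1]. A countable union over [i] and over the splittings recovers the
    event. *)
Let void_on_atleast m B : measurable B -> void_on (atleast m B).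
Proof.
have [n mn] : exists n, (m < n)%N by exists m.+1.
elim: n m B mn => // n IH [|[|m]] B mn mB.
- exists setT; first by rewrite -setC0; apply: sigma_algebraC; exact: sigma_algebra0.
  by congr setI; apply/seteqP; split=> xi // _; exact: ct_ge0.
- rewrite (_ : atleast _ _ = ~` void B); first exact/void_onC/void_on_void.
  apply/seteqP; split=> xi; rewrite /atleast /void/= ct_gt0.
    by move=> /set0P/eqP.
  by move=> /eqP/set0P.
pose U := \bigcup_i \bigcup_(k < m.+1)
  (atleast k.+1 (B `&` H i) `&` atleast (m.+1 - k) (B `&` ~` H i)).
suff -> : void_on (atleast m.+2 B) = void_on U.
  apply: void_on_bigcup => i; rewrite bigcup_mkcond; apply: void_on_bigcup => k.
  case: ifPn => [|_]; last by have [] := void_on_sigma_algebra.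
  rewrite inE /= => km; apply: void_onI; apply: IH; [lia| |lia|].
  - exact: measurableI.
  - by apply: measurableI => //; exact: measurableC.
have E : atleast m.+2 B `&` G = U `&` G.
  apply/seteqP; split=> xi [h Gxi]; split => //.
    have [|x [y [[xix Bx] [xiy By] xy]]] := @ct_two (xi `&` B).
      by apply: le_trans h; rewrite lee_fin ler_nat.
    have [i Hi] := sepG Gxi xix xiy xy; exists i => //.
    have [||k km [k1 k2]] := @ct_split m.+1 (xi `&` B) (H i) erefl h.
    - by case: Hi => -[Hx Hy]; [exists x|exists y].
    - by case: Hi => -[Hx Hy]; [exists y|exists x].
    by exists k => //; split; rewrite /atleast /= setIA.
  move: h => [i _ [k /= km []]]; rewrite /atleast /= !setIA => k1 k2.
  rewrite (ctID R _ (H i)); apply: le_trans (leeD k1 k2).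
  by rewrite -EFinD -natrD lee_fin ler_nat; lia.
by rewrite /void_on /= E.
Qed.

Lemma void_on_measurable U : measurable U -> void_on U.
Proof.
suff : <<s [set [set g : config T | g `&` B #= `I_k] | B in measurable & k in setT] >>
    `<=` void_on by exact.
apply: smallest_sub; first exact: void_on_sigma_algebra.
move=> _ [B mB [k _ <-]].
rewrite (_ : [set _ | _] = atleast k B `&` ~` atleast k.+1 B).
  by apply: void_onI; [|apply: void_onC]; exact: void_on_atleast.
apply/seteqP; split=> xi /=; rewrite /atleast /=.
  by move=> /(ctP R) ->; rewrite !lee_fin !ler_nat ltnn.
have [[p pE]|->] := ctE R (xi `&` B); last by rewrite !leey => -[].
rewrite pE !lee_fin !ler_nat => -[kp /negP]; rewrite -ltnNge => pk.
by apply/(ctP R); rewrite pE; suff -> : p = k; [|lia].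
Qed.

(** Void events form a pi-system, two voids meeting in the void of the union. Only sets contained in
    some [Bd n] are used, since void probabilities are compared there. *)
Lemma void_unique (P P' : probability (config T) R) :
  {ae P, forall xi, G xi} -> {ae P', forall xi, G xi} ->
  (forall B, measurable B -> (exists n, B `<=` Bd n) -> P (void B) = P' (void B)) ->
  forall U, measurable U -> P U = P' U.
Proof.
move=> PG P'G PP' U mU.
have mvoid B : measurable B -> measurable (void B).
  move=> mB; apply: sub_sigma_algebra; exists B => //; exists 0%N => //.
  by apply/seteqP; split=> xi /=; rewrite II0 card_eq0 => /eqP.
have mV : V `<=` measurable.
  apply: smallest_sub; first exact: sigma_algebra_measurable.
  by move=> _ [B [mB _] <-]; exact: mvoid.
have VE W : V W -> P W = P' W.
  apply: (@g_sigma_algebra_measure_unique _ _ _ void_events _ (fun=> setT)) => //.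
  - by move=> _ [B [mB _] <-]; exact: mvoid.
  - move=> _; exists set0; last by apply/seteqP; split=> xi // _; rewrite /void /= setI0.
    by split=> //; exists 0%N.
  - by apply/seteqP; split=> // xi _; exists 0%N.
  - move=> _ _ [B [mB [n Bn]] <-] [C [mC [m Cm]] <-]; exists (B `|` C).
      split; first exact: measurableU.
      exists (maxn n m) => x [/Bn|/Cm]; apply: ndBd; [exact: leq_maxl|exact: leq_maxr].
    apply/seteqP; split=> xi; rewrite /void /= setIUr.
      by move/seteqP => [h _]; split; apply/seteqP; split=> x // ?; apply: h; [left|right].
    by move=> [-> ->]; rewrite setU0.
  - by move=> _ [B [mB Bn] <-]; exact: PP'.
  - by move=> _; rewrite (le_lt_trans (probability_le1 _ _))// ltry.
have [W VW UW] := void_on_measurable mU.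
have GE (Q : probability (config T) R) X : {ae Q, forall xi, G xi} -> measurable X ->
    Q X = Q (X `&` G).
  move=> [N [mN N0 NG]] mX; apply/eqP; rewrite eq_le; apply/andP; split.
    rewrite -[leRHS]adde0 -N0; apply: le_trans (measureU2 _ _ _) => //.
      apply: le_measure; rewrite ?inE//.
        by apply: measurableU => //; exact: measurableI.
      by move=> xi Xxi; case: (pselect (G xi)) => Gxi; [left|right; apply: NG].
    exact: measurableI.
  by apply: le_measure; rewrite ?inE//; exact: measurableI.
rewrite (GE _ _ PG)// (GE _ _ P'G)// UW -GE//; last exact: mV.
by rewrite -GE//; [exact: VE|exact: mV].
Qed.

End void_probabilities.

(** * Integration against the Poisson process *)

Section integral_like.
Import HBNNSimple.
Context d (X : measurableType d) (R : realType).
Implicit Types (I J : (X -> \bar R) -> \bar R) (f g : X -> \bar R).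

(** The axioms of an integral on non-negative measurable functions. They show that a set function
    given by an explicit formula is a measure and yield its integrals at the same time. *)
Definition integral_like I := [/\
  (forall f g, measurable_fun setT f -> (forall x, 0 <= f x) ->
     measurable_fun setT g -> (forall x, 0 <= g x) ->
     I (fun x => f x + g x) = I f + I g),
  (forall (c : R) f, (0 <= c)%R -> measurable_fun setT f -> (forall x, 0 <= f x) ->
     I (fun x => c%:E * f x) = c%:E * I f) &
  (forall (f_ : nat -> X -> \bar R) f, (forall n, measurable_fun setT (f_ n)) ->
     (forall n x, 0 <= f_ n x) ->
     (forall x, {homo f_ ^~ x : n m / (n <= m)%N >-> n <= m}) ->
     (forall x, f_ n x @[n --> \oo] --> f x) -> I (f_ n) @[n --> \oo] --> I f)].

Lemma integral_like_integral (mu : {measure set X -> \bar R}) :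
  integral_like (fun f => \int[mu]_x f x).
Proof.
split=> [f g mf f0 mg g0|c f c0 mf f0|f_ f mf f0 ndf ff].
- by rewrite ge0_integralD.
- by rewrite ge0_integralZl// lee_fin.
- exact: ge0_cvg_integral.
Qed.

Lemma integral_like0 I : integral_like I -> I (fun=> 0) = 0.
Proof.
move=> [_ /(_ 0%R (fun=> 0) (lexx _) (measurable_cst _) (fun=> lexx _)) + _].
by under [in X in X -> _]eq_fun do rewrite mul0e; rewrite mul0e.
Qed.

(** Additivity and homogeneity pass from indicators to simple functions, and monotone continuity
    passes to all non-negative measurable functions. *)
Lemma integral_like_unique I J : integral_like I -> integral_like J ->
  (forall A, measurable A -> I (fun x => (\1_A x)%:E) = J (fun x => (\1_A x)%:E)) ->
  forall f, measurable_fun setT f -> (forall x, 0 <= f x) -> I f = J f.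
Proof.
move=> HI HJ IJ f mf f0.
pose f_ := nnsfun_approx measurableT mf.
have simple n : I (EFin \o f_ n) = J (EFin \o f_ n).
  have -> : EFin \o f_ n = fun x => \sum_(y <- fset_set (range (f_ n)))
      (`|y| * \1_(f_ n @^-1` [set y]) x)%:E.
    apply/funext => x /=; rewrite [f_ n x]fimfunE fsbig_finite//= -sumEFin big_seq.
    rewrite [RHS]big_seq; apply: eq_bigr => y; rewrite in_fset_set// inE.
    by move=> [t _ <-]; rewrite ger0_norm.
  have pm y : measurable_fun setT (fun x => (`|y| * \1_(f_ n @^-1` [set y]) x)%:E).
    apply/measurable_EFinP; apply: measurable_funM; first exact: measurable_cst.
    by apply: measurable_indic; exact: measurable_sfunP.
  have p0 y x : 0 <= (`|y| * \1_(f_ n @^-1` [set y]) x)%:E :> \bar R.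
    by rewrite lee_fin mulr_ge0.
  elim: (fset_set _ : seq R) => [|y s IH].
    under eq_fun do rewrite big_nil; by rewrite !integral_like0.
  under eq_fun do rewrite big_cons.
  have ms : measurable_fun setT (fun x => \sum_(y <- s) (`|y| * \1_(f_ n @^-1` [set y]) x)%:E).
    exact: emeasurable_sum.
  have s0 x : 0 <= \sum_(y <- s) (`|y| * \1_(f_ n @^-1` [set y]) x)%:E :> \bar R.
    by apply: sume_ge0.
  case: (HI) => addI ZI _; case: (HJ) => addJ ZJ _.
  rewrite addI// addJ// IH; congr (_ + _).
  have mi : measurable (f_ n @^-1` [set y]) by exact: measurable_sfunP.
  have mi' := @measurable_EFin_indic _ _ R _ mi.
  by under eq_fun do rewrite EFinM; rewrite ZI// ZJ// IJ.
have approx K : integral_like K -> K (EFin \o f_ n) @[n --> \oo] --> K f.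
  move=> [_ _]; apply => [n|n x|x n m nm|x].
  - exact/measurable_EFinP.
  - by rewrite lee_fin.
  - rewrite lee_fin; exact/lefP/nd_nnsfun_approx.
  - by apply: cvg_nnsfun_approx.
rewrite -(cvg_lim _ (approx _ HI))// -(cvg_lim _ (approx _ HJ))//.
by congr (limn _); apply/funext.
Qed.

(** The measure is equal to [mu] as a function on all sets, not merely on measurable ones, so
    integrals written with the bare set function can be rewritten through it. *)
Lemma integral_like_measure I (mu : set X -> \bar R) : integral_like I ->
  (forall A, 0 <= mu A) ->
  (forall A, measurable A -> mu A = I (fun x => (\1_A x)%:E)) ->
  exists2 nu : {measure set X -> \bar R}, (nu : set X -> \bar R) = mu &
    forall f, measurable_fun setT f -> (forall x, 0 <= f x) -> \int[nu]_x f x = I f.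
Proof.
move=> HI mu0 muI; have mi := @measurable_EFin_indic _ X R.
have i0 (A : set X) x : 0 <= (\1_A x)%:E :> \bar R by rewrite lee_fin.
have mu_set0 : mu set0 = 0.
  rewrite muI// -(integral_like0 HI); congr I; apply/funext => x.
  by rewrite indic0.
have mu_sigma : semi_sigma_additive mu.
  move=> F mF tF mUF; case: (HI) => addI _ cvgI.
  have mn n : measurable (\big[setU/set0]_(k < n) F k) by exact: bigsetU_measurable.
  have E n : \sum_(0 <= k < n) mu (F k) = mu (\big[setU/set0]_(k < n) F k).
    elim: n => [|n IH]; first by rewrite big_geq// big_ord0 mu_set0.
    rewrite big_nat_recr//= IH big_ord_recr/=.
    have mU := measurableU _ _ (mn n) (mF n).
    rewrite (muI _ mU) (muI _ (mn n)) (muI _ (mF n)).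
    rewrite -(addI _ _ (mi _ (mn n)) (i0 _) (mi _ (mF n)) (i0 _)).
    congr I; apply/funext => x.
    rewrite -EFinD; congr EFin; rewrite !indicE in_setU.
    case: (boolP (x \in F n)) => [xFn|_]; last by rewrite addr0 orbF.
    case: (boolP (x \in _)) => [|_]; last by rewrite add0r.
    rewrite -bigcup_mkord inE => -[k /= kn Fkx].
    have /trivIsetP/(_ k n Logic.I Logic.I) := tF; rewrite ltn_eqF// => /(_ erefl) kn0.
    have : (F k `&` F n) x by split=> //; exact/set_mem.
    by rewrite kn0.
  under eq_fun do rewrite E (muI _ (mn _)).
  rewrite muI//; apply: cvgI => [n|//|x n m nm|x].
  - exact: mi.
  - rewrite lee_fin !indicE -!bigcup_mkord ler_nat; case: (boolP (x \in _)) => //.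
    rewrite inE => -[k /= kn Fkx]; rewrite mem_set//; exists k => //=.
    exact: leq_trans kn nm.
  - rewrite indicE; case: (boolP (x \in _)) => [|xF].
      rewrite inE => -[k _ Fkx]; apply: cvg_near_cst; exists k.+1 => // n /= kn.
      by rewrite indicE -bigcup_mkord mem_set//; exists k.
    apply: cvg_near_cst; apply: nearW => n; rewrite indicE -bigcup_mkord.
    rewrite (_ : (x \in _) = false)//; apply/negP => /set_mem[k _ Fkx].
    by move: xF; rewrite mem_set//; exists k.
pose M := isMeasure.Build _ _ _ mu mu_set0 mu0 mu_sigma.
pose nu : {measure set X -> \bar R} := HB.pack mu M.
exists nu => // f mf f0.
apply: (integral_like_unique (integral_like_integral nu) HI) => // A mA.
by rewrite integral_indic// setIT; exact: muI.
Qed.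

End integral_like.

Section poisson_sum_limits.
Context d (T : measurableType d) (R : realType).
Variable lam : {sigma_finite_measure set T -> \bar R}.
Variable z : R.
Hypothesis z0 : (0 <= z)%R.

Let coef_ge0 k : 0 <= (z ^+ k / k`!%:R)%:E :> \bar R.
Proof. by rewrite lee_fin divr_ge0// exprn_ge0. Qed.

Lemma poisson_sumD dX (X : measurableType dX) (F G : X -> seq T -> \bar R) p :
  mseq F -> mseq G -> (forall x s, 0 <= F x s) -> (forall x s, 0 <= G x s) ->
  poisson_sum lam z (fun s => F p s + G p s) =
  poisson_sum lam z (F p) + poisson_sum lam z (G p).
Proof.
move=> mF mG F0 G0; rewrite /poisson_sum -nneseriesD; last 2 first.
- by move=> k _ _; rewrite mule_ge0// iint_ge0.
- by move=> k _ _; rewrite mule_ge0// iint_ge0.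
apply: eq_eseriesr => k _; rewrite -ge0_muleDr ?iint_ge0//.
by congr (_ * _); rewrite -(@iintD _ _ _ lam k _ X F G p).
Qed.

Lemma cvg_poisson_sum dX (X : measurableType dX)
    (F_ : nat -> X -> seq T -> \bar R) (F : X -> seq T -> \bar R) p :
  (forall m, mseq (F_ m)) -> (forall m x s, 0 <= F_ m x s) ->
  (forall x s, {homo F_^~ x ^~ s : k m / (k <= m)%N >-> k <= m}) ->
  (forall x s, F_ m x s @[m --> \oo] --> F x s) ->
  poisson_sum lam z (F_ m p) @[m --> \oo] --> poisson_sum lam z (F p).
Proof.
move=> mF F0 ndF FF; apply: cvg_nneseries.
- by move=> m k; rewrite mule_ge0// iint_ge0.
- move=> k m m' mm; rewrite lee_wpmul2l//; apply: le_iint => [s|s|]; [exact: F0..|].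
  by apply: aeseqW => s _; exact: ndF.
move=> k; apply: cvgeZl => //; apply: (@cvg_iint _ _ _ lam k _ X F_ F p) => //.
by move=> m; exact: mF.
Qed.

End poisson_sum_limits.

Section poisson_integral.
Context d (T : measurableType d) (R : realType).
Variable lam : {sigma_finite_measure set T -> \bar R}.
Context (D : eqType) (pos : T -> D).
Hypothesis mpos : measurable_fun setT (fun q : T * T => pos q.1 == pos q.2).
Variable A : nat -> set T.
Hypothesis mA : forall n, measurable (A n).
Hypothesis ndA : forall n m, (n <= m)%N -> A n `<=` A m.
Hypothesis AT : forall x, exists n, A n x.

Lemma config_ext (g h : config T) : (g : set T) = h -> g = h.
Proof.
case: g h => [g cg] [h ch] /= gh; rewrite gh in cg *.
by congr Config; exact: Prop_irrelevance.
Qed.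

Lemma upos_inj s : upos pos s -> {in s &, injective pos}.
Proof.
rewrite /upos => us x y xs ys pxy; have [i si iE] := nthP x xs.
have [j sj jE] := nthP x ys; move: us => /(uniqP (pos x))/(_ i j).
rewrite !inE size_map => /(_ si sj); rewrite !(nth_map x)// jE iE => /(_ pxy) ij.
by rewrite -iE -jE ij.
Qed.

Lemma star_config_seq s : star A (config_seq s) = config_seq s.
Proof. by apply: star_lf => n; apply: sub_finite_set (finite_seq s) => x []. Qed.

Lemma ssum_size (T' : eqType) (s : seq T') :
  ssum (size s) (fun _ _ => 1) s = (size s)`!%:R%:E :> \bar R.
Proof.
suff H k : (size s <= k)%N -> ssum k (fun _ _ => 1) s =
    (if size s == k then k`!%:R%:E else 0) :> \bar R by rewrite H// eqxx.
elim: s k => [|x s IH] [|k]//= sk.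
have ks : (size s <= k.+1)%N by exact: leqW.
have := @ssum_cons _ R k (fun=> 1) x s; rewrite /= => -> //.
rewrite (IH k)// -[rsum _ _]/(ssum k.+1 (fun _ _ => 1) s) (IH _ ks)
  (_ : (size s == k.+1) = false); last by lia.
rewrite add0e eqSS; case: eqP => _; last by rewrite mule0.
by rewrite -EFinM -natrM.
Qed.

Section descent.
Variable w : seq T -> \bar R.
Hypothesis mw : mseq (fun _ : unit => w).
Hypothesis w0 : forall s, 0 <= w s.
Hypothesis w_perm : forall s t, perm_eq s t -> w s = w t.

Lemma gsum_config_seq s : upos pos s ->
  gsum (size s) (if_upos pos w) [set` s] = (size s)`!%:R%:E * w s.
Proof.
move=> us; rewrite gsum_seq; [|exact: upos_uniq us|exact: if_upos_ge0].
rewrite tsum_upos_ssum// (@eq_ssum _ _ _ _ (fun _ _ => w s * 1)) ?ssumZ//.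
  by rewrite ssum_size muleC.
move=> y r ys /[dup]/perm_size; rewrite size_cat ys => /eqP.
rewrite -{2}[size s]addn0 eqn_add2l size_eq0 => /eqP ->.
by rewrite cats0 mule1; exact: w_perm.
Qed.

(* The [k`!] orderings of a configuration of [k] points have the same weight. *)
Lemma symmetric_descent : exists W : config T -> \bar R,
  [/\ measurable_fun setT W, forall xi, 0 <= W xi &
      forall s, upos pos s -> W (config_seq s) = w s].
Proof.
pose V k (xi : config T) := (k`!%:R^-1)%:E * gsum k (if_upos pos w) (star A xi).
have V0 k xi : 0 <= V k xi.
  rewrite mule_ge0 ?lee_fin ?invr_ge0//; apply: gsum_ge0; exact: if_upos_ge0.
have mV k : measurable_fun setT (V k).
  apply: emeasurable_funM; first exact: measurable_cst.
  apply: (@measurable_gsum _ _ R _ mA ndA AT k _ _ id (fun _ => if_upos pos w)) => //.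
    apply: (mseq_if_upos mpos (h := fun (_ : config T) y => w y)) => m.
    have mu0 : measurable_fun setT (fun _ : config T => tt) by exact: measurable_cst.
    have := mseqn_comp mu0 (@mw m); exact.
  by move=> _; exact: if_upos_ge0.
pose W (xi : config T) := \sum_(0 <= k <oo) if ct R ((xi : set T) `&` setT) == k%:R%:E then V k xi else 0.
have W0 k (xi : config T) : 0 <= if ct R ((xi : set T) `&` setT) == k%:R%:E then V k xi else 0.
  by case: ifP.
exists W; split=> [|xi|s us].
- apply: ge0_emeasurable_sum => [k xi _ _|k _]; first exact: W0.
  apply: measurable_fun_ifT => //; apply: measurable_fun_eqe => //.
  exact: measurable_ct.
- by apply: nneseries_ge0 => k _ _.
rewrite /W setIT (_ : ct R _ = (size s)%:R%:E); last first.
  rewrite /ct esum_seq//; last exact: upos_uniq us.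
  by rewrite sumEFin big_const_seq count_predT iter_addr addr0.
rewrite nneseries_esumT; last by move=> k; case: ifP.
rewrite (@eq_esum _ _ _ _ (fun k => if k \in [set size s] then V k (config_seq s) else 0)).
  rewrite -esum_mkcondr setTI esum_set1// /V star_config_seq gsum_config_seq//.
  rewrite muleA -EFinM mulVf ?mul1e// pnatr_eq0 -lt0n; exact: fact_gt0.
move=> k _; rewrite eqe eqr_nat eq_sym; case: eqP => [->|ks]; first by rewrite mem_set.
by rewrite memNset.
Qed.

End descent.

Variables (z c : R) (n : nat).
Hypothesis z0 : (0 <= z)%R.
Hypothesis c0 : (0 <= c)%R.

Definition poisson_law (U : set (config T)) : \bar R :=
  c%:E * \sum_(0 <= N <oo) (z ^+ N / N`!%:R)%:E *
    mpow lam N [set t : N.-tuple T | upos pos t /\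
      (U `&` [set g : config T | g `<=` A n]) (config_seq t)].

Let ext (f : config T -> \bar R) s :=
  if inwin pos A n s then f (upos_config pos s) else 0.

Let ext_ge0 f s : (forall g, 0 <= f g) -> 0 <= ext f s.
Proof. by move=> f0; rewrite /ext; case: ifP. Qed.

Let mseq_ext f : measurable_fun setT f -> mseq (fun _ : unit => ext f).
Proof.
move=> mf m; apply: measurable_fun_ifT; last exact: measurable_cst.
  exact: mseq_inwin.
have mu0 : mseq (fun _ : unit => upos_config pos) by exact: (mseq_upos_config R mpos).
exact: (measurableT_comp mf (@mu0 m)).
Qed.

Let coef_ge0 k : 0 <= (z ^+ k / k`!%:R)%:E :> \bar R.
Proof. by rewrite lee_fin divr_ge0// exprn_ge0. Qed.

Let poisson_like : integral_like (fun f => c%:E * poisson_sum lam z (ext f)).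
Proof.
split=> [f g mf f0 mg g0|k f k0 mf f0|f_ f mf f0 ndf ff].
- rewrite -ge0_muleDr; [|by apply: poisson_sum_ge0 => // s; exact: ext_ge0..].
  congr (_ * _); rewrite -(@poisson_sumD _ _ _ lam z z0 _ unit (fun=> ext f) (fun=> ext g) tt).
  + by congr poisson_sum; apply/funext => s; rewrite /ext; case: ifP; rewrite ?adde0.
  + exact: mseq_ext.
  + exact: mseq_ext.
  + by move=> _ s; exact: ext_ge0.
  + by move=> _ s; exact: ext_ge0.
- rewrite muleCA -(poisson_sumZ lam z0 k0 (@mseq_ext f mf) (fun s => ext_ge0 s f0)).
  congr (_ * poisson_sum _ _ _); apply/funext => s; rewrite /ext.
  by case: ifP; rewrite ?mule0.
- have fg0 : forall g, 0 <= f g.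
    by move=> g; apply: le_trans (f0 0%N g) (nd_cvg_lee (ndf g) (ff g) 0%N).
  apply: cvgeZl => //.
  apply: (@cvg_poisson_sum _ _ _ lam z z0 _ unit (fun m _ => ext (f_ m)) (fun=> ext f) tt).
  + by move=> m; exact: mseq_ext.
  + by move=> m _ s; exact: ext_ge0.
  + by move=> _ s m m' mm; rewrite /ext; case: ifP => // _; exact: ndf.
  + by move=> _ s; rewrite /ext; case: ifP => // _; exact: cvg_cst.
Qed.

Let inwin_supp s : inwin pos A n s <->
  upos pos s /\ (config_seq s : set T) `<=` A n.
Proof.
rewrite /inwin; split=> [/andP[us /allP sA]|[us sA]].
  by split=> // x /= xs; have /= := sA _ xs; rewrite inE.
by rewrite us; apply/allP => x xs /=; rewrite inE; exact: sA.
Qed.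

Lemma poisson_lawP : exists2 nu : {measure set (config T) -> \bar R},
  (nu : set (config T) -> \bar R) = poisson_law &
  forall f, measurable_fun setT f -> (forall g, 0 <= f g) ->
    \int[nu]_g f g = c%:E * poisson_sum lam z (ext f).
Proof.
apply: (integral_like_measure poisson_like) => [U|U mU].
  by rewrite mule_ge0// nneseries_ge0// => k _ _; rewrite mule_ge0.
congr (_ * _); apply: eq_eseriesr => k _; congr (_ * _).
have mi := @measurable_EFin_indic _ _ R _ mU.
have i0 g : 0 <= (\1_U g)%:E :> \bar R by rewrite lee_fin.
rewrite -(@iint_mpow _ _ _ lam k _ unit (fun=> ext (fun g => (\1_U g)%:E)) tt); last 2 first.
- exact: mseq_ext.
- by move=> _ s; exact: ext_ge0.
set B := [set _ | _]; have BE t : ext (fun g => (\1_U g)%:E) (t : k.-tuple T) = (\1_B t)%:E.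
  rewrite /ext !indicE; case: ifPn => [/[dup] ws /inwin_supp[us sA]|ws].
    rewrite /upos_config us; congr (_%:R%:E); congr nat_of_bool.
    by apply/idP/idP => /set_mem tU; apply/mem_set => //; case: tU => _ [].
  by rewrite memNset// => -[us [_ sA]]; move/negP: ws; apply; exact/inwin_supp.
have mB : measurable B.
  have mE : measurable_fun setT (fun t : k.-tuple T => (\1_B t)%:E : \bar R).
    have mx := @mseq_ext _ mi k.
    have := measurableT_comp mx (pair1_measurable tt).
    by congr measurable_fun; apply/funext => t; exact: BE.
  rewrite (_ : B = (fun t : k.-tuple T => (\1_B t)%:E : \bar R) @^-1` [set 1]).
    by rewrite -[X in measurable X]setTI; exact: (mE measurableT [set 1]).
  apply/seteqP; split=> t; rewrite /preimage/= indicE.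
    by move=> Bt; rewrite mem_set.
  case: (boolP (t \in B)) => [/set_mem//|_] /eqP.
  by rewrite eqe eq_sym oner_eq0.
by under eq_integral do rewrite BE; rewrite integral_indic// setIT.
Qed.

(* [f] need not be measurable: it agrees with a measurable function of the
   configuration on a set of full measure. *)
Lemma poisson_integralW (f : config T -> \bar R) (w : seq T -> \bar R) (good : set T) :
  measurable good -> {ae lam, forall x, good x} ->
  (forall g, 0 <= f g) -> (forall s, 0 <= w s) -> mseq (fun _ : unit => w) ->
  (forall s t, perm_eq s t -> w s = w t) ->
  (forall s, inwin pos A n s -> {in s, forall x, good x} -> f (config_seq s) = w s) ->
  \int[poisson_law]_(g in [set g : config T | g `<=` A n]) f g =
  c%:E * poisson_sum lam z (fun s => if inwin pos A n s then w s else 0).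
Proof.
move=> mgood lgood f0 w0 mw wperm fw; have [nu <- nuE] := poisson_lawP.
have [W [mW W0 Ww]] := symmetric_descent mw w0 wperm.
pose supp := [set g : config T | g `<=` A n].
(* [G] is a measurable set of full measure on which every configuration is enumerated by a sequence
   where [f] is known; this makes up for the missing measurability of [f]. *)
pose G := [set g : config T | [/\ simple_lf A pos g, g `<=` A n & g `<=` good]].
have msub B : measurable B -> measurable [set g : config T | g `<=` B].
  move=> mB; rewrite (_ : [set _ | _] =
      (fun g : config T => ct R (g `&` ~` B)) @^-1` [set 0]); last first.
    apply/seteqP; split=> g; rewrite /preimage/= -[0]/(0%:R%:E) -ctP II0 card_eq0.
      by move=> gB; apply/eqP/seteqP; split=> x // [/gB].
    by move=> /eqP g0 x gx; apply: contrapT => Bx; have : (g `&` ~` B) x by []; rewrite g0.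
  have mBC := measurableC mB.
  by rewrite -[X in measurable X]setTI; exact: (@measurable_ct _ T R _ mBC measurableT [set 0]).
have mG : measurable G.
  rewrite (_ : G = simple_lf A pos `&` ([set g : config T | g `<=` A n] `&`
      [set g : config T | g `<=` good])).
    apply: measurableI; first exact: (@measurable_simple_lf _ T R A mA ndA AT _ pos mpos).
    by apply: measurableI; exact: msub.
  by apply/seteqP; split=> g; [case|case=> ? []].
have GE g : G g -> exists s, [/\ g = config_seq s, inwin pos A n s & {in s, forall x, good x}].
  move=> [[lfg inj] gA ggood]; have fing : finite_set g.
    by rewrite -(setIidl gA); exact: lfg.
  exists (fset_set g); have gE : g = config_seq (fset_set g) by apply: config_ext; rewrite /= fset_setK.
  split=> //.
    apply/inwin_supp; split; last by rewrite -gE.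
    rewrite /upos map_inj_in_uniq ?fset_uniq// => x y.
    by rewrite !in_fset_set// => xg yg; exact: inj.
  by move=> x; rewrite in_fset_set// inE => /ggood.
have nuG : nu (~` G) = 0.
  have mGC := measurableC mG; rewrite -[~` G]setIT -integral_indic//.
  rewrite (nuE (fun g => (\1_(~` G) g)%:E)); last 2 first.
  - exact: measurable_EFin_indic.
  - by move=> g; rewrite lee_fin.
  rewrite (_ : poisson_sum _ _ _ = 0) ?mule0//; rewrite /poisson_sum eseries0// => k _ _.
  rewrite (@eq_iint _ _ _ lam k _ (fun=> 0)).
  - by rewrite (_ : iint _ _ _ = 0) ?mule0//; elim: k => //= k ->; rewrite integral0.
  - by move=> s; apply: ext_ge0 => g; rewrite lee_fin.
  - by [].
  apply: aeseq_impl (aeseq_all k lgood) => s _ sgood; rewrite /ext; case: ifPn => // ws.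
  have [us sA] := (inwin_supp s).1 ws.
  rewrite indicE memNset// => -[]; rewrite /upos_config us; split=> //.
  split=> [m|x y]; first by apply: sub_finite_set (finite_seq s) => x [].
  by rewrite !inE /= => xs ys; exact: (upos_inj us).
have aeG : {ae nu, forall g, G g} by exists (~` G); split => //; exact: measurableC.
rewrite integral_mkcond; transitivity (\int[nu]_g W g).
  apply: ae_ge0_eq_integralW => [g|//|].
    by rewrite patchE; case: ifP.
  apply: filterS aeG => g Gg; have [_ gA _] := Gg; rewrite patchE mem_set//.
  by have [s [-> ws sgood]] := GE _ Gg; rewrite Ww ?fw//; case/andP: ws.
rewrite nuE//; congr (_ * poisson_sum _ _ _); apply/funext => s; rewrite /ext.
by case: ifPn => // /andP[us _]; rewrite /upos_config us Ww.
Qed.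

End poisson_integral.

(** * Marked points in Euclidean space *)

Section energy_weights.
Context (R : realType) (d : nat) (S : normedModType R).
Local Notation E := (mpoint R d S).
Variables (Psi : E -> \bar R) (Phi : E -> E -> \bar R) (beta : R).
Hypothesis beta0 : (0 < beta)%R.
Hypothesis Psi_gt : forall x, -oo < Psi x.
Hypothesis Phi_gt : forall x y, -oo < Phi x y.
Hypothesis Phi_sym : forall x y, Phi x y = Phi y x.

Lemma adde_gtNy (u v : \bar R) : -oo < u -> -oo < v -> -oo < u + v.
Proof. by move: u v => [u| |] [v| |]//= _ _; rewrite -EFinD ltNyr. Qed.

Lemma expeR_sum (I : eqType) (s : seq I) (u : I -> \bar R) (v : I -> R) :
  (forall i, i \in s -> -oo < u i) ->
  (forall i, i \in s -> expeR (- (beta%:E * u i)) = (v i)%:E) ->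
  -oo < \sum_(i <- s) u i /\
  expeR (- (beta%:E * \sum_(i <- s) u i)) = (\prod_(i <- s) v i)%R%:E.
Proof.
elim: s => [|i s IH] u0 uv.
  by rewrite !big_nil mule0 oppe0 /= expR0.
have [|j js|us0 us] := IH; first by move=> j js; apply: u0; rewrite inE js orbT.
  by apply: uv; rewrite inE js orbT.
have ui : -oo < u i by apply: u0; rewrite mem_head.
rewrite !big_cons; split; first exact: adde_gtNy.
by rewrite expeR_neg_mulD// us uv ?mem_head.
Qed.

Lemma expeR_posneg (T : Type) (f : T -> \bar R) x : -oo < f x ->
  expeR (- (beta%:E * f x)) = (bexp beta (f^\+ x) (f^\- x))%:E.
Proof.
move=> fx; rewrite {1}(funeposneg f) expeR_bexp//.
by rewrite funenegE gt_max lteNl/= fx ltry.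
Qed.

Fixpoint pairsum (s : seq E) : \bar R :=
  if s is x :: s' then \sum_(y <- s') Phi x y + pairsum s' else 0.

Lemma pair_energyE s : pair_energy Phi s = pairsum s.
Proof.
elim: s => [|x s IH]; first by rewrite /pair_energy big_ord0.
rewrite /pair_energy /= big_ord_recl; congr (_ + _).
  rewrite big_mkcond big_ord_recl /= add0e [RHS]big_tnth; apply: eq_bigr => i _.
  by rewrite !(tnth_nth x).
rewrite -IH /pair_energy; apply: eq_bigr => i _.
rewrite big_mkcond big_ord_recl /= add0e [RHS]big_mkcond.
apply: eq_bigr => j _; rewrite /bump /= !add1n ltnS; case: ifP => // _.
by rewrite !(tnth_nth x).
Qed.

Lemma expeR_pairsum s : -oo < pairsum s /\
  expeR (- (beta%:E * pairsum s)) = (selfb beta Phi s)%:E.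
Proof.
elim: s => [|x s [IH0 IH]] /=; first by rewrite mulr0 oppr0 expR0.
have [|y _|s0 sE] := @expeR_sum _ s (Phi x) (pairb beta Phi x); first by [].
  exact: expeR_posneg.
by split; [exact: adde_gtNy|rewrite expeR_neg_mulD// sE IH].
Qed.

(** The enumeration behind [energy] is some permutation of [s], and all factors are symmetric.
    Finite negative parts keep every energy above minus infinity, where the exponential turns sums
    into products. *)
Lemma energy_config_seq s (xi : config E) : uniq s ->
  (forall x, x \in s -> \esum_(y in xi) (Phi x)^\- y < +oo) ->
  expeR (- (beta%:E * (energy Psi Phi (config_seq s) +
                       cond_energy Phi (config_seq s) xi))) =
  (selfwt beta Psi Phi s * condbs beta Phi s xi)%:E.
Proof.
move=> us Nfin; rewrite /energy /cond_energy fsbig_finite /=; last exact: finite_seq.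
set t : seq E := fset_set _.
have ts : perm_eq t s.
  apply: uniq_perm => // [|x]; first exact: fset_uniq.
  rewrite (in_fset_set (finite_seq s)).
  by apply/idP/idP => [/set_mem|xs]; last exact/mem_set.
have [|x _|P0 PE] := @expeR_sum _ t Psi (psi beta Psi); first by [].
  exact: expeR_posneg.
rewrite pair_energyE; have [p0 pE] := expeR_pairsum t.
have [||C0 CE] := @expeR_sum _ t (fun x => point_energy Phi x xi) (fun x => condb beta Phi x xi).
- move=> x; rewrite (perm_mem ts) => /Nfin N; rewrite /point_energy.
  apply: adde_gtNy; first by rewrite (lt_le_trans (ltNyr 0))//; exact: esum_ge0.
  by rewrite lteNr.
- move=> x; rewrite (perm_mem ts) => /Nfin N; rewrite /point_energy expeR_bexp//.
    exact: esum_ge0.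
  exact: esum_ge0.
rewrite !expeR_neg_mulD//; last exact: adde_gtNy.
rewrite PE pE CE -!EFinM /selfwt (perm_big _ ts)/= (selfb_perm beta Phi_sym ts).
by rewrite /condbs (perm_big _ ts).
Qed.

End energy_weights.

Lemma measurable_forall_fin dX (X : measurableType dX) (I : finType) (f : X -> I -> bool) :
  (forall i, measurable_fun setT (f ^~ i)) ->
  measurable_fun setT (fun x => [forall i, f x i]).
Proof.
move=> mf; rewrite (_ : (fun _ => _) = (fun x => all (f x) (enum I))).
  elim: (enum I) => [|i s IH] /=; first exact: measurable_cst.
  exact: measurable_and.
apply/funext => x; apply/forallP/allP => [h i _|h i]; first exact: h.
by apply: h; rewrite mem_enum.
Qed.

Section windows.
Context (R : realType) (d : nat) (S : normedModType R).
Local Notation E := (mpoint R d S).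

Definition box (n : nat) : set (Rspace R d) :=
  [set x | forall i, (`|tnth x i : R| <= n%:R)%R].

Definition slab n : set E := box n `*` setT.

Lemma measurable_box n : measurable (box n).
Proof.
rewrite (_ : box n = (fun x : Rspace R d => [forall i, `|tnth x i : R| <= n%:R]%R) @^-1` [set true]).
  rewrite -[X in measurable X]setTI; apply: measurable_forall_fin => // i.
  apply: measurable_fun_ler; last exact: measurable_cst.
  exact: (measurableT_comp (@normr_measurable R setT) (measurable_tnth i)).
by apply/seteqP; split=> x; rewrite /preimage /=; move/forallP.
Qed.

Lemma measurable_slab n : measurable (slab n).
Proof. by apply: measurableX => //; exact: measurable_box. Qed.

Lemma nd_slab n m : (n <= m)%N -> slab n `<=` slab m.
Proof.
move=> nm x [xn _]; split => // i; apply: le_trans (xn i) _.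
by rewrite ler_nat.
Qed.

Lemma box_cover x : exists n, box n x.
Proof.
exists (Num.truncn (\sum_(i < d) `|tnth x i : R|)%R).+1 => i.
apply: (@le_trans _ _ (\sum_(i < d) `|tnth x i : R|)%R).
  by rewrite (bigD1 i)//= lerDl sumr_ge0.
by rewrite ltW// truncnS_gt.
Qed.

Lemma slab_cover x : exists n, slab n x.
Proof. by have [n xn] := box_cover x.1; exists n. Qed.

Lemma bounded_box n : bounded_window (box n).
Proof. by exists n%:R%R. Qed.

Lemma measurable_eq_pos : measurable_fun setT (fun q : E * E => q.1.1 == q.2.1).
Proof.
rewrite (_ : (fun _ => _) = (fun q : E * E =>
    [forall i, (tnth q.1.1 i == tnth q.2.1 i :> R)])).
  apply: measurable_forall_fin => i; apply: measurable_fun_eqr.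
    have m1 : measurable_fun setT (fun q : E * E => q.1.1).
      exact: (measurableT_comp measurable_fst measurable_fst).
    exact: (measurableT_comp (measurable_tnth i) m1).
  have m2 : measurable_fun setT (fun q : E * E => q.2.1).
    exact: (measurableT_comp measurable_fst measurable_snd).
  exact: (measurableT_comp (measurable_tnth i) m2).
apply/funext => q; apply/eqP/forallP => [-> i|h]; first by rewrite eqxx.
by apply: eq_from_tnth => i; exact/eqP/h.
Qed.

End windows.

(** Points sharing the position of [x] lie in a hyperplane orthogonal to the first axis, which is
    Lebesgue null; a first axis exists because [d] is positive. *)
Lemma ae_neq_pos (R : realType) (d : nat) (S : normedModType R)
    (Q : probability (mark S) R) (x : mpoint R d S) : (0 < d)%N ->
  {ae lam Q, forall y : mpoint R d S, y.1 != x.1}.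
Proof.
case: d x => // d [p m] _ /=.
pose B : set (Rspace R d.+1) := [set y | tnth y ord0 = tnth p ord0].
have mB : measurable B.
  rewrite -[X in measurable X]setTI.
  have /(_ measurableT [set tnth p ord0]) := @measurable_tnth _ (measurableTypeR R) d.+1 ord0.
  by apply; exact: measurable_set1.
exists (B `*` setT); split; first exact: measurableX.
  have vB : volume B = 0.
    rewrite /volume /= /pushforward (_ : _ @^-1` _ = [set thead p] `*` setT).
      transitivity (lebesgue_measure [set thead p : R] * (@mpow _ _ R lebesgue_measure d) setT).
        exact: product_measure1E.
      by rewrite lebesgue_measure_set1 mul0e.
    apply/seteqP; split=> -[y t]; rewrite /B /=.
      by rewrite tnth0 => ->.
    by move=> [-> _]; rewrite tnth0.
  transitivity (volume B * Q setT); first exact: product_measure1E.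
  by rewrite vB mul0e.
move=> y /= /negP; rewrite negbK => /eqP yp; split => //.
by rewrite /B /= yp.
Qed.

Section sigma_finite_copy.
Context d (T : measurableType d) (R : realType).
Variable nu : {measure set T -> \bar R}.
Hypothesis sfin : sigma_finite setT nu.

Let copy : set T -> \bar R := nu.

Let copy0 : copy set0 = 0. Proof. exact: measure0. Qed.
Let copy_ge0 B : 0 <= copy B. Proof. exact: measure_ge0. Qed.
Let copy_sigma_additive : semi_sigma_additive copy.
Proof. exact: measure_semi_sigma_additive. Qed.

HB.instance Definition _ := isMeasure.Build _ _ _ copy copy0 copy_ge0 copy_sigma_additive.
HB.instance Definition _ := Measure_isSigmaFinite.Build _ _ _ copy sfin.

Lemma sigma_finite_measureP :
  exists mu : {sigma_finite_measure set T -> \bar R}, (mu : set T -> \bar R) = nu.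
Proof. by exists copy. Qed.

End sigma_finite_copy.

(** * The activity measure [z sigma] and its density *)

Section activity_measure.
Context (R : realType) (d : nat) (S : normedModType R).
Variable Q : probability (mark S) R.
Local Notation E := (mpoint R d S).
Variables (Psi : E -> \bar R) (beta : R).
Hypothesis beta0 : (0 < beta)%R.
Hypothesis mPsi : measurable_fun setT Psi.
Hypothesis Psi_gt : forall x, -oo < Psi x.

Lemma sigma_measureP (z : R) : (0 <= z)%R ->
  exists2 nu : {measure set E -> \bar R},
    (nu : set E -> \bar R) = (fun A => z%:E * sigma Q Psi beta A) &
    forall f, measurable_fun setT f -> (forall x, 0 <= f x) ->
      \int[nu]_x f x = \int[lam Q]_x ((z * psi beta Psi x)%:E * f x).
Proof.
move=> z0; have w0 x : 0 <= (z * psi beta Psi x)%:E by rewrite lee_fin mulr_ge0 ?psi_ge0.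
have mw : measurable_fun setT (fun x => (z * psi beta Psi x)%:E).
  by apply/measurable_EFinP; apply: measurable_funM => //; exact: measurable_psi.
apply: integral_like_measure => [|A|A mA].
- split=> [f g mf f0 mg g0|c f c0 mf f0|f_ f mf f0 ndf ff].
  + rewrite -ge0_integralD//; last 4 first.
    * by move=> x _; exact: mule_ge0.
    * exact: emeasurable_funM.
    * by move=> x _; exact: mule_ge0.
    * exact: emeasurable_funM.
    by apply: eq_integral => x _; rewrite ge0_muleDr.
  + rewrite -ge0_integralZl//; last 2 first.
    * exact: emeasurable_funM.
    * by move=> x _; exact: mule_ge0.
    by apply: eq_integral => x _; rewrite muleCA.
  + apply: ge0_cvg_integral.
    * by move=> n; exact: emeasurable_funM.
    * by move=> n x; exact: mule_ge0.
    * by move=> x n m nm; rewrite lee_wpmul2l//; exact: ndf.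
    * by move=> x; apply: cvgeZl.
- rewrite mule_ge0 ?lee_fin// /sigma; apply: integral_ge0 => x _.
  exact: expeR_ge0.
- have mi := @measurable_EFin_indic _ _ R _ mA.
  have mp : measurable_fun setT (fun x => (psi beta Psi x)%:E).
    by apply/measurable_EFinP; exact: measurable_psi.
  have mE : measurable_fun setT (fun x => expeR (- (beta%:E * Psi x))).
    have -> // : (fun x => expeR (- (beta%:E * Psi x))) = (fun x => (psi beta Psi x)%:E).
    by apply/funext => x; exact: expeR_posneg.
  rewrite /sigma integral_mkcond -ge0_integralZl//; last 2 first.
  + apply/(measurable_restrictT _ mA); exact: measurable_funTS mE.
  + by move=> x _; rewrite patchE; case: ifP => // _; exact: expeR_ge0.
  apply: eq_integral => x _; rewrite patchE indicE EFinM.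
  case: (x \in A); last by rewrite !mule0.
  by rewrite mule1 expeR_posneg.
Qed.

(** Marks are bounded too, unlike in [slab]: the integrability assumption concerns regions bounded
    in both components. *)
Definition ball_region (n : nat) : set E :=
  box n `*` [set m : mark S | (`|m : S| <= n%:R)%R].

Lemma measurable_ball_region n : measurable (ball_region n).
Proof.
apply: measurableX; first exact: measurable_box.
rewrite -[X in measurable X]setCK; apply: measurableC; apply: sub_sigma_algebra.
rewrite (_ : ~` _ = (fun m : S => `|m|%R) @^-1` [set t : R | (n%:R < t)%R]).
  apply: open_comp => [m _|]; [exact: norm_continuous|exact: open_gt].
apply/seteqP; split=> m; rewrite /preimage /=; first by move/negP; rewrite -ltNge.
by move=> nm; apply/negP; rewrite -ltNge.
Qed.

Lemma nd_ball_region n m : (n <= m)%N -> ball_region n `<=` ball_region m.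
Proof.
move=> nm x [xn xm]; split => [i|]; first by apply: le_trans (xn i) _; rewrite ler_nat.
by apply: le_trans xm _; rewrite ler_nat.
Qed.

Lemma ball_region_cover x : exists n, ball_region n x.
Proof.
have [n xn] := box_cover x.1.
pose k := (Num.truncn `|x.2 : S|%R).+1; exists (maxn n k); split => [i|].
  by apply: le_trans (xn i) _; rewrite ler_nat leq_maxl.
apply: (@le_trans _ _ k%:R%R); first by rewrite ltW// truncnS_gt.
by rewrite ler_nat leq_maxr.
Qed.

Lemma bounded_ball_region n : bounded_region (ball_region n).
Proof. by exists n%:R%R => x []. Qed.

Variable c : E -> R.
Hypothesis mc : measurable_fun setT c.
Hypothesis c0 : forall x, (0 <= c x)%R.
Hypothesis c_bounded : forall A, measurable A -> bounded_region A ->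
  \int[sigma Q Psi beta]_(x in A) (expR (c x))%:E < +oo.

Lemma activity_measureP (z : R) : (0 <= z)%R ->
  exists2 mu : {sigma_finite_measure set E -> \bar R},
    (mu : set E -> \bar R) = (fun A => z%:E * sigma Q Psi beta A) &
    forall f, measurable_fun setT f -> (forall x, 0 <= f x) ->
      \int[mu]_x f x = \int[lam Q]_x ((z * psi beta Psi x)%:E * f x).
Proof.
move=> z0; have [nu nuE nu_int] := sigma_measureP z0.
have [s sE s_int] := sigma_measureP (@ler01 R).
have sE' : (s : set E -> \bar R) = sigma Q Psi beta.
  by rewrite sE; apply/funext => A; rewrite mul1e.
have sfin : sigma_finite setT nu.
  exists ball_region; first by apply/seteqP; split => // x _;
    have [n xn] := ball_region_cover x; exists n.
  move=> n; have mB := measurable_ball_region n; split=> //.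
  rewrite [X in X _ < _]nuE; apply: lte_mul_pinfty; rewrite ?lee_fin//.
  rewrite -sE'; apply: le_lt_trans (c_bounded mB (@bounded_ball_region n)).
  rewrite -sE' -[leLHS]mul1e -integral_cst//; apply: ge0_le_integral => //.
  (* Since [c] is non-negative, [1 <= e^c], so the finite weighted mass of the region bounds its
     mass under [sigma]. *)
  - apply/measurable_EFinP; apply: measurable_funTS.
    exact: (measurableT_comp (@measurable_expR R) mc).
  - by move=> x _; rewrite lee_fin -expR0 ler_expR.
have [mu muE] := sigma_finite_measureP sfin.
by exists mu; rewrite muE.
Qed.

End activity_measure.

Lemma poisson_sum0 d (T : measurableType d) (R : realType)
    (lam : {sigma_finite_measure set T -> \bar R}) z : poisson_sum lam z (fun=> 0) = 0.
Proof.
rewrite /poisson_sum eseries0// => k _ _.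
by rewrite (_ : iint _ _ _ = 0) ?mule0//; elim: k => //= k ->; rewrite integral0.
Qed.

Section positive_multiples.
Context (R : realType).

Lemma measurable_inve dX (X : measurableType dX) (f : X -> \bar R) :
  measurable_fun setT f -> (forall x, 0 <= f x) ->
  measurable_fun setT (fun x => (f x)^-1).
Proof.
move=> mf f0; rewrite (_ : (fun _ => _) = (fun x => if f x == 0 then +oo else
    if f x == +oo then 0 else (expR (- ln (fine (f x))))%:E)).
  apply: measurable_fun_ifT; [exact: measurable_fun_eqe|exact: measurable_cst|].
  apply: measurable_fun_ifT; [exact: measurable_fun_eqe|exact: measurable_cst|].
  apply/measurable_EFinP; apply: (measurableT_comp (@measurable_expR R)).
  apply: measurable_funN; apply: (measurableT_comp (@measurable_ln R)).
  exact: (measurableT_comp (fine_measurable measurableT) mf).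
apply/funext => x; have := f0 x; case: (f x) => [r| |]//=; rewrite lee_fin => r0.
by rewrite inver eqe; case: eqP => // /eqP rn0; rewrite expRN lnK// posrE lt0r rn0.
Qed.

(** An infinite factor is allowed, with the convention that infinity times 0 is 0: an inverse
    partition function is only known to be non-negative. Monotonicity prevents the product from
    jumping at the limit. *)
Lemma nd_cvgeZl (c : \bar R) (u : (\bar R)^nat) l : 0 <= c -> (forall n, 0 <= u n) ->
  {homo u : n m / (n <= m)%N >-> n <= m} -> u n @[n --> \oo] --> l ->
  c * u n @[n --> \oo] --> c * l.
Proof.
move=> c0 u0 ndu ul; have [cfin|] := boolP (c \is a fin_num); first exact: cvgeZl.
rewrite ge0_fin_numE// -leNgt leye_eq => /eqP ->.
have [u00|] := pselect (forall n, u n = 0).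
  have uE : u = fun=> 0 by apply/funext.
  have -> : l = 0 by rewrite -(cvg_lim _ ul)// uE; exact: lim_cst.
  rewrite mule0 (_ : (fun n => +oo * u n) = fun=> 0); first exact: cvg_cst.
  by apply/funext => n; rewrite u00 mule0.
move=> /existsNP[k /eqP uk]; have uk0 : 0 < u k by rewrite lt0e uk u0.
have l0 : 0 < l by apply: lt_le_trans uk0 (nd_cvg_lee ndu ul k).
rewrite gt0_mulye//; apply: cvg_near_cst; exists k => // n /= kn.
by rewrite gt0_mulye//; apply: lt_le_trans uk0 (ndu _ _ kn).
Qed.

End positive_multiples.

(** * Consequences of the Gibbs equation in boxes *)

Section gibbs_processes.
Context (R : realType) (d : nat) (S : normedModType R).
Variable Q : probability (mark S) R.
Local Notation E := (mpoint R d S).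
Variables (Psi : E -> \bar R) (Phi : E -> E -> \bar R) (z beta : R).
Hypothesis d0 : (0 < d)%N.
Hypothesis z0 : (0 <= z)%R.
Hypothesis beta0 : (0 < beta)%R.
Hypothesis mPsi : measurable_fun setT Psi.
Hypothesis Psi_gt : forall x, -oo < Psi x.
Hypothesis mPhi : measurable_fun setT (fun q : E * E => Phi q.1 q.2).
Hypothesis Phi_gt : forall x y, -oo < Phi x y.
Hypothesis Phi_sym : forall x y, Phi x y = Phi y x.
Variable P : probability (config E) R.
Hypothesis gibbsP : gibbs Q Psi Phi z beta P.

Let pos (x : E) := x.1.
Let A : nat -> set E := @slab R d S.
Let mpos : measurable_fun setT (fun q : E * E => pos q.1 == pos q.2).
Proof. exact: measurable_eq_pos. Qed.
Let mA n : measurable (A n). Proof. exact: measurable_slab. Qed.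
Let ndA n m : (n <= m)%N -> A n `<=` A m. Proof. exact: nd_slab. Qed.
Let AT x : exists n, A n x. Proof. exact: slab_cover. Qed.
Let lam_pos x : {ae lam Q, forall y, pos y != pos x}. Proof. exact: ae_neq_pos. Qed.

Local Notation box := (@box R d).
Let c n : R := fine (expeR (- (z%:E * volume (box n)))).

Let c_ge0 n : (0 <= c n)%R.
Proof. exact/fine_ge0/expeR_ge0. Qed.

Let poisson_inE n : poisson_in Q z (box n) = poisson_law (lam Q) pos A z (c n) n.
Proof.
apply/funext => U; rewrite /poisson_in /poisson_law; congr (_ * _).
rewrite /c fineK// ge0_fin_numE ?expeR_ge0//.
apply: (@le_lt_trans _ _ (expeR 0)); last by rewrite /= ltry.
rewrite lee_expeR leeNl oppe0 mule_ge0 ?lee_fin//.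
Qed.

Let windowE n (g : config E) : window g (box n) = restr g (A n).
Proof. exact: config_ext. Qed.

Let windowCE n (g : config E) : window g (~` box n) = restr g (~` A n).
Proof.
apply: config_ext; apply/seteqP; split=> x /= [gx nx]; split=> //.
  by move: nx => [nx _] [].
by split=> // h; apply: nx; split.
Qed.

(** Resampling a box produces finitely many points at distinct positions, so the Gibbs equation for
    the bad event in that box gives probability 0. Any two points of a configuration lie in a common
    box. *)
Lemma gibbs_simple_lf : {ae P, forall xi, simple_lf A pos xi}.
Proof.
have mrestr n : measurable_fun setT (fun xi : config E => restr xi (A n)).
  apply: (@measurable_config _ _ R) => B mB; under eq_fun do rewrite -setIA.
  by apply: measurable_ct; exact: measurableI.
have msl : measurable (simple_lf A pos).
  exact: (@measurable_simple_lf _ E R A mA ndA AT _ pos mpos).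
have H n : {ae P, forall xi, simple_lf A pos (restr xi (A n))}.
  pose U := [set xi | ~ simple_lf A pos (restr xi (A n))].
  have mU : measurable U.
    rewrite (_ : U = (fun xi => restr xi (A n)) @^-1` (~` simple_lf A pos))//.
    by rewrite -[X in measurable X]setTI; apply: mrestr => //; exact: measurableC.
  exists U; split=> //.
  have [_ /(_ (\1_U) (measurable_indic mU))] := gibbsP (@measurable_box R d n) (@bounded_box R d n).
  rewrite integral_indic// setIT => -> //; last by exists 1%R => xi; rewrite indicE; case: (_ \in _).
  have goodT : {ae lam Q, forall x : E, [set: E] x} by apply: (@aeW _ E R (lam Q)).
  apply: integral0_eq => xi _.
  rewrite poisson_inE (@poisson_integralW _ E R (lam Q) _ pos mpos A mA ndA AT z (c n) n z0 (c_ge0 n) _ (fun=> 0) setT)//.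
  - by under eq_fun do rewrite if_same; rewrite poisson_sum0 !mule0.
  - by move=> g; rewrite mule_ge0 ?lee_fin// expeR_ge0.
  - by move=> m; exact: measurable_cst.
  move=> s /andP[us sA] _; rewrite indicE memNset ?mul0e//; apply; split.
    move=> m; apply: sub_finite_set (finite_seq s) => x.
    by rewrite windowE windowCE /= => -[[[[xs _]|[_ nx]] Ax] _].
  move=> x y; rewrite windowE windowCE !inE /= => xE yE.
  have inS (w : E) : (config_seq s `&` A n `|` xi `&` ~` A n) w /\ A n w -> w \in s.
    by move=> [[[]|[]]].
  exact: (upos_inj us (inS _ xE) (inS _ yE)).
have /filterS := ae_foralln H; apply => xi sl; split=> [n|x y].
  by have [/(_ n) + _] := sl n; rewrite /= -setIA setIid.
rewrite !inE => xix xiy; have [n xn] := AT x; have [m ym] := AT y.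
have [_] := sl (maxn n m); apply; rewrite inE /=; split=> //.
  exact: (ndA (leq_maxl n m)).
exact: (ndA (leq_maxr n m)).
Qed.

Let negsum x (xi : config E) := \esum_(y in star A xi) (Phi x)^\- y.

(** Well-definedness of the conditional energy of the single point [x], in a box containing it,
    controls the sum outside the box; inside there are finitely many terms, each finite. *)
Lemma gibbs_negsum x : {ae P, forall xi : config E, \esum_(y in xi) (Phi x)^\- y < +oo}.
Proof.
have [n xn] := AT x; pose g := config_seq [:: x].
have [/(_ g (finite_seq _)) H _] := gibbsP (@measurable_box R d n) (@bounded_box R d n).
apply: filterS2 H gibbs_simple_lf => xi + [lfx _].
rewrite windowE windowCE => /(_ x) H; rewrite (esumID (A n))//.
apply: lte_add_pinfty.
  rewrite esum_fset_set//; apply: lte_sum_pinfty => y _.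
  by rewrite funenegE gt_max lteNl/= Phi_gt ltry.
by apply: H; split=> //=; rewrite inE.
Qed.

Let measurable_negsum : measurable_fun setT (fun q : E * config E => negsum q.1 q.2).
Proof.
apply: (@measurable_esum_star _ E R A mA ndA AT _ _ snd measurable_snd
  (fun q : E * config E * E => (Phi q.1.1)^\- q.2)) => //.
have mc : measurable_fun setT (fun q : E * config E * E => (q.1.1, q.2)).
  apply: measurable_fun_pair => //.
  exact: (measurableT_comp measurable_fst measurable_fst).
exact: (measurableT_comp (measurable_Phi_neg mPhi) mc).
Qed.

(** Tonelli exchanges the quantifiers of [gibbs_negsum]. The boundary condition is fixed in the
    Gibbs equation while the inner points vary, so this order is the useful one. *)
Lemma gibbs_negsum_lam : {ae P, forall xi, {ae lam Q, forall x, negsum x xi < +oo}}.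
Proof.
pose h (q : E * config E) : \bar R := if negsum q.1 q.2 == +oo then 1 else 0.
have h0 q : 0 <= h q by rewrite /h; case: ifP.
have mh : measurable_fun setT h.
  apply: measurable_fun_ifT; [|exact: measurable_cst|exact: measurable_cst].
  by apply: measurable_fun_eqe => //; exact: measurable_negsum.
have hz : \int[P]_xi \int[lam Q]_x h (x, xi) = 0.
  have <- := @fubini_tonelli _ _ _ _ _ (lam Q) P h mh h0.
  rewrite integral0_eq// => x _.
  rewrite (@ae_ge0_eq_integralW _ _ _ P _ (fun=> 0)) ?integral0//.
  apply: filterS2 (gibbs_negsum x) gibbs_simple_lf => xi xiN [lfx _].
  by rewrite /h /= /negsum star_lf// ifF//; exact: lt_eqF.
have mG := @measurable_fun_fubini_tonelli_G _ _ _ _ _ (lam Q) h mh h0.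
have G0 xi : 0 <= \int[lam Q]_x h (x, xi) by apply: integral_ge0 => x _; exact: h0.
have : \int[P]_xi `|\int[lam Q]_x h (x, xi)| = 0.
  rewrite -[RHS]hz; apply: eq_integral => xi _; rewrite gee0_abs//.
  exact: G0.
move/(ae_eq_integral_abs _ measurableT mG); apply: filterS => xi /(_ Logic.I) xi0.
have mx : measurable_fun setT (fun x => h (x, xi)).
  exact: (measurableT_comp mh (pair2_measurable xi)).
have : \int[lam Q]_x `|h (x, xi)| = 0.
  by rewrite -[RHS]xi0; apply: eq_integral => x _; rewrite gee0_abs// h0.
move/(ae_eq_integral_abs _ measurableT mx); apply: filterS => x /(_ Logic.I).
rewrite /h /=; case: eqP => [_ /eqP|/eqP xN _]; first by rewrite onee_eq0.
by rewrite lt_neqAle xN leey.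
Qed.

Let spec n := specint pos A beta Psi Phi n.

Let spec_perm n F xi s t : perm_eq s t -> spec n F xi s = spec n F xi t.
Proof.
move=> st; have up : upos pos s = upos pos t by rewrite /upos (perm_uniq (perm_map pos st)).
rewrite /spec /specint /inwin up (perm_all _ st); case: ifPn => // /andP[ut _].
congr (F _ * _%:E).
  apply: config_ext; rewrite /splice /= /upos_config up ut; congr (_ `&` _ `|` _).
  by apply/seteqP; split=> x /=; rewrite (perm_mem st).
rewrite /selfwt (perm_big _ st)/= (selfb_perm beta Phi_sym st).
by rewrite (condbs_perm _ _ _ st).
Qed.

(** For almost every boundary condition, the conditional energy is defined at almost every inner
    point, and there the weight agrees with the measurable one of [specint]. The exceptional set
    does not depend on [F], so numerator and partition function are treated together. *)
Lemma gibbs_window n : {ae P, forall xi, forall F : config E -> \bar R,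
  measurable_fun setT F -> (forall g, 0 <= F g) ->
  \int[poisson_in Q z (box n)]_(g in supported_in (box n))
    (F (superpose (window g (box n)) (window xi (~` box n))) *
     gibbs_weight Psi Phi beta (box n) g xi) =
  (c n)%:E * poisson_sum (lam Q) z (spec n F xi)}.
Proof.
apply: filterS2 gibbs_negsum_lam gibbs_simple_lf => xi good [lfx _] F mF F0.
have wperm : forall s t, perm_eq s t -> spec n F xi s = spec n F xi t.
  by move=> s t; exact: spec_perm.
have mw : mseq (fun _ : unit => spec n F xi).
  move=> m; have mx : measurable_fun setT (fun _ : unit => xi) by exact: measurable_cst.
  have := mseqn_comp mx (@mseq_specint _ E R _ pos mpos A mA ndA AT beta Psi Phi mPsi mPhi n F mF m).
  exact.
have w0 s : 0 <= spec n F xi s by exact: specint_ge0.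
have mgood : measurable [set x | negsum x xi < +oo].
  rewrite (_ : [set _ | _] = ~` ((negsum ^~ xi) @^-1` [set +oo])).
    apply: measurableC; rewrite -[X in measurable X]setTI.
    exact: (measurableT_comp measurable_negsum (pair2_measurable xi)).
  apply/seteqP; split=> x; rewrite /preimage /= ltey; [by move/eqP|by move=> h; apply/eqP].
have f0 g : 0 <= F (superpose (window g (box n)) (window xi (~` box n))) *
     gibbs_weight Psi Phi beta (box n) g xi by rewrite mule_ge0// expeR_ge0.
rewrite poisson_inE (poisson_integralW mpos mA ndA AT z0 (c_ge0 n) mgood good f0 w0 mw wperm).
  congr (_ * poisson_sum _ _ _); apply/funext => s; rewrite /spec /specint.
  by case: (inwin _ _ _ _).
move=> s ws sgood; have [us sA] := andP ws.
rewrite /spec /specint ws /gibbs_weight windowE windowCE.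
have sE : restr (config_seq s) (A n) = config_seq s.
  apply: config_ext; apply/seteqP; split=> x /=; first by case.
  by move=> xs; split=> //; have /= := allP sA _ xs; rewrite inE.
have oE : restr xi (~` A n) = outer A n xi :> set E by rewrite /outer star_lf.
have N x : x \in s -> \esum_(y in restr xi (~` A n)) (Phi x)^\- y < +oo.
  move=> /sgood /=; apply: le_lt_trans; rewrite /negsum star_lf//.
  rewrite [leRHS](esumID (~` A n))// leeDl//; exact: esum_ge0.
have e := @energy_config_seq R d S Psi Phi beta beta0 Psi_gt Phi_gt Phi_sym s
  (restr xi (~` A n)) (upos_uniq us) N.
rewrite sE e oE; congr (F _ * _).
apply: config_ext; rewrite /splice /= star_lf//.
rewrite /upos_config us; congr (_ `|` _).
by rewrite -[LHS]/(config_seq s : set E) -sE.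
Qed.

Let gibbs_weight_ge0 L g xi : 0 <= gibbs_weight Psi Phi beta L g xi.
Proof. by rewrite /gibbs_weight; exact: expeR_ge0. Qed.

Let poisson_in_ge0 n V (f : config E -> \bar R) : (forall g, 0 <= f g) ->
  0 <= \int[poisson_in Q z (box n)]_(g in V) f g.
Proof.
move=> f0; rewrite poisson_inE.
have [nu <- _] := @poisson_lawP _ E R (lam Q) _ pos mpos A mA z (c n) n z0 (c_ge0 n).
by apply: integral_ge0 => g _.
Qed.

(** The Gibbs equation concerns bounded functionals; it is used for indicators, and both sides are
    additive, homogeneous and monotone continuous, which extends it to all non-negative measurable
    functionals. *)
Lemma gibbs_dlr : dlr (lam Q) pos A beta z Psi Phi P.
Proof.
move=> n; pose ps F xi := poisson_sum (lam Q) z (spec n F xi).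
have spec0 F xi s : (forall g, 0 <= F g) -> 0 <= spec n F xi s by exact: specint_ge0.
have mspec F : measurable_fun setT F -> mseq (spec n F).
  exact: (mseq_specint mpos mA ndA AT beta mPsi mPhi).
have ps0 F xi : (forall g, 0 <= F g) -> 0 <= ps F xi.
  by move=> F0; apply: poisson_sum_ge0 => // s; exact: spec0.
have mps F : measurable_fun setT F -> (forall g, 0 <= F g) -> measurable_fun setT (ps F).
  move=> mF F0; apply: measurable_poisson_sum => //; first exact: mspec.
  by move=> xi s; exact: spec0.
have one0 (g : config E) : 0 <= cst 1 g :> \bar R by rewrite /= lee01.
(* By [gibbs_window] with [F = 1], the inverted quantity is almost surely the partition function;
   the other [c n] normalises the Poisson sum in the numerator. *)
pose zeta xi := ((c n)%:E * ps (cst 1) xi)^-1 * (c n)%:E.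
have Z0 xi : 0 <= (c n)%:E * ps (cst 1) xi by rewrite mule_ge0 ?ps0// lee_fin.
have mzeta : measurable_fun setT zeta.
  apply: emeasurable_funM; last exact: measurable_cst.
  apply: measurable_inve => //; apply: emeasurable_funM; first exact: measurable_cst.
  by apply: mps => //; exact: measurable_cst.
have zeta0 xi : 0 <= zeta xi by rewrite mule_ge0 ?lee_fin// inve_ge0.
exists zeta; split=> // F mF F0.
pose J G := \int[P]_xi (zeta xi * ps G xi).
apply: (integral_like_unique (integral_like_integral P) (J := J)) => // [|U mU].
  split=> [f g mf f0 mg g0|k f k0 mf f0|f_ f mf f0 ndf ff].
  - rewrite /J -ge0_integralD//; last 4 first.
    + by move=> xi _; rewrite mule_ge0// ps0.
    + by apply: emeasurable_funM => //; exact: mps.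
    + by move=> xi _; rewrite mule_ge0// ps0.
    + by apply: emeasurable_funM => //; exact: mps.
    apply: eq_integral => xi _; rewrite -ge0_muleDr ?ps0//; congr (_ * _).
    rewrite /ps -(poisson_sumD _ z0); last 4 first.
    + exact: mspec.
    + exact: mspec.
    + by move=> xi' s; exact: spec0.
    + by move=> xi' s; exact: spec0.
    congr poisson_sum; apply/funext => s; rewrite /spec /specint.
    case: ifP => _; last by rewrite adde0.
    by rewrite ge0_muleDl.
  - rewrite /J -ge0_integralZl//; last 2 first.
    + by apply: emeasurable_funM => //; exact: mps.
    + by move=> xi _; rewrite mule_ge0// ps0.
    apply: eq_integral => xi _; rewrite muleCA; congr (_ * _).
    have mk : mseq (fun _ : unit => spec n f xi).
      move=> m; have mx : measurable_fun setT (fun _ : unit => xi) by exact: measurable_cst.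
      have := mseqn_comp mx (@mspec f mf m); exact.
    rewrite /ps -(poisson_sumZ (lam Q) z0 k0 mk); last by move=> s; exact: spec0.
    congr poisson_sum; apply/funext => s; rewrite /spec /specint.
    by case: ifP => _; rewrite ?mule0// muleA.
  - have fg0 g : 0 <= f g by apply: le_trans (f0 0%N g) (nd_cvg_lee (ndf g) (ff g) 0%N).
    have spec_le m k xi s : (m <= k)%N -> spec n (f_ m) xi s <= spec n (f_ k) xi s.
      move=> mk; rewrite /spec /specint; case: ifP => // _.
      by apply: lee_wpmul2r; [rewrite lee_fin mulr_ge0 ?selfwt_ge0 ?condbs_ge0|exact: ndf].
    have ndps xi : {homo (fun m => ps (f_ m) xi) : m k / (m <= k)%N >-> m <= k}.
      move=> m k mk; apply: lee_nneseries => [i _ _|i _].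
        by rewrite mule_ge0 ?lee_fin ?divr_ge0 ?exprn_ge0// iint_ge0// => s; exact: spec0.
      rewrite lee_wpmul2l ?lee_fin ?divr_ge0 ?exprn_ge0//.
      apply: le_iint => [s|s|]; [exact: spec0..|].
      by apply: aeseqW => s _; exact: spec_le.
    apply: ge0_cvg_integral.
    + by move=> m; apply: emeasurable_funM => //; exact: mps.
    + by move=> m xi; rewrite mule_ge0// ps0.
    + by move=> xi m k mk; rewrite lee_wpmul2l//; exact: ndps.
    move=> xi; apply: nd_cvgeZl => //; first by move=> m; exact: ps0.
    apply: (@cvg_poisson_sum _ E R (lam Q) z z0 _ (config E) (fun m => spec n (f_ m)) (spec n f) xi).
    + by move=> m; exact: mspec.
    + by move=> m xi' s; exact: spec0.
    + by move=> xi' s m k mk; exact: spec_le.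
    move=> xi' s; rewrite /spec /specint; case: ifP => _; last exact: cvg_cst.
    by apply: cvgeZr.
have mi := @measurable_EFin_indic _ _ R _ mU.
have [_ /(_ (\1_U) (measurable_indic mU))] := gibbsP (@measurable_box R d n) (@bounded_box R d n).
move=> -> //; last by exists 1%R => xi; rewrite indicE; case: (_ \in _).
apply: ae_ge0_eq_integralW.
- move=> xi; apply: mule_ge0.
    by rewrite inve_ge0; apply: poisson_in_ge0 => g; exact: gibbs_weight_ge0.
  apply: poisson_in_ge0 => g; apply: mule_ge0; last exact: gibbs_weight_ge0.
  by rewrite lee_fin.
- by move=> xi; rewrite mule_ge0// ps0// => g; rewrite lee_fin.
apply: filterS (gibbs_window n) => xi H; rewrite (H (fun g => (\1_U g)%:E))//.
rewrite /zeta -muleA; congr (_^-1 * _).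
have m1 : measurable_fun setT (cst 1 : config E -> \bar R) by exact: measurable_cst.
rewrite /ps -(H _ m1 one0) /partition_function; congr integral.
by apply/funext => g; rewrite /= mul1e.
Qed.

End gibbs_processes.

Lemma aeseq_dominated d (T : measurableType d) (R : realType)
    (nu mu : {sigma_finite_measure set T -> \bar R}) :
  (forall U, measurable U -> nu U = 0 -> mu U = 0) ->
  forall n (Pr : seq T -> Prop), aeseq nu n Pr -> aeseq mu n Pr.
Proof.
move=> dom; elim=> [//|n IH] Pr [N [mN N0 H]].
exists N; split=> //; first exact: dom.
by move=> x nx; apply: H => hx; apply: nx; exact: IH.
Qed.

Section separation.
Context (R : realType) (d : nat) (S : normedModType R).
Local Notation E := (mpoint R d S).

(** Pairs of an axis and a rational threshold, coded by integers, give a countable measurable family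
    separating distinct positions; codes of no pair give the empty set. *)
Definition halfspace (k : nat) : set E :=
  if choice.unpickle k is Some (j, q) then
    [set x : E | (tnth x.1 (j : 'I_d) < ratr q :> R)%R] else set0.

Lemma measurable_halfspace k : measurable (halfspace k).
Proof.
rewrite /halfspace; case: choice.unpickle => [[j q]|]; last exact: measurable0.
have mt : measurable_fun setT (fun x : E => tnth x.1 j : R).
  exact: (measurableT_comp (measurable_tnth j) measurable_fst).
have /(_ measurableT [set true]) := measurable_fun_ltr mt (@measurable_cst _ _ _ _ setT (ratr q : R)).
by rewrite setTI; apply.
Qed.

Lemma halfspace_separation (x y : E) : x.1 <> y.1 -> exists k,
  halfspace k x /\ ~ halfspace k y \/ halfspace k y /\ ~ halfspace k x.
Proof.
move=> xy; have [j xyj] : exists j, tnth x.1 j <> tnth y.1 j.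
  apply: contrapT => h; apply: xy; apply: eq_from_tnth => j.
  by apply: contrapT => xyj; apply: h; exists j.
wlog lexy : x y {xy} xyj / (tnth x.1 j < tnth y.1 j :> R)%R.
  move=> H; have [l|l|/xyj//] := ltgtP (tnth x.1 j : R) (tnth y.1 j); first exact: H.
  by have [k [hk|hk]] := H y x (nesym xyj) l; exists k; [right|left].
have [q] := rat_in_itvoo lexy; rewrite in_itv /= => /andP[xq qy].
exists (choice.pickle (j, q)); left; rewrite /halfspace choice.pickleK /=; split => //.
by apply/negP; rewrite -leNgt ltW.
Qed.

End separation.

(** * Uniqueness of the Gibbs point process below the critical activity *)

Theorem theorem2 (R : realType) (d : nat) (S : normedModType R)
    (Q : probability (mark S) R) (delta beta zcrit a0 : R)
    (Psi : mpoint R d S -> \bar R)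
    (Phi : mpoint R d S -> mpoint R d S -> \bar R)
    (a b : mpoint R d S -> R) :
  (0 < d)%N -> (0 < delta)%R ->
  \int[Q]_m (expR (`|m : S| `^ (d%:R + 2 * delta)))%:E < +oo ->
  (0 < beta)%R ->
  measurable_fun setT Psi -> (forall x, -oo < Psi x) ->
  measurable_fun setT (fun p : mpoint R d S * mpoint R d S => Phi p.1 p.2) ->
  (forall x y, -oo < Phi x y) -> (forall x y, Phi x y = Phi y x) ->
  measurable_fun setT b -> (forall x, (0 <= b x)%R) ->
  measurable_fun setT a -> (0 < a0)%R -> (forall x, (a0 <= a x)%R) ->
  (* (1) *)
  (exists APsi : R, (0 < APsi)%R /\
    forall m : mark S,
      (- (APsi * `|m : S| `^ (d%:R + delta)))%:E <=
        ereal_inf [set Psi (x, m) | x in [set: Rspace R d]]) ->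
  (* (2) weak stability *)
  (forall (N : nat) (x : N.+1.-tuple (mpoint R d S)), uniq x ->
    exists j : 'I_N.+1,
      (- b (tnth x j))%:E <=
        beta%:E * \sum_(i < N.+1 | i != j) Phi (tnth x j) (tnth x i)) ->
  (* (3) weighted regularity *)
  (0 < zcrit)%R ->
  (forall x, zcrit%:E *
      \int[sigma Q Psi beta]_y ((expR (a y + b y))%:E *
                                `|expeR (- (beta%:E * Phi x y)) - 1|)
    <= (a x)%:E) ->
  (forall A : set (mpoint R d S), measurable A -> bounded_region A ->
    \int[sigma Q Psi beta]_(x in A) (expR (a x + b x))%:E < +oo) ->
  (* (4) non-uniform Ruelle bound *)
  (forall z : R, (0 < z < zcrit)%R ->
    forall P : probability (config (mpoint R d S)) R,
    gibbs Q Psi Phi z beta P ->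
    forall N : nat, (0 < N)%N ->
    forall rho : N.-tuple (mpoint R d S) -> \bar R,
    correlation_function (fun A => z%:E * sigma Q Psi beta A) P rho ->
    {ae mpow (sigma Q Psi beta) N, forall t,
      rho t <= (\prod_(i < N) expR (a (tnth t i) + b (tnth t i)))%:E}) ->
  forall z : R, (0 < z < zcrit)%R ->
  forall P P' : probability (config (mpoint R d S)) R,
    gibbs Q Psi Phi z beta P -> gibbs Q Psi Phi z beta P' ->
    forall A : set (config (mpoint R d S)), measurable A -> P A = P' A.
Proof.
move=> d_gt0 _ _ beta0 mPsi Psi_gt mPhi Phi_gt Phi_sym mb b0 ma a0_gt0 a0a _.
move=> stab zcrit0 reg c_bounded ruelle z /[dup] zz /andP[z_gt0 zlt] P P' gP gP'.
pose E := mpoint R d S; pose pos (x : E) := x.1; pose A : nat -> set E := @slab R d S.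
pose c (x : E) : R := (a x + b x)%R; pose theta : R := (z / zcrit)%R.
have z0 := ltW z_gt0.
have a_ge0 x : (0 <= a x)%R by exact: le_trans (ltW a0_gt0) (a0a x).
have mc : measurable_fun setT c by exact: measurable_funD.
have c0 x : (0 <= c x)%R by rewrite addr_ge0.
have [mu muE mu_int] := activity_measureP beta0 mPsi Psi_gt mc c0 c_bounded z0.
have [sg sgE sg_int] := activity_measureP beta0 mPsi Psi_gt mc c0 c_bounded (@ler01 R).
have sgE' : sigma Q Psi beta = sg.
  by rewrite sgE; apply/funext => B; rewrite mul1e.
have mu_sg f : measurable_fun setT f -> (forall x, 0 <= f x) ->
    \int[mu]_x f x = z%:E * \int[sg]_x f x.
  move=> mf f0; rewrite mu_int// sg_int// -ge0_integralZl//.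
  - by apply: eq_integral => x _; rewrite mul1r EFinM muleA.
  - apply: emeasurable_funM => //; apply/measurable_EFinP; apply: measurable_funM => //.
    exact: measurable_psi.
  - by move=> x _; rewrite mule_ge0// lee_fin mul1r psi_ge0.
have mpos : measurable_fun setT (fun q : E * E => pos q.1 == pos q.2).
  exact: measurable_eq_pos.
have mA n : measurable (A n) by exact: measurable_slab.
have ndA n m : (n <= m)%N -> A n `<=` A m by exact: nd_slab.
have AT x : exists n, A n x by exact: slab_cover.
have lam_pos x : {ae lam Q, forall y, pos y != pos x} by exact: ae_neq_pos.
have mu_pos x : {ae mu, forall y, pos y != pos x}.
  have [N [mN N0 H]] := lam_pos x; exists N; split=> //.
  have mi := @measurable_EFin_indic _ E R _ mN.
  rewrite -[N]setIT -integral_indic// (mu_int (fun x => (\1_N x)%:E))//.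
  rewrite (@ae_ge0_eq_integralW _ _ _ (lam Q) _ (fun=> 0)) ?integral0//.
    by move=> y; rewrite mule_ge0// lee_fin// mulr_ge0// psi_ge0.
  exists N; split=> // y yN; apply: contrapT => nNy; apply: yN.
  by rewrite /= indicE memNset// mule0.
(* The regularity assumption at activity [zcrit] is scaled down to [z], which leaves the factor
   [theta]. *)
have regular x : \int[mu]_y (expR (a y + b y) * `|pairb beta Phi x y - 1|)%:E <=
    (theta * a x)%:E.
  set f := fun y : E => _.
  have f0 y : 0 <= f y by rewrite lee_fin mulr_ge0 ?expR_ge0.
  have mf : measurable_fun setT f.
    apply/measurable_EFinP; apply: measurable_funM.
      exact: (measurableT_comp (@measurable_expR R) mc).
    apply: (measurableT_comp (@normr_measurable R setT)); apply: measurable_funB => //.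
    exact: (measurableT_comp (measurable_pairb beta mPhi) (pair1_measurable x)).
  rewrite mu_sg//; have := reg x; rewrite sgE'.
  have -> : (fun y => (expR (a y + b y))%:E * `|expeR (- (beta%:E * Phi x y)) - 1|) = f.
    by apply/funext => y; rewrite (expeR_posneg beta0 (Phi_gt x y)) -EFinB -EFinM.
  move=> le1; rewrite (_ : z = theta * zcrit)%R; last by rewrite divfK// gt_eqF.
  by rewrite !EFinM -muleA lee_wpmul2l// lee_fin divr_ge0// ltW.
(* The stable index becomes a splitting of the sequence, and the energy bound is exponentiated into
   a bound on the product of pair factors. *)
have stable s : s != [::] -> uniq s -> exists s1 x s2, s = s1 ++ x :: s2 /\
    (\prod_(y <- s1 ++ s2) pairb beta Phi x y <= expR (b x))%R.
  move=> s0 us; have [N sN] : exists N, size s == N.+1.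
    by case: s s0 {us} => // x s _; exists (size s).
  have [j] := stab N (Tuple sN) us; set x := tnth _ j => xb.
  have js : (j < size s)%N by rewrite (eqP sN).
  have xE : x = nth x s j by exact: tnth_nth.
  have sE : s = take j s ++ x :: drop j.+1 s.
    by rewrite {1}xE -drop_nth// cat_take_drop.
  exists (take j s), x, (drop j.+1 s); split=> //; set s' := take j s ++ _.
  have sp : perm_eq s (x :: s') by rewrite {1}sE perm_catC /= perm_cons perm_catC.
  have xs' : x \notin s' by move: us; rewrite (perm_uniq sp) => /andP[].
  have sumE : \sum_(i < N.+1 | i != j) Phi x (tnth (Tuple sN) i) =
      \sum_(y <- s') Phi x y.
    transitivity (\sum_(y <- s) if y == x then 0 else Phi x y).
      pose G y := if y == x then 0 else Phi x y.
      rewrite (big_tuple _ _ (Tuple sN) xpredT G) big_mkcond /=.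
      apply: eq_bigr => i _; rewrite /G /x (inj_eq (tuple_uniqP (Tuple sN) us)).
      by case: eqP.
    rewrite (perm_big _ sp) big_cons eqxx /= add0e big_seq [RHS]big_seq.
    by apply: eq_bigr => y ys; case: eqP => // yx; move: xs'; rewrite -yx ys.
  have [|y _|_ pE] := @expeR_sum _ beta beta0 _ s' (Phi x) (pairb beta Phi x).
  - by move=> y _; exact: Phi_gt.
  - exact: expeR_posneg.
  rewrite -lee_fin -pE -sumE -[leRHS]/(expeR (b x)%:E) lee_expeR leeNl.
  by rewrite -EFinN.
have admissibleP Pr : gibbs Q Psi Phi z beta Pr ->
    admissible (lam Q) mu pos A beta z Psi Phi a b Pr.
  move=> gPr; have Pdlr := gibbs_dlr z0 beta0 mPsi Psi_gt mPhi Phi_gt Phi_sym gPr.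
  have Psimple := gibbs_simple_lf z0 gPr.
  split=> // [x|N]; first exact: (gibbs_negsum z0 Phi_gt gPr x).
  have corr_density := @corr_correlation _ _ _ _ _ _ _ mpos lam_pos _ mA ndA AT
    _ _ z0 _ _ mPsi mPhi Phi_sym mu_int _ Pdlr Psimple N.
  (* The Ruelle bound is assumed for positive order; at order 0 both sides equal 1. *)
  have [->|N0] := posnP N; first by rewrite /= corr_nil /weight big_nil.
  rewrite muE in corr_density; have := ruelle z zz Pr gPr N N0 _ corr_density.
  (* The bound holds almost everywhere for [sigma]; [mu] is a multiple of [sigma] and has the same
     statement on its null sets. *)
  rewrite sgE' => bound; apply: (@aeseq_dominated _ _ _ sg mu) => [U mU sgU|].
    have mi := @measurable_EFin_indic _ E R _ mU.
    by rewrite -[U]setIT -integral_indic// (mu_sg (fun x => (\1_U x)%:E))//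
      integral_indic// setIT [X in _ * X]sgU mule0.
  apply: ae_mpow; apply: filterS bound => t; rewrite /weight big_tuple; exact.
have mG : measurable (simple_lf A pos).
  exact: (@measurable_simple_lf _ E R A mA ndA AT _ pos mpos).
apply: (@void_unique _ E R (@ball_region R d S) (@halfspace R d S) _ _ _ _ (simple_lf A pos)) => //.
- exact: measurable_ball_region.
- exact: nd_ball_region.
- exact: ball_region_cover.
- exact: measurable_halfspace.
(* Half-spaces separate positions only, which suffices since distinct points of a simple
   configuration have distinct positions. *)
- move=> xi [_ inj] x y xix xiy xy; apply: halfspace_separation => pxy.
  by apply: xy; apply: inj; rewrite ?inE.
- exact: (gibbs_simple_lf z0 gP).
- exact: (gibbs_simple_lf z0 gP').
move=> B mB [n Bn].
have theta1 : (theta < 1)%R by rewrite ltr_pdivrMr// mul1r.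
apply: (void_probability mpos lam_pos mA ndA AT beta0 z0 mPsi mPhi Phi_sym mu_int
  ma mb a0a regular stable mu_pos a0_gt0 theta1) => //; try exact: admissibleP.
have mf : measurable_fun setT (fun x => (expR (a x + b x))%:E).
  apply/measurable_EFinP; exact: (measurableT_comp (@measurable_expR R) mc).
rewrite integral_mkcond mu_sg; last 2 first.
- by apply/(measurable_restrictT _ mB); exact: measurable_funTS.
- by move=> x; rewrite patchE; case: ifP => // _; rewrite lee_fin expR_ge0.
rewrite -integral_mkcond -sgE'; apply: lte_mul_pinfty; rewrite ?lee_fin//.
apply: c_bounded => //; have [M BM] := @bounded_ball_region R d S n.
by exists M => x /Bn /BM.
Qed.
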